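(* Let $G$ be a nontrivial connected Lie group and let $T\in\mathrm{Aut}(G)$. Then the $T$-action on $\mathrm{Sub}^a_G$ is not expansive.
   Context: $\mathrm{Aut}(G)$ is the group of (bicontinuous) automorphisms of the topological group $G$. $\mathrm{Sub}_G$ is the set of all closed subgroups of the locally compact group $G$ with the Chabauty topology: a sub-basis is given by the sets $\{A\in\mathrm{Sub}_G\mid A\cap K=\emptyset\}$ for $K\subset G$ compact and $\{A\in\mathrm{Sub}_G\mid A\cap U\neq\emptyset\}$ for $U\subset G$ open. It is a compact Hausdorff space. $\mathrm{Sub}^a_G\subset\mathrm{Sub}_G$ is the closed subspace of closed abelian subgroups. Each $T\in\mathrm{Aut}(G)$ acts by the homeomorphism $H\mapsto T(H)$ of $\mathrm{Sub}_G$, and this preserves $\mathrm{Sub}^a_G$. A homeomorphism $\varphi$ of a compact space $X$ is expansive if, for a metric $d$ inducing the topology of $X$, there is $\delta>0$ such that for all $x\neq y$ in $X$ there is $n\in\mathbb{Z}$ with $d(\varphi^n(x),\varphi^n(y))>\delta$ (this does not depend on the choice of compatible metric). The $T$-action on $\mathrm{Sub}^a_G$ is expansive if the homeomorphism $H\mapsto T(H)$ of $\mathrm{Sub}^a_G$ is expansive. *)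

(* Defs.v *)
From HB Require Import structures.
From mathcomp Require Import all_boot all_order all_algebra.
From mathcomp Require Import finmap.
From mathcomp Require Import all_classical all_reals all_analysis.
Import numFieldNormedType.Exports.

Set Implicit Arguments.
Unset Strict Implicit.
Unset Printing Implicit Defensive.

Import Order.TTheory GRing.Theory Num.Theory.
Local Open Scope classical_set_scope.
Local Open Scope ring_scope.

HB.mixin Record Group_isTopologicalGroup G & Group G & Topological G := {
  mulg_continuous : continuous (fun xy : G * G => (xy.1 * xy.2)%g) ;
  invg_continuous : continuous (fun x : G => x^-1%g)
}.

#[short(type="topologicalGroupType")]
HB.structure Definition TopologicalGroup :=
  {G of Group G & Topological G & Group_isTopologicalGroup G}.

Record homeo (X : topologicalType) := Homeo {
  homeo_fun :> X -> X ;
  homeo_inv : X -> X ;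
  homeo_funK : cancel homeo_fun homeo_inv ;
  homeo_invK : cancel homeo_inv homeo_fun ;
  homeo_cont : continuous homeo_fun ;
  homeo_inv_cont : continuous homeo_inv
}.

Definition homeo_iter (X : topologicalType) (f : homeo X) (k : int) : X -> X :=
  match k with
  | Posz n => iter n f
  | Negz n => iter n.+1 (homeo_inv f)
  end.

(* An automorphism is bicontinuous: it is a homeomorphism of G which is
   multiplicative. *)
Record top_aut (G : topologicalGroupType) := TopAut {
  aut_homeo :> homeo G ;
  aut_morph : {morph aut_homeo : x y / (x * y)%g}
}.

(* [metric_for d]: d is a metric on X that induces the given topology of X. *)
Definition metric_for (R : realType) (X : topologicalType) (d : X -> X -> R) :=
  [/\ forall x y, 0 <= d x y,
      forall x y, d x y = 0 <-> x = y,
      forall x y, d x y = d y x,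
      forall x y z, d x z <= d x y + d y z &
      forall x (A : set X),
        nbhs x A <-> exists2 e, 0 < e & [set y | d x y < e] `<=` A].

(* On a compact X the choice of the compatible metric d does not matter, so the
   existential over d makes [~ expansive] a claim about every such metric. *)
Definition expansive (R : realType) (X : topologicalType) (f : homeo X) :=
  exists2 d : X -> X -> R, metric_for d &
    exists2 delta : R, 0 < delta &
      forall x y : X, x <> y ->
        exists k : int, delta < d (homeo_iter f k x) (homeo_iter f k y).

Definition closed_subgroup_set (G : topologicalGroupType) (A : set G) :=
  [/\ closed A, A 1%g,
      forall x y, A x -> A y -> A (x * y)%g &
      forall x, A x -> A (x^-1)%g].

Record closed_subgroup (G : topologicalGroupType) := ClosedSubgroup {
  csub_set :> set G ;
  csub_closed_subgroup : closed_subgroup_set csub_set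
}.

HB.instance Definition _ (G : topologicalGroupType) :=
  gen_eqMixin (closed_subgroup G).
HB.instance Definition _ (G : topologicalGroupType) :=
  gen_choiceMixin (closed_subgroup G).

Definition chabauty_subbase (G : topologicalGroupType) :
    set (set (closed_subgroup G)) :=
  [set W | (exists2 K : set G, compact K &
              W = [set A : closed_subgroup G | A `&` K = set0]) \/
           (exists2 U : set G, open U &
              W = [set A : closed_subgroup G | A `&` U !=set0])].

HB.instance Definition _ (G : topologicalGroupType) :=
  @isSubBaseTopological.Build (closed_subgroup G)
    (set (closed_subgroup G)) (@chabauty_subbase G) id.

Lemma csub_inj (G : topologicalGroupType) : injective (@csub_set G).
Proof.
move=> [A HA] [B HB] /= AB; subst B.
by congr ClosedSubgroup; exact: Prop_irrelevance.
Qed.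

Lemma chabauty_subbase_open (G : topologicalGroupType)
  (W : set (closed_subgroup G)) : chabauty_subbase W -> open W.
Proof.
move=> DW; exists [set W]; last by rewrite bigcup_set1.
move=> _ ->; exists [fset W]%fset; first by move=> V /fset1P ->; rewrite inE.
by rewrite predeqE => A; split=> [|WA V /= /fset1P ->//]; apply; exact/fset1P.
Qed.

Lemma chabauty_openP (G : topologicalGroupType)
    (O : set (closed_subgroup G)) (A : closed_subgroup G) : open O -> O A ->
  exists s : {fset set (closed_subgroup G)},
    [/\ (forall W, W \in s -> chabauty_subbase W /\ W A) &
        (forall B, (forall W, W \in s -> W B) -> O B)].
Proof.
move=> [D sD <-] [V DV VA]; have [s sDs sV] := sD _ DV.
rewrite /= in VA; exists s; split=> [W Ws|B WB].
  split; first by have := sDs _ Ws; rewrite inE.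
  by move: VA; rewrite -sV => /(_ _ Ws).
by exists V => //=; rewrite -sV => W Ws; exact: WB.
Qed.

Lemma chabauty_continuous (X : topologicalType) (G : topologicalGroupType)
    (f : X -> closed_subgroup G) :
  (forall W, chabauty_subbase W -> open (f @^-1` W)) -> continuous f.
Proof.
move=> fo; apply/continuousP => O oO.
rewrite openE => x /= Ofx.
have [s [sW sO]] := chabauty_openP oO Ofx.
have : nbhs x (\bigcap_(W in [set` s]) (f @^-1` W)).
  apply: filter_bigI => W Ws; apply: open_nbhs_nbhs.
  by split; [apply: fo|]; case: (sW _ Ws).
by apply: filterS => y H; apply: sO => W Ws; exact: H.
Qed.

Definition homeo_sym (X : topologicalType) (f : homeo X) : homeo X :=
  Homeo (homeo_invK f) (homeo_funK f) (@homeo_inv_cont _ f) (@homeo_cont _ f).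

Lemma homeo_imageE (X : topologicalType) (f : homeo X) (A : set X) :
  f @` A = homeo_inv f @^-1` A.
Proof.
rewrite predeqE => x; split=> [[y Ay <-]|Ax] /=; first by rewrite homeo_funK.
by exists (homeo_inv f x) => //; rewrite homeo_invK.
Qed.

Lemma aut_inv_morph (G : topologicalGroupType) (T : top_aut G) :
  {morph homeo_sym T : x y / (x * y)%g}.
Proof.
move=> x y; apply: (can_inj (homeo_funK T)).
by rewrite aut_morph /= !homeo_invK.
Qed.

Definition aut_sym (G : topologicalGroupType) (T : top_aut G) : top_aut G :=
  TopAut (@aut_inv_morph G T).

Lemma aut_image_subproof (G : topologicalGroupType) (T : top_aut G)
  (A : closed_subgroup G) : closed_subgroup_set (T @` A).
Proof.
have [cA A1 AM AV] := csub_closed_subgroup A.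
have T1 : T 1%g = 1%g.
  by apply: (@mulgI _ (T 1%g)); rewrite -aut_morph !mulg1.
split.
- rewrite homeo_imageE; apply: preimage_closed => // x _.
  exact: homeo_inv_cont.
- by exists 1%g.
- move=> _ _ [x Ax <-] [y Ay <-]; exists (x * y)%g; first exact: AM.
  exact: aut_morph.
- move=> _ [x Ax <-]; exists (x^-1)%g; first exact: AV.
  by apply: (@mulgI _ (T x)); rewrite -aut_morph !mulgV.
Qed.

Definition aut_image (G : topologicalGroupType) (T : top_aut G)
  (A : closed_subgroup G) := ClosedSubgroup (aut_image_subproof T A).

Lemma aut_imageK (G : topologicalGroupType) (T : top_aut G) :
  cancel (aut_image T) (aut_image (aut_sym T)).
Proof.
move=> A; apply: csub_inj => /=; rewrite image_comp.
rewrite (_ : _ \o _ = id) ?image_id //.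
by apply/funext => x /=; rewrite homeo_funK.
Qed.

Lemma aut_imageVK (G : topologicalGroupType) (T : top_aut G) :
  cancel (aut_image (aut_sym T)) (aut_image T).
Proof.
move=> A; apply: csub_inj => /=; rewrite image_comp.
rewrite (_ : _ \o _ = id) ?image_id //.
by apply/funext => x /=; rewrite homeo_invK.
Qed.

Lemma aut_image_continuous (G : topologicalGroupType) (T : top_aut G) :
  continuous (aut_image T).
Proof.
have TI (A : closed_subgroup G) (B : set G) :
    (T @` A) `&` B = T @` (A `&` (homeo_inv T @` B)).
  rewrite predeqE => x; split.
    move=> [[y Ay <-] By]; exists y => //; split => //.
    by exists (T y) => //; rewrite homeo_funK.
  move=> [y [Ay [z Bz zy]]] <-; split; first by exists y.
  by rewrite -zy homeo_invK.
apply: chabauty_continuous => W [[K cK ->]|[U oU ->]];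
  apply: chabauty_subbase_open; [left|right].
- exists (homeo_inv T @` K).
    apply: continuous_compact => //; apply: continuous_subspaceT.
    exact: homeo_inv_cont.
  rewrite predeqE => A /=; rewrite TI; split=> [|->]; last exact: image_set0.
  exact: image_set0_set0.
- exists (homeo_inv T @` U).
    rewrite (homeo_imageE (homeo_sym T)) /=.
    by apply: open_comp => // x _; exact: homeo_cont.
  rewrite predeqE => A /=; rewrite TI; split=> [[_ [x Ax _]]|[x Ax]].
    by exists x.
  by exists (T x); exists x.
Qed.

(* As a type, this set carries the subspace topology (subtype_topology). *)
Definition abelian_csubs (G : topologicalGroupType) :
    set (closed_subgroup G) :=
  [set A : closed_subgroup G |
    forall x y : G, csub_set A x -> csub_set A y -> commute x y].

Notation SubA G := (set_type (@abelian_csubs G)).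

Lemma aut_image_abelian (G : topologicalGroupType) (T : top_aut G)
  (A : SubA G) : aut_image T (val A) \in @abelian_csubs G.
Proof.
apply/mem_set => _ _ [x Ax <-] [y Ay <-].
rewrite /commute -!aut_morph; congr (T _).
by have /set_mem := valP A; exact.
Qed.

Definition subA_map (G : topologicalGroupType) (T : top_aut G)
  (A : SubA G) : SubA G := SigSub (aut_image_abelian T A).

Lemma subA_map_continuous (G : topologicalGroupType) (T : top_aut G) :
  continuous (subA_map T).
Proof.
apply: continuous_comp_initial => A.
apply: (@continuous_comp _ _ _ (set_val : SubA G -> _) (aut_image T)).
  exact: initial_continuous.
exact: aut_image_continuous.
Qed.

Lemma subA_mapK (G : topologicalGroupType) (T : top_aut G) :
  cancel (subA_map T) (subA_map (aut_sym T)).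
Proof. by move=> A; apply: val_inj; exact: aut_imageK. Qed.

Lemma subA_mapVK (G : topologicalGroupType) (T : top_aut G) :
  cancel (subA_map (aut_sym T)) (subA_map T).
Proof. by move=> A; apply: val_inj; exact: aut_imageVK. Qed.

Definition subA_action (G : topologicalGroupType) (T : top_aut G) :
    homeo (SubA G) :=
  Homeo (@subA_mapK G T) (@subA_mapVK G T)
    (@subA_map_continuous G T) (@subA_map_continuous G (aut_sym T)).

Section lie_group.
Variable R : realType.

(* C^k on an open set U, through iterated partial derivatives. Values of f
   outside U are irrelevant. *)
Fixpoint Ck (k m n : nat) (U : set 'rV[R]_m) (f : 'rV[R]_m -> 'rV[R]_n) :
    Prop :=
  match k with
  | 0 => {in U, continuous f}
  | k'.+1 => {in U, continuous f} /\
      forall i : 'I_m,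
        {in U, forall x, derivable f x (delta_mx 0 i)} /\
        Ck k' U (fun x => 'D_(delta_mx 0 i) f x)
  end.

Definition smooth (m n : nat) (U : set 'rV[R]_m) (f : 'rV[R]_m -> 'rV[R]_n) :=
  forall k, Ck k U f.

(* A chart is a homeomorphism from the open set [chart_dom] onto an open subset
   of R^n; both maps are totalized, with arbitrary values elsewhere. *)
Record chart (X : topologicalType) (n : nat) := Chart {
  chart_dom : set X ;
  chart_map :> X -> 'rV[R]_n ;
  chart_inv : 'rV[R]_n -> X ;
  chart_dom_open : open chart_dom ;
  chart_codom_open : open (chart_map @` chart_dom) ;
  chart_mapK : {in chart_dom, cancel chart_map chart_inv} ;
  chart_cont : {in chart_dom, continuous chart_map} ;
  chart_inv_cont : {in chart_map @` chart_dom, continuous chart_inv}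
}.

Definition chart_codom (X : topologicalType) (n : nat) (a : chart X n) :=
  a @` chart_dom a.

(* A smooth atlas on G for which the group operations are smooth; G x G is read
   in the product charts, with R^n x R^n identified with R^(n + n). *)
Record lie_structure (G : topologicalGroupType) := LieStructure {
  lie_dim : nat ;
  lie_hausdorff : hausdorff_space G ;
  lie_second_countable : @second_countable G ;
  lie_atlas : set (chart G lie_dim) ;
  lie_atlas_cover : forall x, exists2 a, lie_atlas a & chart_dom a x ;
  lie_atlas_compat : forall a b, lie_atlas a -> lie_atlas b ->
    smooth (a @` (chart_dom a `&` chart_dom b)) (fun v => b (chart_inv a v)) ;
  lie_mul_smooth : forall a b c,
    lie_atlas a -> lie_atlas b -> lie_atlas c ->
    let mul v := (chart_inv a (lsubmx v) * chart_inv b (rsubmx v))%g in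
    smooth [set v : 'rV[R]_(lie_dim + lie_dim) |
             [/\ chart_codom a (lsubmx v), chart_codom b (rsubmx v) &
                 chart_dom c (mul v)]]
           (fun v => c (mul v)) ;
  lie_inv_smooth : forall a b, lie_atlas a -> lie_atlas b ->
    smooth [set v | chart_codom a v /\ chart_dom b (chart_inv a v)^-1%g]
           (fun v => b (chart_inv a v)^-1%g)
}.

End lie_group.

(* Main.v *)
Require Import Defs.
From mathcomp Require Import all_boot all_order all_algebra.
From mathcomp Require Import finmap complex.
From mathcomp Require Import all_classical all_reals all_analysis.
From mathcomp Require Import ring lra zify.
Import numFieldNormedType.Exports.
Import Order.TTheory GRing.Theory Num.Theory.

(* One-parameter subgroups t |-> E (t v) are built by hand from the C^2
   estimates of the product: E v is the limit of the powers (v / k)^k. The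
   automorphism T acts on them through a linear map M, which preserves the
   bracket. M has an invariant line or plane; on an invariant plane the bracket
   of a basis is either 0 or an eigenvector of M. Hence M has a nonzero
   invariant subspace whose image by E is commutative. For such a subspace P of
   maximal rank, E P is a closed T-invariant abelian subgroup on which E is a
   local homeomorphism.

   If E is injective on P, take v in P nonzero and compare the subgroups E (Z v)
   and E (Z c v). They are sent by T^k to E (Z w) and E (Z c w), which are close
   uniformly in w when c is close to 1: a bounded multiple m w moves by
   (c - 1) m w only. If E has a kernel on P, the elements of E P killed by 2^k
   form, as k varies, infinitely many T-invariant closed subgroups. By
   compactness of the space of closed subgroups two of them are close. *)

Set Implicit Arguments.
Unset Strict Implicit.
Unset Printing Implicit Defensive.

Local Open Scope classical_set_scope.
Local Open Scope ring_scope.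

(** * Mean value estimates *)

(** Expansiveness quantifies over all times, so two subgroups have to stay close under every iterate
    of [T], whatever the dynamics of [M]. What makes this possible is that, when [E] is injective on
    [P], the points of [E P] near a given point of [G] come from a bounded part of [P], with a bound
    independent of the time. A dense line in a torus has no such property, which is why [E P] has to
    be closed. Closedness comes from maximality: the closure of [E P] is again commutative and
    [T]-stable, so its tangent space is a candidate containing [P] and equals [P]; a local form of
    Cartan's closed subgroup theorem then puts the points of the closure near 1 in [E P].

    The algebra of [E] rests on one characterisation, [lc_expg_cvg]: [E w] is the limit of
    [y i ^+ m i] as soon as [psi (y i)] tends to 0 and [m i] times [psi (y i)] tends to [w].
    Addition, inversion, the Trotter formula and the linear map [M] follow by choosing [y] and [m]
    and using uniqueness of limits.

    Closeness is obtained from common limits in the space of subgroups, so every compatible metric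
    is treated at once. *)

Section row_vector_norm.
Context {R : realType} {n : nat}.
Implicit Types x : 'rV[R]_n.

Lemma rV_norm_le x (c : R) : 0 <= c -> (forall j, `|x 0 j| <= c) -> `|x| <= c.
Proof.
move=> c0 xc; rewrite /Num.Def.normr /= mx_normrE.
by apply: bigmax_le => // -[i j] _ /=; rewrite ord1.
Qed.

Lemma le_rV_norm x j : `|x 0 j| <= `|x|.
Proof.
rewrite [leRHS]/Num.Def.normr /= mx_normrE.
exact: (le_bigmax _ (fun ij => `|x ij.1 ij.2|) (0, j)).
Qed.

End row_vector_norm.

Section mean_value.
Context {R : realType} {m n : nat}.
Implicit Types (F : 'rV[R]_m -> 'rV[R]_n) (z : 'rV[R]_m).

Local Notation e i := (delta_mx 0 i : 'rV[R]_m).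

Lemma is_derive_line F z i j u : derivable F (z + u *: e i) (e i) ->
  is_derive u (1 : R) (fun t => F (z + t *: e i) 0 j)
    (('D_(e i) F (z + u *: e i)) 0 j).
Proof.
move=> dF; rewrite derive_mx// mxE.
have := (derivable_mxP _ _ _).1 dF 0 j; set y := z + u *: e i => dFj.
have E : (fun h : R => h^-1 *: (F (z + (h *: (1 : R) + u) *: e i) 0 j -
    F y 0 j)) =
  (fun h : R => h^-1 *: (F (h *: e i + y) 0 j - F y 0 j)).
  apply/funext => h; congr (_ *: (F _ 0 j - _)).
  by rewrite /y scalerDl addrCA /GRing.scale /= mulr1.
by split; [rewrite /derivable|rewrite /derive]; rewrite /= E.
Qed.

(** The mean value theorem fails for vector values, but the norm is the sup norm: each coordinate
    has its own intermediate point, and the same bound [M] applies at all of them. The sign of [s]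
    is free, hence the [Num.min] and [Num.max]. *)
Lemma line_mean_value F z i (s M : R) (l : 'rV[R]_n) : 0 <= M ->
  (forall u : R, Num.min 0 s <= u <= Num.max 0 s ->
     derivable F (z + u *: e i) (e i) /\
     `|'D_(e i) F (z + u *: e i) - l| <= M) ->
  `|F (z + s *: e i) - F z - s *: l| <= M * `|s|.
Proof.
move=> M0 HF; apply: rV_norm_le => [|j]; first exact: mulr_ge0.
pose g t := F (z + t *: e i) 0 j.
have dg (u : R) : Num.min 0 s <= u <= Num.max 0 s ->
    is_derive u (1 : R) g (('D_(e i) F (z + u *: e i)) 0 j).
  by move=> /HF[dF _]; exact: is_derive_line.
have [c /HF[_ cM] Ec] : exists2 c, Num.min 0 s <= c <= Num.max 0 s &
    g s - g 0 = ('D_(e i) F (z + c *: e i)) 0 j * s.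
  have W (a b : R) : a <= b -> (forall x : R, a <= x <= b ->
      is_derive x (1 : R) g (('D_(e i) F (z + x *: e i)) 0 j)) ->
      exists2 c, a <= c <= b &
      g b - g a = ('D_(e i) F (z + c *: e i)) 0 j * (b - a).
    move=> ab d; have [||c cab E] := MVT_segment ab (f := g)
      (df := fun x => ('D_(e i) F (z + x *: e i)) 0 j).
    - by move=> x xab; apply: d; rewrite !ltW ?(itvP xab).
    - apply: derivable_within_continuous => x xab.
      by have [] := d x _; first by rewrite ?(itvP xab).
    - by exists c => //; rewrite !(itvP cab).
  case: (leP 0 s) dg => s0 dg.
    by have [c c0 E] := W _ _ s0 dg; exists c => //; rewrite E subr0.
  have [c c0 E] := W _ _ (ltW s0) dg; exists c => //.
  by rewrite -opprB E sub0r mulrN opprK.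
have -> : (F (z + s *: e i) - F z - s *: l) 0 j =
    ('D_(e i) F (z + c *: e i) - l) 0 j * s.
  rewrite !mxE mulrBl -Ec /g scale0r addr0.
  by congr (_ - _); rewrite mulrC.
by rewrite normrM ler_wpM2r// (le_trans (le_rV_norm _ _)).
Qed.

(* The coordinates are changed one after another: every intermediate point
   stays in the box spanned by z and z'. *)
Lemma box_mean_value F z z' (M : R) (l : 'I_m -> 'rV[R]_n) : 0 <= M ->
  (forall i, z 0 i != z' 0 i -> forall y : 'rV[R]_m,
     (forall j, Num.min (z 0 j) (z' 0 j) <= y 0 j <= Num.max (z 0 j) (z' 0 j))
       ->
     derivable F y (e i) /\ `|'D_(e i) F y - l i| <= M) ->
  `|F z' - F z - \sum_i (z' 0 i - z 0 i) *: l i| <=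
    M * \sum_i `|z' 0 i - z 0 i|.
Proof.
move=> M0 HF.
pose w k : 'rV[R]_m := \row_j (if (j < k)%N then z' 0 j else z 0 j).
have w0 : w 0 = z by apply/rowP => j; rewrite mxE.
have wm : w m = z' by apply/rowP => j; rewrite mxE ltn_ord.
suff H k : (k <= m)%N -> `|F (w k) - F z -
    \sum_(i < m | (i < k)%N) (z' 0 i - z 0 i) *: l i| <=
    M * \sum_(i < m | (i < k)%N) `|z' 0 i - z 0 i|.
  have S (V : zmodType) (f : 'I_m -> V) :
      \sum_(i < m | (i < m)%N) f i = \sum_i f i.
    by apply: eq_bigl => i; rewrite ltn_ord.
  by have := H m (leqnn _); rewrite wm !S.
elim: k => [_|k IH km].
  by rewrite !big_pred0// w0 !subrr normr0 mulr0.
pose i0 := Ordinal km.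
have Ew : w k.+1 = w k + (z' 0 i0 - z 0 i0) *: e i0.
  apply/rowP => j; rewrite !mxE eqxx /= ltnS leq_eqVlt.
  have [->|ji] := eqVneq j i0.
    by rewrite /= eqxx ltnn /= mulr1 addrC subrK.
  rewrite mulr0 addr0 (_ : (j == k :> nat) = false)//.
  by apply/negbTE; apply: contraNN ji => /eqP jk; apply/eqP/val_inj.
have S (V : zmodType) (f : 'I_m -> V) : \sum_(i < m | (i < k.+1)%N) f i =
    f i0 + \sum_(i < m | (i < k)%N) f i.
  rewrite (bigD1 i0)//=; congr (_ + _); apply: eq_bigl => j.
  by rewrite ltnS ltn_neqAle andbC -(inj_eq val_inj).
rewrite !S mulrDr.
have -> : F (w k.+1) - F z - ((z' 0 i0 - z 0 i0) *: l i0 +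
    \sum_(i < m | (i < k)%N) (z' 0 i - z 0 i) *: l i) =
  (F (w k.+1) - F (w k) - (z' 0 i0 - z 0 i0) *: l i0) +
  (F (w k) - F z - \sum_(i < m | (i < k)%N) (z' 0 i - z 0 i) *: l i).
  by rewrite [RHS]addrACA subrKA opprD.
apply: le_trans (ler_normD _ _) _; apply: lerD; last exact: IH (ltnW km).
have [E|nE] := eqVneq (z 0 i0) (z' 0 i0).
  by rewrite Ew E subrr !scale0r addr0 !subrr !normr0 mulr0.
rewrite Ew; apply: line_mean_value => // u u0; apply: HF => // j.
rewrite !mxE eqxx /=; have [->|ji] := eqVneq j i0.
  rewrite ltnn mulr1; move: u0; rewrite /Num.min /Num.max subr_gt0 ltNge.
  by case: (ltP (z 0 i0) (z' 0 i0)) => _ /=; lra.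
rewrite mulr0 addr0; case: ifP => _.
  by rewrite ge_min le_max lexx !orbT.
by rewrite ge_min le_max lexx.
Qed.

End mean_value.

Lemma derive_eq_line (R : realType) (V W : normedModType R) (F : V -> W) v u l :
  (\forall h \near (0 : R), F (h *: u + v) - F v = h *: l) -> 'D_u F v = l.
Proof.
move=> H; apply: cvg_lim => //; apply: (@cvg_trans _ (cst l @ (0 : R)^')).
  apply: near_eq_cvg; near=> h; rewrite /= (_ : F _ - _ = h *: l).
    by rewrite scalerA mulVf ?scale1r//; near: h; exact: nbhs_dnbhs_neq.
  by near: h; exact: nbhs_dnbhs.
exact: cvg_cst.
Unshelve. all: by end_near. Qed.

(** * Second-order estimates for a product with a neutral element *)

Section two_variables.
Context {R : realType} {n m : nat}.
(* Symmetric description of the two ways to see a vector of R^(n + n) as a pair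
   of vectors: either block may come first. *)
Variables (p q : 'I_n -> 'I_m) (w : 'rV[R]_n -> 'rV[R]_n -> 'rV[R]_m).
Hypothesis pq_sum : forall (V : zmodType) (f : 'I_m -> V),
  \sum_k f k = \sum_i f (p i) + \sum_j f (q j).
Hypothesis pq_case : forall k, (exists i, k = p i) \/ (exists j, k = q j).
Hypothesis wp : forall x y i, w x y 0 (p i) = x 0 i.
Hypothesis wq : forall x y j, w x y 0 (q j) = y 0 j.

Variables (f : 'rV[R]_m -> 'rV[R]_n) (a : 'rV[R]_n) (rho K : R).
Variable beta : 'I_m -> 'I_m -> 'rV[R]_n.
Local Notation e i := (delta_mx 0 i : 'rV[R]_m).
Local Notation D i := (fun v => 'D_(e i) f v).

Hypothesis K0 : 0 <= K.
Hypothesis f_id : forall x, `|x - a| < rho -> f (w x a) = x.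
Hypothesis f_der : forall v :
  'rV[R]_m, (forall k, `|v 0 k - w a a 0 k| < rho) ->
  forall i, derivable f v (e i) /\
  forall j, derivable (D i) v (e j) /\ `|'D_(e j) (D i) v - beta i j| <= K.

Lemma two_var_w (v : 'rV[R]_m) : v = w (\row_i v 0 (p i)) (\row_j v 0 (q j)).
Proof.
apply/rowP => k; case: (pq_case k) => -[i ->]; rewrite ?wp ?wq mxE //.
Qed.

Lemma two_var_ball x y k : `|x - a| < rho -> `|y - a| < rho ->
  `|w x y 0 k - w a a 0 k| < rho.
Proof.
move=> xa ya; case: (pq_case k) => -[i ->]; rewrite ?wp ?wq.
  by have := le_rV_norm (x - a) i; rewrite !mxE => /le_lt_trans; exact.
by have := le_rV_norm (y - a) i; rewrite !mxE => /le_lt_trans; exact.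
Qed.

Lemma two_var_derive_id x i : `|x - a| < rho ->
  'D_(e (p i)) f (w x a) = delta_mx 0 i.
Proof.
move=> xa; apply: derive_eq_line.
have E h : h *: e (p i) + w x a = w (h *: delta_mx 0 i + x) a.
  apply/rowP => k; case: (pq_case k) => -[j ->].
    rewrite !mxE !wp !mxE !eqxx /=; congr (_ * _%:R + _).
    have [->|ji] := eqVneq j i; first by rewrite eqxx.
    (* [p] is injective: if [p j = p i], the pair made of [delta_mx 0 j] and 0 would have the values
       0 and 1 at the same index. *)
    case: eqP => // pji; have := wp (delta_mx 0 j) 0 i; rewrite -pji wp.
    by rewrite !mxE !eqxx eq_sym (negbTE ji) => /eqP; rewrite oner_eq0.
  rewrite !mxE !wq eqxx /=; case: eqP => [qp|_]; last by rewrite mulr0 add0r.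
  (* The two blocks are disjoint: a common index would carry both 1 and 0 in the pair [const_mx 1],
     0. *)
  have := wp (const_mx 1) 0 i; rewrite -qp wq !mxE => /esym/eqP.
  by rewrite oner_eq0.
have N0 : \forall h \near (0 : R), `|h| < rho - `|x - a|.
  by apply: (@nbhs0_lt R R); rewrite subr_gt0.
near=> h; rewrite E !f_id// ?addrK//.
rewrite -addrA; apply: le_lt_trans (ler_normD _ _) _.
rewrite -ltrBrDr normrZ.
have d1 : `|delta_mx 0 i : 'rV[R]_n| <= 1.
  by apply: rV_norm_le => // j; rewrite mxE; case: (_ && _);
    rewrite ?normr1 ?normr0.
apply: (@le_lt_trans _ _ `|h|); first by rewrite ler_piMr.
by near: h; exact: N0.
Unshelve. all: by end_near. Qed.

Lemma sum_norm_rV (x : 'rV[R]_n) : \sum_i `|x 0 i| <= n%:R * `|x|.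
Proof.
apply: le_trans (ler_sum _ (fun i _ => le_rV_norm x i)) _.
by rewrite sumr_const card_ord mulr_natl.
Qed.

(** On the slice [y = a] the derivative along the first block is known exactly, because [f] is the
    identity there. The mean value estimate, applied to this derivative as the second block moves
    from [a] to [y], involves only the mixed second derivatives. *)
Lemma two_var_derive x y i : `|x - a| < rho -> `|y - a| < rho ->
  `|'D_(e (p i)) f (w x y) - (delta_mx 0 i +
     \sum_j (y 0 j - a 0 j) *: beta (p i) (q j))| <= K * (n%:R * `|y - a|).
Proof.
move=> xa ya; have rho0 : 0 < rho by exact: le_lt_trans xa.
have := @box_mean_value R m n (D (p i)) (w x a) (w x y) K
  (fun k => beta (p i) k) K0 _.
rewrite two_var_derive_id// !pq_sum /=.
under eq_bigr do rewrite !wp subrr scale0r.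
rewrite big1// add0r.
under eq_bigr do rewrite !wq.
have -> : \sum_(i < n) `|w x y 0 (p i) - w x a 0 (p i)| = 0.
  by rewrite big1// => j _; rewrite !wp subrr normr0.
have -> : \sum_j `|w x y 0 (q j) - w x a 0 (q j)| =
    \sum_j `|(y - a) 0 j|.
  by apply: eq_bigr => j _; rewrite !wq !mxE.
rewrite add0r -addrA -opprD => H; apply: le_trans (H _) _.
  move=> k _ v vk; apply: (f_der _ (p i)).2 => l.
  have := vk l; case: (pq_case l) => -[j ->]; rewrite ?wp ?wq => hv.
    have := le_lt_trans (le_rV_norm (x - a) j) xa; rewrite !mxE.
    by move: hv; rewrite minxx maxxx -eq_le => /eqP <-.
  have := le_lt_trans (le_rV_norm (y - a) j) ya; rewrite !mxE.
  move: hv; rewrite ge_min le_max ltr_norml ltr_norml.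
  by move=> /andP[/orP[] ? /orP[] ?] /andP[? ?]; apply/andP; split; lra.
by rewrite ler_wpM2l// sum_norm_rV.
Qed.

(** A second mean value estimate, now in the first block, integrates [two_var_derive]; each one
    contributes a factor [n]. There are two uses: [beta = 0] with [K] a bound on the second
    derivatives gives a Lipschitz estimate, and [beta] equal to the second derivatives at the centre
    with [K] small gives the Taylor expansion. *)
Lemma two_var_estimate x x' y :
  `|x - a| < rho -> `|x' - a| < rho -> `|y - a| < rho ->
  `|f (w x y) - f (w x' y) - (x - x') - \sum_i (x 0 i - x' 0 i) *:
     \sum_j (y 0 j - a 0 j) *: beta (p i) (q j)|
   <= K * n%:R ^+ 2 * `|x - x'| * `|y - a|.
Proof.
move=> xa xa' ya; have rho0 : 0 < rho by exact: le_lt_trans xa.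
pose l k := 'D_(e k) f (w a a) + \sum_j (y 0 j - a 0 j) *: beta k (q j).
have lp i : l (p i) = delta_mx 0 i +
    \sum_j (y 0 j - a 0 j) *: beta (p i) (q j).
  by rewrite /l two_var_derive_id// subrr normr0.
have M0 : 0 <= K * (n%:R * `|y - a|) by rewrite !mulr_ge0.
have := @box_mean_value R m n f (w x' y) (w x y) _ l M0 _.
rewrite !pq_sum.
have -> : \sum_(j < n) `|w x y 0 (q j) - w x' y 0 (q j)| = 0.
  by rewrite big1// => j _; rewrite !wq subrr normr0.
have -> : \sum_(j < n) (w x y 0 (q j) - w x' y 0 (q j)) *: l (q j) = 0.
  by rewrite big1// => j _; rewrite !wq subrr scale0r.
have -> : \sum_j `|w x y 0 (p j) - w x' y 0 (p j)| =
    \sum_j `|(x - x') 0 j|.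
  by apply: eq_bigr => j _; rewrite !wp !mxE.
have -> : \sum_j (w x y 0 (p j) - w x' y 0 (p j)) *: l (p j) =
    (x - x') + \sum_i (x 0 i - x' 0 i) *:
     \sum_j (y 0 j - a 0 j) *: beta (p i) (q j).
  rewrite [X in X + _]row_sum_delta -big_split /=; apply: eq_bigr => j _.
  by rewrite !wp lp scalerDr !mxE.
rewrite !addr0 opprD addrA => H; apply: le_trans (H _) _.
  move=> k; case: (pq_case k) => -[i ->]; last by rewrite !wq eqxx.
  move=> _ v vk.
  have vq j : v 0 (q j) = y 0 j.
    by have := vk (q j); rewrite !wq minxx maxxx -eq_le => /eqP.
  (* Balls of the sup norm contain the box spanned by any two of their points. *)
  have va : `|\row_i v 0 (p i) - a| < rho.
    apply: le_lt_trans (_ : Num.max `|x - a| `|x' - a| < rho); last first.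
      by rewrite gt_max xa xa'.
    apply: rV_norm_le => [|j]; first by rewrite le_max normr_ge0.
    have := vk (p j); rewrite !mxE !wp.
    have := le_rV_norm (x - a) j; have := le_rV_norm (x' - a) j.
    rewrite !mxE le_max ge_min le_max.
    rewrite !ler_norml => /andP[? ?] /andP[? ?] /andP[h1 h2].
    have [A|A] := leP (v 0 (p j)) (a 0 j).
      by case/orP: h1 => h1; apply/orP; [right|left]; apply/andP; split; lra.
    by case/orP: h2 => h2; apply/orP; [right|left]; apply/andP; split; lra.
  have vE : v = w (\row_i v 0 (p i)) y.
    rewrite [LHS]two_var_w; congr w; apply/rowP => j.
    by rewrite mxE vq.
  rewrite vE; split.
    apply: (f_der _ _).1 => k'; exact: two_var_ball.
  rewrite lp; exact: two_var_derive.
have -> : K * n%:R ^+ 2 * `|x - x'| * `|y - a| =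
  K * (n%:R * `|y - a|) * (n%:R * `|x - x'|) by ring.
by rewrite ler_wpM2l// sum_norm_rV.
Qed.

End two_variables.

(** * The product of a Lie group to second order *)

Section bilinear_form.
Context {R : realType} {n : nat}.
Variable beta : 'I_n -> 'I_n -> 'rV[R]_n.
Implicit Types u v : 'rV[R]_n.

Definition bform u v := \sum_i u 0 i *: \sum_j v 0 j *: beta i j.

Lemma bformDl u u' v : bform (u + u') v = bform u v + bform u' v.
Proof. by rewrite -big_split; apply: eq_bigr => i _; rewrite mxE scalerDl. Qed.

Lemma bformZl c u v : bform (c *: u) v = c *: bform u v.
Proof.
by rewrite scaler_sumr; apply: eq_bigr => i _; rewrite mxE scalerA.
Qed.

Lemma bformDr u v v' : bform u (v + v') = bform u v + bform u v'.
Proof.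
rewrite -big_split; apply: eq_bigr => i _ /=; rewrite -scalerDr -big_split.
by congr (_ *: _); apply: eq_bigr => j _; rewrite mxE scalerDl.
Qed.

Lemma bformZr c u v : bform u (c *: v) = c *: bform u v.
Proof.
rewrite scaler_sumr; apply: eq_bigr => i _.
rewrite [RHS]scalerA mulrC -scalerA; congr (_ *: _); rewrite scaler_sumr.
by apply: eq_bigr => j _; rewrite mxE scalerA.
Qed.

Lemma bform_bounded : exists2 K, 0 <= K &
  forall u v, `|bform u v| <= K * (`|u| * `|v|).
Proof.
exists (\sum_i \sum_j `|beta i j|); first by rewrite !sumr_ge0// => i _;
  exact: sumr_ge0.
move=> u v; apply: le_trans (ler_norm_sum _ _ _) _; rewrite mulr_suml.
apply: ler_sum => i _; rewrite normrZ mulrCA.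
apply: ler_pM => //; first exact: le_rV_norm.
apply: le_trans (ler_norm_sum _ _ _) _; rewrite mulr_suml.
apply: ler_sum => j _; rewrite normrZ mulrC ler_wpM2l//; exact: le_rV_norm.
Qed.

End bilinear_form.

Lemma le_double_sum (R : realType) m (g : 'I_m -> 'I_m -> R) i j :
  (forall i j, 0 <= g i j) -> g i j <= \sum_i \sum_j g i j.
Proof.
move=> g0; rewrite (bigD1 i)//= (bigD1 j)//= -addrA lerDl addr_ge0 ?sumr_ge0//.
by move=> k _; exact: sumr_ge0.
Qed.

Section C2_product.
Context {R : realType} {n : nat}.
Variables (U : set 'rV[R]_(n + n)) (f : 'rV[R]_(n + n) -> 'rV[R]_n).
Variables (a : 'rV[R]_n) (rho : R).
Hypothesis f_C2 : Ck 2 U f.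
Hypothesis rho0 : 0 < rho.
Hypothesis U_ball : forall x y, `|x - a| < rho -> `|y - a| < rho ->
  U (row_mx x y).
Hypothesis f_idl : forall x, `|x - a| < rho -> f (row_mx x a) = x.
Hypothesis f_idr : forall y, `|y - a| < rho -> f (row_mx a y) = y.

Local Notation e i := (delta_mx 0 i : 'rV[R]_(n + n)).
Local Notation DD i j := (fun v => 'D_(e j) (fun v => 'D_(e i) f v) v).
Local Notation c := (row_mx a a).

(** There are finitely many second partial derivatives, each continuous at [c], so one radius serves
    them all. Keeping [rho'] below [rho] keeps the box inside [U], where the derivatives exist. *)
Lemma C2_product_second_derivative eps : 0 < eps ->
  exists2 rho', 0 < rho' <= rho & forall v : 'rV[R]_(n + n),
  (forall k, `|v 0 k - c 0 k| < rho') ->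
  forall i, derivable f v (e i) /\
  forall j, derivable (fun v => 'D_(e i) f v) v (e j) /\
  `|DD i j v - DD i j c| <= eps.
Proof.
move=> eps0; have Uc : U c by apply: U_ball; rewrite subrr normr0.
have near_c (ij : 'I_(n + n) * 'I_(n + n)) :
    \forall v \near c, `|DD ij.1 ij.2 c - DD ij.1 ij.2 v| <= eps.
  case: ij => i j /=.
  have [_ /(_ i)[_ [_ /(_ j)[_ /= H]]]] := f_C2.
  exact: (((cvgrPdist_le _ _).1 (H c (mem_set Uc))) _ eps0).
have {near_c} : nbhs c [set v | forall ij : 'I_(n + n) * 'I_(n + n),
    `|DD ij.1 ij.2 c - DD ij.1 ij.2 v| <= eps].
  exact: filter_forall near_c.
move=> /nbhs_ballP[d /= d0 dP]; exists (Num.min d rho).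
  by rewrite lt_min d0 rho0 ge_min lexx orbT.
move=> v vc i.
have vU : U v.
  rewrite -(hsubmxK v); apply: U_ball.
    apply: (@le_lt_trans _ _ (\big[Num.max/0]_k `|v 0 k - c 0 k|)).
      apply: rV_norm_le => [|j]; first exact: bigmax_ge_id.
      have := le_bigmax 0 (fun k => `|v 0 k - c 0 k|) (lshift n j).
      by rewrite row_mxEl !mxE.
    apply/bigmax_ltP; split=> // k _.
    by apply: lt_le_trans (vc k) _; rewrite ge_min lexx orbT.
  apply: (@le_lt_trans _ _ (\big[Num.max/0]_k `|v 0 k - c 0 k|)).
    apply: rV_norm_le => [|j]; first exact: bigmax_ge_id.
    have := le_bigmax 0 (fun k => `|v 0 k - c 0 k|) (rshift n j).
    by rewrite row_mxEr !mxE.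
  apply/bigmax_ltP; split=> // k _.
  by apply: lt_le_trans (vc k) _; rewrite ge_min lexx orbT.
have [_ /(_ i)[di [_ Dj]]] := f_C2; split; first exact: di (mem_set vU).
move=> j; have [dj _] := Dj j; split; first exact: dj (mem_set vU).
rewrite distrC; apply: (dP v _ (i, j)).
rewrite -ball_normE /=; apply: le_lt_trans (_ :
  \big[Num.max/0]_k `|v 0 k - c 0 k| < d).
  apply: rV_norm_le => [|k]; first exact: bigmax_ge_id.
  have := le_bigmax 0 (fun k => `|v 0 k - c 0 k|) k.
  by rewrite !mxE distrC.
apply/bigmax_ltP; split=> // k _.
by apply: lt_le_trans (vc k) _; rewrite ge_min lexx.
Qed.

Let sum_lr (V : zmodType) (g : 'I_(n + n) -> V) :
  \sum_k g k = \sum_i g (lshift n i) + \sum_j g (rshift n j).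
Proof. exact: big_split_ord. Qed.

Let sum_rl (V : zmodType) (g : 'I_(n + n) -> V) :
  \sum_k g k = \sum_i g (rshift n i) + \sum_j g (lshift n j).
Proof. by rewrite addrC; exact: big_split_ord. Qed.

Let case_lr (k : 'I_(n + n)) :
  (exists i, k = lshift n i) \/ (exists j, k = rshift n j).
Proof. by case: (split_ordP k) => i ->; [left|right]; exists i. Qed.

Let case_rl (k : 'I_(n + n)) :
  (exists i, k = rshift n i) \/ (exists j, k = lshift n j).
Proof. by case: (split_ordP k) => i ->; [right|left]; exists i. Qed.

Let w_l (x y : 'rV[R]_n) i : row_mx x y 0 (lshift n i) = x 0 i.
Proof. exact: row_mxEl. Qed.

Let w_r (x y : 'rV[R]_n) i : row_mx x y 0 (rshift n i) = y 0 i.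
Proof. exact: row_mxEr. Qed.

(** The two estimates are the same one, read with either block first. Replacing one factor changes
    the product by almost the same vector, with a relative error proportional to the other factor:
    this smallness is what the induction on powers consumes. *)
Lemma C2_product_Lipschitz : exists C rho' : R, [/\ 0 <= C, 0 < rho' <= rho,
  forall x x' y, `|x - a| < rho' -> `|x' - a| < rho' -> `|y - a| < rho' ->
   `|f (row_mx x y) - f (row_mx x' y) - (x - x')| <= C * `|x - x'| * `|y - a| &
  forall x y y', `|x - a| < rho' -> `|y - a| < rho' -> `|y' - a| < rho' ->
   `|f (row_mx x y) - f (row_mx x y') - (y - y')| <= C * `|y - y'| * `|x - a|].
Proof.
have [r /andP[r0 rrho] rP] := C2_product_second_derivative ltr01.
pose K := 1 + \sum_i \sum_j `|DD i j c|.
have K0 : 0 <= K by rewrite addr_ge0// sumr_ge0// => i _; exact: sumr_ge0.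
have der (v : 'rV[R]_(n + n)) : (forall k, `|v 0 k - c 0 k| < r) ->
    forall i, derivable f v (e i) /\
    forall j, derivable (fun v => 'D_(e i) f v) v (e j) /\
    `|DD i j v - 0| <= K.
  move=> hv i; have [d1 H1] := rP v hv i; split; first exact: d1.
  move=> j; have [d2 H2] := H1 j; split; first exact: d2.
  rewrite subr0 -[X in `|X|](subrK (DD i j c)).
  rewrite /K; apply: le_trans (ler_normD _ _) _; apply: (lerD H2).
  exact: (@le_double_sum R (n + n) (fun i j => `|DD i j c|) i j _).
have Z (s t : 'I_n -> R) :
  \sum_(i < n) s i *: \sum_(j < n) t j *: 0 = 0 :> 'rV[R]_n.
  rewrite big1// => i _; rewrite big1 ?scaler0// => j _; exact: scaler0.
exists (K * n%:R ^+ 2), r; split; first by rewrite mulr_ge0 ?exprn_ge0.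
- by rewrite r0.
- move=> x x' y hx hx' hy.
  have H := @two_var_estimate R n (n + n) (@lshift n n) (@rshift n n)
    (fun x y => row_mx x y) sum_lr case_lr
    w_l w_r
    f a r K (fun _ _ => 0) K0 (fun z hz =>
      f_idl (lt_le_trans hz rrho)) der x x' y hx hx' hy.
  by move: H; rewrite Z subr0.
- move=> x y y' hx hy hy'.
  have H := @two_var_estimate R n (n + n) (@rshift n n) (@lshift n n)
    (fun y x => row_mx x y) sum_rl case_rl
    (fun x y => w_r y x) (fun x y => w_l y x)
    f a r K (fun _ _ => 0) K0 (fun z hz =>
      f_idr (lt_le_trans hz rrho)) der y y' x hy hy' hx.
  by move: H; rewrite Z subr0.
Qed.

Lemma C2_product_bilinear : exists beta, forall eps, 0 < eps ->
  exists2 rho', 0 < rho' & forall x y, `|x - a| < rho' -> `|y - a| < rho' ->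
  `|f (row_mx x y) - y - (x - a) - bform beta (x - a) (y - a)| <=
    eps * `|x - a| * `|y - a|.
Proof.
exists (fun i j => DD (lshift n i) (rshift n j) c) => eps eps0.
(* [n%:R ^+ 2] is the factor lost in [two_var_estimate], used below with [x' = a]; the added 1
   avoids a division by zero when [n = 0]. *)
pose eps' := eps / (n%:R ^+ 2 + 1).
have n1 : 0 < n%:R ^+ 2 + 1 :> R by rewrite ltr_wpDl ?exprn_ge0.
have eps'0 : 0 < eps' by rewrite divr_gt0.
have [r /andP[r0 rrho] rP] := C2_product_second_derivative eps'0.
exists r => // x y hx hy.
have aa : `|a - a| < r by rewrite subrr normr0.
have H := @two_var_estimate R n (n + n) (@lshift n n) (@rshift n n)
    (fun x y => row_mx x y) sum_lr case_lr
    w_l w_r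
    f a r eps' (fun i j => DD i j c) (ltW eps'0)
    (fun z hz => f_idl (lt_le_trans hz rrho)) rP x a y hx aa hy.
move: H.
rewrite f_idr; last exact: lt_le_trans rrho.
rewrite (_ : \sum_i _ = bform (fun i j => DD (lshift n i) (rshift n j) c)
    (x - a) (y - a)); last first.
  apply: eq_bigr => i _; rewrite !mxE; congr (_ *: _).
  by apply: eq_bigr => j _; rewrite !mxE.
move=> H; apply: le_trans H _; rewrite !ler_wpM2r//.
rewrite -mulrA ger_pMr// mulrC ler_pdivrMr// mul1r; lra.
Qed.

End C2_product.

(* Both maps are total; lc_psi is meant to be large outside a neighbourhood of
   the identity, so that a bound on it also locates the point. *)
Record local_chart (R : realType) (G : topologicalGroupType) (n : nat) :=
    LocalChart {
  lc_psi : G -> 'rV[R]_n ;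
  lc_xi : 'rV[R]_n -> G ;
  lc_r : R ;
  lc_C : R ;
  lc_beta : 'I_n -> 'I_n -> 'rV[R]_n ;
  lc_r_gt0 : 0 < lc_r ;
  lc_C_ge0 : 0 <= lc_C ;
  lc_Cr : 10 * (lc_C * lc_r) <= 1 ;
  lc_xiK : forall v, `|v| < lc_r -> lc_psi (lc_xi v) = v ;
  lc_psiK : forall x, `|lc_psi x| < lc_r -> lc_xi (lc_psi x) = x ;
  lc_psi1 : lc_psi 1%g = 0 ;
  lc_psi_cont : forall x, `|lc_psi x| < lc_r -> {for x, continuous lc_psi} ;
  lc_xi_cont : forall v, `|v| < lc_r -> {for v, continuous lc_xi} ;
  lc_mulL : forall x x' y, `|lc_psi x| < lc_r -> `|lc_psi x'| < lc_r ->
    `|lc_psi y| < lc_r ->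
    `|lc_psi (x * y)%g - lc_psi (x' * y)%g - (lc_psi x - lc_psi x')| <=
      lc_C * `|lc_psi x - lc_psi x'| * `|lc_psi y| ;
  lc_mulR : forall x y y', `|lc_psi x| < lc_r -> `|lc_psi y| < lc_r ->
    `|lc_psi y'| < lc_r ->
    `|lc_psi (x * y)%g - lc_psi (x * y')%g - (lc_psi y - lc_psi y')| <=
      lc_C * `|lc_psi y - lc_psi y'| * `|lc_psi x| ;
  lc_mul_beta : forall eps, 0 < eps -> exists2 rho, 0 < rho & forall x y,
    `|lc_psi x| < rho -> `|lc_psi y| < rho ->
    `|lc_psi (x * y)%g - lc_psi x - lc_psi y -
       bform lc_beta (lc_psi x) (lc_psi y)| <= eps * `|lc_psi x| * `|lc_psi y|
}.

Lemma chart_codom_inv (R : realType) (G : topologicalGroupType) n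
    (A : chart R G n) v : chart_codom A v ->
  chart_dom A (chart_inv A v) /\ A (chart_inv A v) = v.
Proof. by move=> [g gA <-]; rewrite (chart_mapK (mem_set gA)). Qed.

Lemma nbhs_rV_ball (R : realType) n (v : 'rV[R]_n) (A : set 'rV[R]_n) :
  nbhs v A -> exists2 d, 0 < d & forall w, `|w - v| < d -> A w.
Proof.
move=> /nbhs_ballP[d /= d0 dA]; exists d => // w wv.
by apply: dA; rewrite -ball_normE /= distrC.
Qed.

Lemma local_chart_of_chart (R : realType) (G : topologicalGroupType) n
    (A : chart R G n.+1) : chart_dom A 1%g ->
  let mul v := (chart_inv A (lsubmx v) * chart_inv A (rsubmx v))%g in
  smooth [set v : 'rV[R]_(n.+1 + n.+1) |
           [/\ chart_codom A (lsubmx v), chart_codom A (rsubmx v) &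
               chart_dom A (mul v)]]
         (fun v => A (mul v)) -> inhabited (local_chart R G n.+1).
Proof.
move=> A1 mul sm; set U := (X in smooth X) in sm.
pose a := A 1%g; pose f v := A (mul v).
have ca : chart_codom A a by exists 1%g.
have inva : chart_inv A a = 1%g by exact: chart_mapK (mem_set A1).
have [d1 d10 d1P] : exists2 d, 0 < d & forall w, `|w - a| < d ->
  chart_codom A w.
  by apply: nbhs_rV_ball; apply: open_nbhs_nbhs; split => //;
    exact: chart_codom_open.
have inv_a : chart_inv A x @[x --> a] --> (1%g : G).
  by rewrite -inva; exact: chart_inv_cont (mem_set ca).
have [d2 d20 d2P] : exists2 d, 0 < d & forall x y, `|x - a| < d ->
  `|y - a| < d ->
    chart_dom A (chart_inv A x * chart_inv A y)%g.
  have : nbhs ((1%g : G), (1%g : G)) [set z | chart_dom A (z.1 * z.2)%g].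
    apply: (@mulg_continuous G (1%g, 1%g)); rewrite /= mulg1.
    by apply: open_nbhs_nbhs; split => //; exact: chart_dom_open.
  case=> -[P Q] /= [/inv_a/nbhs_rV_ball[d d0 dP] /inv_a/nbhs_rV_ball[e e0 eQ]]
    PQ.
  exists (Num.min d e); first by rewrite lt_min d0.
  move=> x y; rewrite !lt_min => /andP[xd _] /andP[_ ye].
  by apply: (PQ (_, _)); split; [exact: dP|exact: eQ].
pose rho := Num.min d1 d2.
have rho0 : 0 < rho by rewrite lt_min d10.
have rho1 x : `|x - a| < rho -> `|x - a| < d1 by rewrite lt_min => /andP[].
have rho2 x : `|x - a| < rho -> `|x - a| < d2 by rewrite lt_min => /andP[].
have codom x : `|x - a| < rho -> chart_codom A x by move=> /rho1; exact: d1P.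
have f_row x y : f (row_mx x y) = A (chart_inv A x * chart_inv A y)%g.
  by rewrite /f /mul row_mxKl row_mxKr.
have U_ball x y : `|x - a| < rho -> `|y - a| < rho -> U (row_mx x y).
  move=> hx hy; rewrite /U /= /mul row_mxKl row_mxKr.
  by split; [exact: codom|exact: codom|apply: d2P; exact: rho2].
have f_idl x : `|x - a| < rho -> f (row_mx x a) = x.
  by move=> /codom/chart_codom_inv[_ E]; rewrite f_row inva mulg1.
have f_idr x : `|x - a| < rho -> f (row_mx a x) = x.
  by move=> /codom/chart_codom_inv[_ E]; rewrite f_row inva mul1g.
have [C [s [C0 /andP[s0 srho] mL mR]]] :=
  C2_product_Lipschitz (sm 2) rho0 U_ball f_idl f_idr.
have [beta mB] := C2_product_bilinear (sm 2) rho0 U_ball f_idl f_idr.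
(* This radius gives [10 * (C * r) <= 1], including when [C = 0]. *)
pose r := Num.min s (10 * (C + 1))^-1.
have r0 : 0 < r by rewrite lt_min s0 invr_gt0 mulr_gt0// ltr_wpDl.
have rs : r <= s by rewrite ge_min lexx.
have Cr : 10 * (C * r) <= 1.
  have h : r <= (10 * (C + 1))^-1 by rewrite ge_min lexx orbT.
  apply: le_trans (_ : 10 * (C * (10 * (C + 1))^-1) <= 1).
    by rewrite ler_pM2l// ler_wpM2l.
  by rewrite mulrA ler_pdivrMr ?mul1r ?ler_pM2l ?lerDl// mulr_gt0// ltr_wpDl.
(* Outside the chart [psi] gets a value of norm at least [r], so [psi g] of norm less than [r]
   forces [g] into the chart. In dimension 0 no vector would have that norm. *)
pose psi g : 'rV[R]_n.+1 :=
  if asbool (chart_dom A g) then A g - a else const_mx r.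
pose xi v := chart_inv A (v + a).
have psi_dom g : chart_dom A g -> psi g = A g - a.
  by rewrite /psi; case: asboolP.
have dom_psi g : `|psi g| < r -> chart_dom A g.
  rewrite /psi; case: asboolP => // _ h; exfalso; move: h;
    rewrite ltNge => /negP.
  apply; have := le_rV_norm (const_mx r : 'rV[R]_n.+1) 0.
  by rewrite mxE ger0_norm// ltW.
have psi_a g : `|psi g| < r -> A g = psi g + a.
  by move=> /dom_psi/psi_dom ->; rewrite subrK.
have ball_a v : `|v| < r -> `|v + a - a| < rho.
  by rewrite addrK => /lt_le_trans; apply; exact: le_trans srho.
have xi_dom v : `|v| < r -> chart_dom A (xi v) /\ A (xi v) = v + a.
  by move=> /ball_a/codom; exact: chart_codom_inv.
have psiK g : `|psi g| < r -> xi (psi g) = g.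
  move=> gr; rewrite /xi -psi_a//; apply: chart_mapK; apply: mem_set.
  exact: dom_psi.
have s_psi g : `|psi g| < r -> `|(psi g + a) - a| < s.
  by rewrite addrK => /lt_le_trans; exact.
have psiM x y : `|psi x| < r -> `|psi y| < r ->
    psi (x * y)%g = f (row_mx (psi x + a) (psi y + a)) - a.
  move=> hx hy; have hx' := ball_a _ hx; have hy' := ball_a _ hy.
  have := d2P _ _ (rho2 _ hx') (rho2 _ hy').
  by rewrite f_row -!/(xi _) !psiK// => /psi_dom.
have sub3 (u v w : 'rV[R]_n.+1) : u - w - (v - w) = u - v.
  by rewrite opprB addrA subrK.
have addB (u v w : 'rV[R]_n.+1) : u + w - (v + w) = u - v.
  by rewrite opprD addrACA subrr addr0.
have sub4 (u v w z : 'rV[R]_n.+1) : u - (z + v) - w = u - v - w - z.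
  by rewrite [z + v]addrC opprD addrA [LHS]addrAC.
have psi_1 : psi 1%g = 0 by rewrite psi_dom// subrr.
split; apply: (@LocalChart R G n.+1 psi xi r C beta) => //.
- by move=> v /xi_dom[d E]; rewrite psi_dom// E addrK.
- move=> x /dom_psi xA; change (psi g @[g --> x] --> psi x).
  rewrite [X in _ --> X]psi_dom//.
  apply: (@cvg_trans _ ((fun g => A g - a) @ x)).
    apply: near_eq_cvg; near=> g; apply/esym/psi_dom.
    by near: g; apply: open_nbhs_nbhs; split => //; exact: chart_dom_open.
  by apply: cvgB; [exact: chart_cont (mem_set xA)|exact: cvg_cst].
- move=> v vr; change (chart_inv A (w + a) @[w --> v] --> chart_inv A (v + a)).
  apply: (@cvg_comp _ _ _ (fun v => v + a) (chart_inv A) _ (nbhs (v + a))).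
    apply: (@cvgD _ _ _ (nbhs v) _ id (cst a) v a); first exact: cvg_id.
    exact: cvg_cst.
  by apply: chart_inv_cont; apply: mem_set; exact/codom/ball_a.
- move=> x x' y hx hx' hy; rewrite !psiM// sub3.
  have := mL _ _ _ (s_psi _ hx) (s_psi _ hx') (s_psi _ hy).
  by rewrite addB addrK.
- move=> x y y' hx hy hy'; rewrite !psiM// sub3.
  have := mR _ _ _ (s_psi _ hx) (s_psi _ hy) (s_psi _ hy').
  by rewrite addB addrK.
- move=> eps /mB[d d0 dP]; exists (Num.min d r); first by rewrite lt_min d0.
  move=> x y; rewrite ![_ < Num.min d r]lt_min => /andP[hx hx'] /andP[hy hy'].
  rewrite (psiM _ _ hx' hy').
  have := dP (psi x + a) (psi y + a); rewrite !addrK => /(_ hx hy).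
  by rewrite (sub4 _ a (psi x) (psi y)) -/(f _); apply.
Unshelve. all: by end_near. Qed.

(** * Powers near the identity *)

Section powers.
Context {R : realType} {G : topologicalGroupType} {n : nat}.
Variable L : local_chart R G n.
Local Notation psi := (lc_psi L).
Local Notation r := (lc_r L).
Local Notation C := (lc_C L).
Implicit Types (x y : G) (m k : nat).

(** This is the role of the 10 in [lc_Cr]: inside the chart a product differs from the sum by at
    most a tenth of either factor, and the generous constants 2 and 4 below absorb these errors. *)
Lemma lc_C_small (t : R) : 0 <= t -> t < r -> C * t <= 10^-1.
Proof.
move=> t0 tr; have := lc_Cr L; have := lc_C_ge0 L => C0 Cr.
apply: (@le_trans _ _ (C * r)); first by rewrite ler_wpM2l// ltW.
by lra.
Qed.

Lemma lc_mul_le x y : `|psi x| < r -> `|psi y| < r ->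
  `|psi (x * y)%g - psi x - psi y| <= C * `|psi x| * `|psi y|.
Proof.
move=> hx hy; have h1 : `|psi 1%g| < r by rewrite lc_psi1 normr0 lc_r_gt0.
have := lc_mulL hx h1 hy; rewrite mul1g lc_psi1 subr0.
by rewrite -addrA [- psi y - _]addrC addrA.
Qed.

Lemma lc_mul_le_l x y : `|psi x| < r -> `|psi y| < r ->
  `|psi (x * y)%g - psi x - psi y| <= 10^-1 * `|psi x|.
Proof.
move=> hx hy; apply: le_trans (lc_mul_le hx hy) _.
by rewrite mulrAC ler_wpM2r// lc_C_small.
Qed.

Lemma lc_mul_le_r x y : `|psi x| < r -> `|psi y| < r ->
  `|psi (x * y)%g - psi x - psi y| <= 10^-1 * `|psi y|.
Proof.
move=> hx hy; apply: le_trans (lc_mul_le hx hy) _.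
by rewrite ler_wpM2r// lc_C_small.
Qed.

Lemma norm_le_sub2 (V : normedZmodType R) (u a b : V) (t : R) :
  `|u - a - b| <= t -> `|u| <= `|a| + `|b| + t.
Proof.
move=> h; rewrite -[u](subrK (a + b)) addrC.
apply: le_trans (ler_normD _ _) _; apply: lerD; first exact: ler_normD.
by rewrite opprD addrA.
Qed.

Lemma sub_split (V : zmodType) (u a b c : V) :
  u - (b + c) = (u - a - c) + (a - b).
Proof. by rewrite [u - a - c]addrAC subrKA opprD addrA addrAC. Qed.

Lemma sub_split2 (V : zmodType) (u v w a b : V) :
  u - v = (u - w - a) + (w - v - b) + (a + b).
Proof. by rewrite [u - w - a + _]addrACA subrKA -opprD subrK. Qed.

Lemma lc_expg_le m x : 2 * m%:R * `|psi x| < r ->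
  `|psi (x ^+ m)%g| <= 2 * m%:R * `|psi x|.
Proof.
elim: m => [|m IH] h; first by rewrite expg0 lc_psi1 normr0 mulr0 mul0r.
have x0 := normr_ge0 (psi x); move: h; rewrite -[m.+1%:R]natr1 => h.
have mx0 : 0 <= m%:R * `|psi x| by rewrite mulr_ge0.
have xr : `|psi x| < r by nra.
have IHm : `|psi (x ^+ m)%g| <= 2 * m%:R * `|psi x| by apply: IH; nra.
have hm : `|psi (x ^+ m)%g| < r by nra.
rewrite expgSr; apply: le_trans (norm_le_sub2 (lc_mul_le_r hm xr)) _.
by lra.
Qed.

Lemma lc_expg_sub_le m x : 2 * m%:R * `|psi x| < r ->
  `|psi (x ^+ m)%g - m%:R *: psi x| <= C * (m%:R * `|psi x|) ^+ 2.
Proof.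
elim: m => [|m IH] h.
  by rewrite expg0 lc_psi1 scale0r subrr normr0 mulr_ge0// ?lc_C_ge0//
    exprn_ge0// mulr_ge0.
have x0 := normr_ge0 (psi x); move: h; rewrite -[m.+1%:R]natr1 => h.
have m0 : 0 <= m%:R :> R by [].
have mx0 : 0 <= m%:R * `|psi x| by rewrite mulr_ge0.
have xr : `|psi x| < r by nra.
have hm' : 2 * m%:R * `|psi x| < r by nra.
have hm := le_lt_trans (lc_expg_le hm') hm'.
rewrite expgSr scalerDl scale1r.
have -> : psi (x ^+ m * x)%g - (m%:R *: psi x + psi x) =
  (psi (x ^+ m * x)%g - psi (x ^+ m)%g - psi x) +
    (psi (x ^+ m)%g - m%:R *: psi x).
  exact: sub_split.
apply: le_trans (ler_normD _ _) _.
have h1 := le_trans (lc_mul_le hm xr) (ler_wpM2r x0 (ler_wpM2l (lc_C_ge0 L)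
  (lc_expg_le hm'))).
apply: le_trans (lerD h1 (IH hm')) _.
rewrite -subr_ge0 (_ : _ - _ = C * `|psi x| ^+ 2); last by ring.
by rewrite mulr_ge0 ?lc_C_ge0// exprn_ge0.
Qed.

(** The error at step [m] is [C *]|psi x|[times the difference accumulated so far, that is]4 *
    m%:R[times the initial one. As]m%:R * [|psi x|] is bounded, each step adds a bounded multiple of
    the initial difference and nothing grows exponentially. *)
Lemma lc_expg_lipschitz m x y : 2 * m%:R * `|psi x| < r ->
  2 * m%:R * `|psi y| < r ->
  `|psi (x ^+ m)%g - psi (y ^+ m)%g| <= 4 * m%:R * `|psi x - psi y|.
Proof.
elim: m => [|m IH] hx hy; first by rewrite !expg0 subrr normr0 mulr0 mul0r.
have x0 := normr_ge0 (psi x); have y0 := normr_ge0 (psi y).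
move: hx hy; rewrite -[m.+1%:R]natr1 => hx hy.
have m0 : 0 <= m%:R :> R by [].
have mx0 : 0 <= m%:R * `|psi x| by rewrite mulr_ge0.
have my0 : 0 <= m%:R * `|psi y| by rewrite mulr_ge0.
have xr : `|psi x| < r by nra.
have yr : `|psi y| < r by nra.
have hx' : 2 * m%:R * `|psi x| < r by nra.
have hy' : 2 * m%:R * `|psi y| < r by nra.
have xmr := le_lt_trans (lc_expg_le hx') hx'.
have ymr := le_lt_trans (lc_expg_le hy') hy'.
have {}IH := IH hx' hy'.
have d0 := normr_ge0 (psi x - psi y).
have h1 := lc_mulL xmr ymr xr; have h2 := lc_mulR ymr xr yr.
rewrite !expgSr.
have -> : psi (x ^+ m * x)%g - psi (y ^+ m * y)%g =
  (psi (x ^+ m * x)%g - psi (y ^+ m * x)%g - (psi (x ^+ m)%g - psi (y ^+ m)%g))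
  + (psi (y ^+ m * x)%g - psi (y ^+ m * y)%g - (psi x - psi y))
  + ((psi (x ^+ m)%g - psi (y ^+ m)%g) + (psi x - psi y)).
  exact: sub_split2.
apply: le_trans (ler_normD _ _) _.
have e1 : `|(psi (x ^+ m * x)%g - psi (y ^+ m * x)%g -
    (psi (x ^+ m)%g - psi (y ^+ m)%g)) +
   (psi (y ^+ m * x)%g - psi (y ^+ m * y)%g - (psi x - psi y))| <=
   (C * `|psi x|) * `|psi (x ^+ m)%g - psi (y ^+ m)%g| +
   10^-1 * `|psi x - psi y|.
  apply: le_trans (ler_normD _ _) _; apply: lerD; first by rewrite mulrAC.
  by apply: le_trans h2 _; rewrite mulrAC ler_wpM2r// lc_C_small.
have e2 : `|(psi (x ^+ m)%g - psi (y ^+ m)%g) + (psi x - psi y)| <=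
    4 * m%:R * `|psi x - psi y| + `|psi x - psi y|.
  by apply: le_trans (ler_normD _ _) _; rewrite lerD2r.
have e3 : C * `|psi x| * `|psi (x ^+ m)%g - psi (y ^+ m)%g| <=
    `|psi x - psi y|.
  apply: le_trans (ler_wpM2l _ IH) _; first by rewrite mulr_ge0 ?lc_C_ge0.
  have -> : C * `|psi x| * (4 * m%:R * `|psi x - psi y|) =
    2 * (C * (2 * m%:R * `|psi x|)) * `|psi x - psi y| by ring.
  rewrite ler_piMl//; have := lc_C_small _ hx'; rewrite !mulr_ge0// => /(_ isT).
  by lra.
apply: le_trans (lerD e1 e2) _; lra.
Qed.

Lemma lc_norm_le_of_powers m x : (forall j, (j <= m)%N ->
  `|psi (x ^+ j)%g| < r) ->
  m%:R * `|psi x| <= 2 * r.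
Proof.
move=> H; have r0 := lc_r_gt0 L.
case: m H => [|m] H; first by rewrite mul0r mulr_ge0// ltW.
have xr : `|psi x| < r by have := H 1%N isT; rewrite expg1.
suff K j : (j <= m.+1)%N ->
    `|psi (x ^+ j)%g - j%:R *: psi x| <= j%:R * (10^-1 * `|psi x|).
  have := K _ (leqnn _); have := H _ (leqnn _).
  set u := psi (x ^+ m.+1)%g; set t := m.+1%:R => ur ut.
  have : t * `|psi x| <= `|u| + `|u - t *: psi x|.
    have -> : t * `|psi x| = `|t *: psi x| by rewrite normrZ ger0_norm.
    rewrite -{1}(subKr u (t *: psi x)); exact: ler_normB.
  by move=> ?; nra.
elim: j => [_|j IH jm].
  by rewrite expg0 lc_psi1 scale0r subrr normr0 mul0r.
have hj := H j (ltnW jm).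
rewrite expgSr -[j.+1%:R]natr1 scalerDl scale1r mulrDl mul1r.
have -> : psi (x ^+ j * x)%g - (j%:R *: psi x + psi x) =
  (psi (x ^+ j)%g - j%:R *: psi x) +
    (psi (x ^+ j * x)%g - psi (x ^+ j)%g - psi x).
  by rewrite [RHS]addrC; exact: sub_split.
apply: le_trans (ler_normD _ _) _; apply: lerD; first exact: IH (ltnW jm).
exact: lc_mul_le_r.
Qed.

End powers.

(** * The exponential map *)

(* A fixed non-principal ultrafilter on the integers: limits along it replace
   the extraction of convergent subsequences. *)
Definition ultra_oo : set_system nat :=
  sval (cid (ultraFilterLemma eventually_filter)).

Lemma ultra_oo_ultra : UltraFilter ultra_oo.
Proof. exact: (svalP (cid (ultraFilterLemma eventually_filter))).1. Qed.
#[global] Existing Instance ultra_oo_ultra.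

Lemma ultra_oo_near (P : set nat) : (\forall k \near \oo, P k) -> ultra_oo P.
Proof. exact: (svalP (cid (ultraFilterLemma eventually_filter))).2. Qed.

Lemma ultra_oo_cvg (T : topologicalType) (u : nat -> T) (l : T) :
  u @ \oo --> l -> u @ ultra_oo --> l.
Proof. by move=> ul A /ul; exact: ultra_oo_near. Qed.

Lemma ultra_oo_compact (T : topologicalType) (K : set T) (u : nat -> T) :
  compact K -> (\forall k \near ultra_oo, K (u k)) ->
  exists2 l, K l & u @ ultra_oo --> l.
Proof.
move=> cK Ku; have [l [Kl cl]] := cK (u @ ultra_oo) _ Ku.
exists l => // V lV.
have [//|nV] := in_ultra_setVsetC (u @^-1` V) ultra_oo_ultra.
by have [x []] := cl (~` V) V nV lV.
Qed.

Lemma rV_closed_ball_compact (R : realType) n (M : R) :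
  compact [set x : 'rV[R]_n | `|x| <= M].
Proof.
apply: bounded_closed_compact.
  exists M; split; first exact: num_real.
  by move=> t Mt x /= xM; apply: le_trans xM (ltW Mt).
apply: (@closed_comp _ _ (fun x : 'rV[R]_n => `|x|) [set t | t <= M]).
  by move=> x _; exact: norm_continuous.
exact: closed_le.
Qed.

Lemma ultra_oo_bounded (R : realType) n (u : nat -> 'rV[R]_n) (M : R) :
  (\forall k \near ultra_oo, `|u k| <= M) ->
  exists2 l, `|l| <= M & u @ ultra_oo --> l.
Proof. by move=> h; exact: (@ultra_oo_compact _ _ u (@rV_closed_ball_compact R
  n M) h). Qed.

Lemma ultra_oo_inv_small (R : realType) (a e : R) : 0 < e ->
  \forall k \near ultra_oo, a / k.+1%:R < e.
Proof.
move=> e0; apply: ultra_oo_near.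
have : (fun k => a * k.+1%:R^-1) @ \oo --> a * (0 : R).
  apply: cvgM; [exact: cvg_cst|exact: cvg_harmonic].
rewrite mulr0 => /cvgrPdist_lt/(_ e e0); apply: filterS => k.
by rewrite sub0r normrN => /(le_lt_trans (ler_norm _)).
Qed.

Lemma ultra_oo_lim_le (R : realType) (V : normedModType R) (u : nat ->
  V) (l w : V) (M a : R) :
  u @ ultra_oo --> l -> (forall k, `|u k - w| <= M + a / k.+1%:R) ->
  `|l - w| <= M.
Proof.
move=> ul uw; apply/ler_addgt0Pr => e e0.
have e2 : 0 < e / 2 by rewrite divr_gt0.
have /cvgrPdist_lt/(_ _ e2) ul' := ul.
have [k [h1 h2]] := filter_ex (filterI ul' (ultra_oo_inv_small a e2)).
rewrite -[l - w](subrKA (u k)); apply: le_trans (ler_normD _ _) _.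
rewrite /= in h1 h2; apply: le_trans (lerD (ltW h1) (uw k)) _;
  move: (a / k.+1%:R) h2 => q h2; rewrite (splitr e); lra.
Qed.

Section exponential.
Context {R : realType} {G : topologicalGroupType} {n : nat}.
Variable L : local_chart R G n.
Local Notation psi := (lc_psi L).
Local Notation xi := (lc_xi L).
Local Notation r := (lc_r L).
Local Notation C := (lc_C L).
Implicit Types (x y : G) (m k : nat) (v w : 'rV[R]_n).

Let r0 : 0 < r := lc_r_gt0 L.
Let C0 : 0 <= C := lc_C_ge0 L.

Definition lc_approx v k := psi (xi (k.+1%:R^-1 *: v) ^+ k.+1)%g.

(** Along the ultrafilter, boundedness alone gives a limit. Independence of the ultrafilter comes
    from [lc_expg_lim], whose error is quadratic in [psi x] for a fixed product [m%:R *: psi x]. *)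
Definition lc_lim v := lim (lc_approx v @ ultra_oo).

Lemma lc_psi_frac v k : `|v| < r ->
  psi (xi (k.+1%:R^-1 *: v)) = k.+1%:R^-1 *: v.
Proof.
move=> vr; rewrite lc_xiK// normrZ (le_lt_trans _ vr)// ger0_norm ?invr_ge0//.
by rewrite ler_piMl// invf_le1// ler1n.
Qed.

Lemma lc_frac_norm v k : `|v| < r ->
  k.+1%:R * `|psi (xi (k.+1%:R^-1 *: v))| = `|v|.
Proof.
move=> vr; rewrite lc_psi_frac// normrZ ger0_norm ?invr_ge0//.
by rewrite mulrA divff ?mul1r// pnatr_eq0.
Qed.

Let half_lt v : 2 * `|v| < r -> `|v| < r.
Proof. by have := normr_ge0 v; lra. Qed.

Lemma lc_approx_le v k : 2 * `|v| < r -> `|lc_approx v k| <= 2 * `|v|.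
Proof.
move=> vr; have vr' := half_lt vr.
have h : 2 * k.+1%:R * `|psi (xi (k.+1%:R^-1 *: v))| = 2 * `|v|.
  by rewrite -mulrA lc_frac_norm.
by rewrite -h; apply: lc_expg_le; rewrite h.
Qed.

Lemma lc_lim_cvg v : 2 * `|v| < r -> lc_approx v @ ultra_oo --> lc_lim v.
Proof.
move=> vr; have [|l _ ul] := @ultra_oo_bounded R n (lc_approx v) (2 * `|v|).
  by apply: nearW => k; exact: lc_approx_le.
by rewrite /lc_lim (cvg_lim _ ul).
Qed.

Lemma lc_lim_le v : 2 * `|v| < r -> `|lc_lim v| <= 2 * `|v|.
Proof.
move=> vr; rewrite -[lc_lim v]subr0.
apply: (@ultra_oo_lim_le _ _ _ _ _ _ 0 (lc_lim_cvg vr)) => k.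
by rewrite subr0 mul0r addr0 lc_approx_le.
Qed.

Lemma lc_lim_sub_le v : 2 * `|v| < r -> `|lc_lim v - v| <= C * `|v| ^+ 2.
Proof.
move=> vr; apply: (@ultra_oo_lim_le _ _ _ _ _ _ 0 (lc_lim_cvg vr)) => k.
have vr' := half_lt vr.
have h : k.+1%:R * `|psi (xi (k.+1%:R^-1 *: v))| = `|v| by exact: lc_frac_norm.
have := @lc_expg_sub_le _ _ _ L k.+1 (xi (k.+1%:R^-1 *: v)).
rewrite -mulrA h => /(_ vr).
by rewrite lc_psi_frac// scalerA divff ?scale1r ?pnatr_eq0// mul0r addr0.
Qed.

Lemma lc_lim_lipschitz v w : 2 * `|v| < r -> 2 * `|w| < r ->
  `|lc_lim v - lc_lim w| <= 4 * `|v - w|.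
Proof.
move=> vr wr; rewrite -[X in `|X|]subr0.
have cv : (fun k => lc_approx v k - lc_approx w k) @ ultra_oo -->
   lc_lim v - lc_lim w by apply: cvgB; exact: lc_lim_cvg.
apply: (@ultra_oo_lim_le _ _ _ _ _ _ 0 cv) => k.
rewrite subr0 mul0r addr0.
have hv : k.+1%:R * `|psi (xi (k.+1%:R^-1 *: v))| = `|v| by
  exact/lc_frac_norm/half_lt.
have hw : k.+1%:R * `|psi (xi (k.+1%:R^-1 *: w))| = `|w| by
  exact/lc_frac_norm/half_lt.
have := @lc_expg_lipschitz _ _ _ L k.+1 (xi (k.+1%:R^-1 *: v)) (xi (k.+1%:R^-1
  *: w)).
rewrite -!mulrA hv hw => /(_ vr wr) H; apply: le_trans H _.
rewrite !lc_psi_frac ?half_lt// -scalerBr normrZ ger0_norm ?invr_ge0//.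
by rewrite [k.+1%:R * (_ * _)]mulrA divff ?mul1r// pnatr_eq0.
Qed.

Lemma lc_expg_lim m x : 4 * m%:R * `|psi x| < r ->
  `|psi (x ^+ m)%g - lc_lim (m%:R *: psi x)| <= 4 * m%:R * (C * `|psi x| ^+ 2).
Proof.
case: m => [|m] h.
  have h0 : 2 * `|(0 : 'rV[R]_n)| < r by rewrite normr0 mulr0.
  have := lc_lim_le h0; rewrite normr0 mulr0 normr_le0 => /eqP e0.
  by rewrite expg0 lc_psi1 scale0r e0 subrr normr0 mulr0 mul0r.
set t : R := m.+1%:R in h *; have t1 : 1 <= t by rewrite ler1n.
have x0 := normr_ge0 (psi x).
have tx0 : 0 <= t * `|psi x| by rewrite mulr_ge0// (le_trans ler01).
have x_tx : `|psi x| <= t * `|psi x| by rewrite ler_peMl.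
have xr : `|psi x| < r by lra.
have txn : `|t *: psi x| = t * `|psi x| by rewrite normrZ ger0_norm// (le_trans
  ler01).
have txr : 2 * `|t *: psi x| < r by rewrite txn; lra.
rewrite distrC.
apply: (@ultra_oo_lim_le _ _ _ _ _ _ (4 * (C * (t * `|psi x|) ^+ 2))
  (lc_lim_cvg txr)) => k.
set s : R := k.+1%:R; have s0 : 0 < s by rewrite ltr0n.
set z := xi (s^-1 *: psi x).
have pz : psi z = s^-1 *: psi x by exact: lc_psi_frac.
have sz : s * `|psi z| = `|psi x| by exact: lc_frac_norm.
have z0 := normr_ge0 (psi z).
have zr2 : 2 * s * `|psi z| < r by rewrite -mulrA sz; lra.
have zk : `|psi (z ^+ k.+1)%g| <= 2 * `|psi x|.
  by rewrite -sz mulrA; exact: lc_expg_le.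
have e1 : `|psi (x ^+ m.+1)%g - psi ((z ^+ k.+1) ^+ m.+1)%g| <=
    4 * t * (C * `|psi x| ^+ 2).
  have := @lc_expg_lipschitz _ _ _ L m.+1 x (z ^+ k.+1)%g; rewrite -/t.
  have a1 : 2 * t * `|psi x| < r by lra.
  have a2 : 2 * t * `|psi (z ^+ k.+1)%g| < r.
    apply: le_lt_trans (ler_wpM2l _ zk) _; first lra.
    by rewrite (_ : 2 * t * (2 * `|psi x|) = 4 * t * `|psi x|)//; ring.
  move=> /(_ a1 a2) H; apply: le_trans H _.
  apply: ler_wpM2l; first lra.
  have := @lc_expg_sub_le _ _ _ L k.+1 z zr2.
  by rewrite -/s sz pz scalerA divff ?gt_eqF// scale1r distrC.
have tz : t * `|psi z| <= t * `|psi x|.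
  rewrite ler_pM2l; last lra.
  by rewrite -sz ler_peMl// ler1n.
have zm2 : 2 * t * `|psi z| < r by lra.
have e2 : `|psi (z ^+ m.+1)%g - psi (xi (s^-1 *: (t *: psi x)))| <=
    C * (t * `|psi z|) ^+ 2.
  have := @lc_expg_sub_le _ _ _ L m.+1 z zm2.
  by rewrite pz (lc_psi_frac _ (half_lt txr)) !scalerA [t * s^-1]mulrC.
have e3 : `|psi ((z ^+ m.+1) ^+ k.+1)%g - lc_approx (t *: psi x) k| <=
    4 * (C * (t * `|psi x|) ^+ 2) / s.
  have := @lc_expg_lipschitz _ _ _ L k.+1 (z ^+ m.+1)%g (xi (s^-1 *: (t *: psi
    x))).
  rewrite -/s -/(lc_approx (t *: psi x) k).
  have a1 : 2 * s * `|psi (z ^+ m.+1)%g| < r.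
    apply: le_lt_trans (ler_wpM2l _ (lc_expg_le zm2)) _; first lra.
    rewrite -/t (_ : 2 * s * (2 * t * `|psi z|) = 4 * t * (s * `|psi z|));
      last by ring.
    by rewrite sz.
  have a2 : 2 * s * `|psi (xi (s^-1 *: (t *: psi x)))| < r.
    by rewrite -mulrA lc_frac_norm ?half_lt.
  move=> /(_ a1 a2) H; apply: le_trans H _.
  apply: le_trans (ler_wpM2l _ e2) _; first lra.
  rewrite -sz le_eqVlt; apply/orP; left; apply/eqP; field.
  by rewrite gt_eqF.
rewrite distrC -[X in `|X|](subrKA (psi ((z ^+ k.+1) ^+ m.+1)%g)).
apply: le_trans (ler_normD _ _) _; apply: lerD => //.
by rewrite -expgnA mulnC expgnA.
Qed.

End exponential.

Section topological_group_limits.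
Context {G : topologicalGroupType} {I : Type} {F : set_system I}.
Context {FF : Filter F}.
Implicit Types (f g : I -> G) (x y : G).

Lemma cvg_mulg f g x y : f @ F --> x -> g @ F --> y ->
  (f i * g i)%g @[i --> F] --> (x * y)%g.
Proof.
move=> fx gy; apply: (@cvg_comp _ _ _ (fun i => (f i, g i))
  (fun z : G * G => (z.1 * z.2)%g) F (nbhs (x, y)));
    last exact: (@mulg_continuous G (x, y)).
exact: cvg_pair.
Qed.

Lemma cvg_invg f x : f @ F --> x -> (f i)^-1%g @[i --> F] --> x^-1%g.
Proof.
move=> fx; apply: (@cvg_comp _ _ _ f (fun z : G => z^-1%g) F (nbhs x)) => //.
exact: (@invg_continuous G x).
Qed.

Lemma cvg_expg f x k : f @ F --> x -> (f i ^+ k)%g @[i --> F] --> (x ^+ k)%g.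
Proof.
move=> fx; elim: k => [|k IH].
  by rewrite expg0; under eq_fun do rewrite expg0; exact: cvg_cst.
rewrite expgS; under eq_fun do rewrite expgS; exact: cvg_mulg.
Qed.

End topological_group_limits.

Lemma cvg_dist_le (R : realType) (V : normedModType R) I (F : set_system I)
    {FF : Filter F} (u : I -> V) (l : V) (g : I -> R) :
  (\forall i \near F, `|u i - l| <= g i) -> g @ F --> (0 : R) -> u @ F --> l.
Proof.
move=> ug /cvgrPdist_lt g0; apply/cvgrPdist_lt => e e0.
move: (g0 e e0) ug; apply: filterS2 => i.
rewrite sub0r normrN distrC => h1 h2.
by apply: le_lt_trans h2 _; apply: le_lt_trans h1; exact: ler_norm.
Qed.

#[local] Opaque lc_lim lc_approx.

Section exponential_limits.
Context {R : realType} {G : topologicalGroupType} {n : nat}.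
Variable L : local_chart R G n.
Local Notation psi := (lc_psi L).
Local Notation xi := (lc_xi L).
Local Notation r := (lc_r L).
Local Notation C := (lc_C L).
Implicit Types (x y : G) (m k : nat) (v w : 'rV[R]_n).

Let r0 : 0 < r := lc_r_gt0 L.
Let C0 : 0 <= C := lc_C_ge0 L.

Lemma lc_xi0 : xi 0 = 1%g.
Proof. by rewrite -(lc_psi1 L) lc_psiK// lc_psi1 normr0. Qed.

Lemma cvg_xi I (F : set_system I) {FF : Filter F} (g : I -> G) v :
  `|v| < r -> psi (g i) @[i --> F] --> v -> g @ F --> xi v.
Proof.
move=> vr gv.
apply: (@cvg_trans _ ((xi \o (psi \o g)) @ F)).
  apply: near_eq_cvg; have /cvgrPdist_lt/(_ (r - `|v|)) := gv.
  rewrite subr_gt0 => /(_ vr); apply: filterS => i h /=.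
  rewrite lc_psiK// -[psi _](subrK v) addrC.
  apply: le_lt_trans (ler_normD _ _) _; rewrite distrC; lra.
apply: (@cvg_comp _ _ _ (psi \o g) xi F (nbhs v)) => //.
exact: lc_xi_cont.
Qed.

Lemma cvg1_psi I (F : set_system I) {FF : Filter F} (g : I -> G) :
  psi (g i) @[i --> F] --> (0 : 'rV[R]_n) -> g @ F --> 1%g.
Proof. by move=> h; rewrite -lc_xi0; apply: cvg_xi => //; rewrite normr0. Qed.

Lemma psi_cvg1 I (F : set_system I) {FF : Filter F} (g : I -> G) :
  g @ F --> 1%g -> psi (g i) @[i --> F] --> (0 : 'rV[R]_n).
Proof.
move=> g1; rewrite -(lc_psi1 L).
apply: (@cvg_comp _ _ _ g psi F (nbhs 1%g)) => //.
by apply: lc_psi_cont; rewrite lc_psi1 normr0.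
Qed.

Lemma near_lt_of_cvg I (F : set_system I) {FF : Filter F} (u : I -> R) l s :
  u @ F --> l -> l < s -> \forall i \near F, u i < s.
Proof. by move=> ul ls; exact: cvgr_lt ul _ ls. Qed.

Lemma lc_expg_cvg_small I (F : set_system I) {FF : Filter F} (y : I -> G)
    (m : I -> nat) w : 8 * `|w| < r ->
  psi (y i) @[i --> F] --> (0 : 'rV[R]_n) ->
  (m i)%:R *: psi (y i) @[i --> F] --> w ->
  (y i ^+ m i)%g @[i --> F] --> xi (lc_lim L w).
Proof.
move=> wr y0 my; have w0 := normr_ge0 w.
have w2r : 2 * `|w| < r by lra.
apply: cvg_xi; first by apply: le_lt_trans (lc_lim_le w2r) _.
pose g i := 4 * C * `|(m i)%:R *: psi (y i)| * `|psi (y i)| +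
  4 * `|(m i)%:R *: psi (y i) - w|.
apply: (@cvg_dist_le _ _ _ _ _ _ _ g).
  have h : \forall i \near F, `|(m i)%:R *: psi (y i)| < r / 4.
    apply: near_lt_of_cvg (cvg_norm my) _; lra.
  move: h; apply: filterS => i; rewrite normrZ ger0_norm// => h.
  have h4 : 4 * (m i)%:R * `|psi (y i)| < r by lra.
  have h2 : 2 * `|(m i)%:R *: psi (y i)| < r.
    rewrite normrZ ger0_norm//;
      have : 0 <= (m i)%:R * `|psi (y i)| by rewrite mulr_ge0.
    by lra.
  rewrite -[X in `|X|](subrKA (lc_lim L ((m i)%:R *: psi (y i)))).
  apply: le_trans (ler_normD _ _) _; apply: lerD; last exact: lc_lim_lipschitz.
  apply: le_trans (lc_expg_lim h4) _.
  rewrite normrZ ger0_norm// le_eqVlt; apply/orP; left; apply/eqP; ring.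
have -> : 0 = 4 * C * `|w| * `|0 : 'rV[R]_n| + 4 * `|w - w|.
  by rewrite subrr !normr0 !mulr0 addr0.
apply: cvgD.
  apply: cvgM; last exact: cvg_norm.
  by apply: cvgM; [exact: cvg_cst|exact: cvg_norm].
apply: cvgM; first exact: cvg_cst.
by apply: cvg_norm; apply: cvgB => //; exact: cvg_cst.
Qed.

Definition lc_exp_index w : nat := (Num.truncn (8 * `|w| / r)).+1.

Definition lc_exp w : G :=
  (xi (lc_lim L ((lc_exp_index w)%:R^-1 *: w)) ^+ lc_exp_index w)%g.

(** The limit depends on [w] only, not on [y], [m] or the filter; this is the form in which the
    exponential is used from here on. *)
Lemma lc_expg_cvg I (F : set_system I) {FF : Filter F} (y : I -> G)
    (m : I -> nat) w :
  psi (y i) @[i --> F] --> (0 : 'rV[R]_n) ->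
  (m i)%:R *: psi (y i) @[i --> F] --> w ->
  (y i ^+ m i)%g @[i --> F] --> lc_exp w.
Proof.
move=> y0 my; rewrite /lc_exp; set q := lc_exp_index w.
have q0 : (0 < q)%N by [].
have qR : 0 < q%:R :> R by rewrite ltr0n.
have qw : 8 * `|q%:R^-1 *: w| < r.
  have : 8 * `|w| / r < q%:R by rewrite /q /lc_exp_index; exact: truncnS_gt.
  rewrite ltr_pdivrMr// => h; rewrite normrZ ger0_norm ?invr_ge0//.
  by rewrite mulrCA mulrC ltr_pdivrMr// [r * _]mulrC.
(* Euclidean division of [m i] by [q] reduces to the small case: the quotient carries [w / q], and
   the remainder, less than [q], contributes a factor tending to 1. *)
have s0 : ((m i %% q)%N)%:R *: psi (y i) @[i --> F] --> (0 : 'rV[R]_n).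
  apply: (@cvg_dist_le _ _ _ _ _ _ _ (fun i => q%:R * `|psi (y i)|)).
    apply: nearW => i; rewrite subr0 normrZ ger0_norm// ler_wpM2r// ler_nat.
    exact/ltnW/ltn_pmod.
  rewrite -(mulr0 (q%:R : R)); apply: cvgM; first exact: cvg_cst.
  by rewrite -(normr0 'rV[R]_n); exact: cvg_norm.
have k0 : ((m i %/ q)%N)%:R *: psi (y i) @[i --> F] --> q%:R^-1 *: w.
  have -> : (fun i => ((m i %/ q)%N)%:R *: psi (y i)) =
      (fun i => q%:R^-1 *: ((m i)%:R *: psi (y i) - ((m i %% q)%N)%:R *: psi (y
        i))).
    apply/funext => i; rewrite -scalerBl scalerA; congr (_ *: _).
    rewrite {2}(divn_eq (m i) q) natrD natrM addrK mulrCA mulVf ?mulr1//.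
    by rewrite gt_eqF.
  rewrite -[w]subr0; apply: cvgZ; first exact: cvg_cst.
  exact: cvgB.
have y1 : (y i ^+ (m i %% q))%g @[i --> F] --> 1%g.
  apply: cvg1_psi.
  apply: (@cvg_dist_le _ _ _ _ _ _ _ (fun i =>
    2 * `|((m i %% q)%N)%:R *: psi (y i)|)).
    have h : \forall i \near F, 2 * `|((m i %% q)%N)%:R *: psi (y i)| < r.
      apply: (@near_lt_of_cvg _ _ _ _ (2 * `|0 : 'rV[R]_n|)).
        by apply: cvgM; [exact: cvg_cst|exact: cvg_norm].
      by rewrite normr0 mulr0.
    move: h; apply: filterS => i; rewrite normrZ ger0_norm// mulrA => h.
    by rewrite subr0; exact: lc_expg_le.
  rewrite -(mulr0 2) -(normr0 'rV[R]_n); apply: cvgM; first exact: cvg_cst.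
  exact: cvg_norm.
have -> : (fun i => (y i ^+ m i)%g) =
    (fun i => ((y i ^+ (m i %/ q)) ^+ q * y i ^+ (m i %% q))%g).
  by apply/funext => i; rewrite -expgnA -expgnDr -divn_eq.
rewrite -[(_ ^+ q)%g]mulg1; apply: cvg_mulg => //; apply: cvg_expg.
exact: lc_expg_cvg_small.
Qed.

Lemma cvg_scale0 I (F : set_system I) {FF : Filter F} (y : I -> 'rV[R]_n)
    (a : I -> R) w : (forall i, 0 < a i) ->
  (a i)^-1 @[i --> F] --> (0 : R) -> a i *: y i @[i --> F] --> w ->
  y @ F --> (0 : 'rV[R]_n).
Proof.
move=> a0 a_oo ay.
have -> : y = (fun i => (a i)^-1 *: (a i *: y i)).
  by apply/funext => i; rewrite scalerA mulVf ?scale1r// gt_eqF.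
by rewrite -(scale0r w); exact: cvgZ.
Qed.

Lemma cvg_truncn_scale I (F : set_system I) {FF : Filter F} (y : I -> 'rV[R]_n)
    (a : I -> R) w t : (forall i, 0 < a i) -> 0 <= t ->
  (a i)^-1 @[i --> F] --> (0 : R) -> a i *: y i @[i --> F] --> w ->
  (Num.truncn (t * a i))%:R *: y i @[i --> F] --> t *: w.
Proof.
move=> a0 t0 a_oo ay; have y0 : y @ F --> (0 :
  'rV[R]_n) by exact: cvg_scale0 a0 a_oo ay.
have -> : (fun i => (Num.truncn (t * a i))%:R *: y i) =
    (fun i => t *: (a i *: y i) - (t * a i - (Num.truncn (t * a i))%:R) *: y i).
  by apply/funext => i; rewrite scalerA -scalerBl opprB addrC subrK.
rewrite -[t *: w]subr0; apply: cvgB; first by apply: cvgZ => //; exact: cvg_cst.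
apply: (@cvg_dist_le _ _ _ _ _ _ _ (fun i => `|y i|)); last first.
  by rewrite -(normr0 'rV[R]_n); exact: (cvg_norm y0).
apply: nearW => i; rewrite subr0 normrZ ler_piMl//.
have /truncn_itv/andP[h1 h2] : 0 <= t * a i by rewrite mulr_ge0// ltW.
rewrite ger0_norm ?subr_ge0//; move: h2; rewrite -natr1; lra.
Qed.

Lemma lc_expg_truncn_cvg I (F : set_system I) {FF : Filter F} (y : I -> G)
    (a : I -> R) w t : (forall i, 0 < a i) -> 0 <= t ->
  (a i)^-1 @[i --> F] --> (0 : R) -> a i *: psi (y i) @[i --> F] --> w ->
  (y i ^+ Num.truncn (t * a i))%g @[i --> F] --> lc_exp (t *: w).
Proof.
move=> a0 t0 a_oo ay; apply: lc_expg_cvg; first exact: cvg_scale0 a0 a_oo ay.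
exact: cvg_truncn_scale.
Qed.

End exponential_limits.

Lemma mulg_div_commute (G : topologicalGroupType) (a b c d : G) :
  commute b c -> commute b d ->
  ((a * c) * (b * d)^-1 = (a * b^-1) * (c * d^-1))%g.
Proof.
move=> bc bd; rewrite bd invgM !mulgA; congr (_ * _)%g.
rewrite -!mulgA; congr (_ * _)%g.
exact: commuteV (commute_sym bc).
Qed.

#[local] Opaque lc_exp.

Section exponential_properties.
Context {R : realType} {G : topologicalGroupType} {n : nat}.
Variable L : local_chart R G n.
Hypothesis hG : hausdorff_space G.
Local Notation psi := (lc_psi L).
Local Notation xi := (lc_xi L).
Local Notation r := (lc_r L).
Local Notation C := (lc_C L).
Local Notation E := (lc_exp L).
Implicit Types (x y : G) (m k : nat) (u v w : 'rV[R]_n) (s t : R).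

Let r0 : 0 < r := lc_r_gt0 L.
Let C0 : 0 <= C := lc_C_ge0 L.

Lemma natS_gt0 (k : nat) : 0 < k.+1%:R :> R. Proof. by []. Qed.

Lemma cvg_invS : (k.+1%:R : R)^-1 @[k --> \oo] --> (0 : R).
Proof. exact: cvg_harmonic. Qed.

Lemma lc_exp_approx w : exists2 y : nat -> G,
  psi (y k) @[k --> \oo] --> (0 : 'rV[R]_n) &
  k.+1%:R *: psi (y k) @[k --> \oo] --> w.
Proof.
pose y k := xi (k.+1%:R^-1 *: w).
have v0 : k.+1%:R^-1 *: w @[k --> \oo] --> (0 : 'rV[R]_n).
  by rewrite -(scale0r w); apply: cvgZ; [exact: cvg_invS|exact: cvg_cst].
have yE : \forall k \near \oo, psi (y k) = k.+1%:R^-1 *: w.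
  have /cvgr0Pnorm_lt/(_ r r0) := v0.
  by apply: filterS => k; exact: lc_xiK.
have yw : k.+1%:R *: psi (y k) @[k --> \oo] --> w.
  apply: (@cvg_trans _ (cst w @ \oo)); last exact: cvg_cst.
  apply: near_eq_cvg; move: yE; apply: filterS => k ->.
  by rewrite scalerA divff ?scale1r// gt_eqF.
exists y => //; exact: (cvg_scale0 natS_gt0 cvg_invS yw).
Qed.

Lemma lc_exp0 : E 0 = 1%g.
Proof.
have h (k : nat) : psi (1%g : G) = 0 by exact: lc_psi1.
have e : (1 ^+ 0)%g @[k --> \oo] --> E 0.
  apply: (@lc_expg_cvg _ _ _ L _ \oo _ (fun=> 1%g) (fun=> 0%N)).
    by rewrite lc_psi1; exact: cvg_cst.
  by rewrite lc_psi1 scale0r; exact: cvg_cst.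
apply: (cvg_unique hG e); rewrite expg0; exact: cvg_cst.
Qed.

Lemma lc_exp_small v : 8 * `|v| < r -> E v = xi (lc_lim L v).
Proof.
move=> vr; have [y y0 yv] := lc_exp_approx v.
pose proof (lc_expg_cvg_small vr y0 yv) as h1.
exact: (cvg_unique hG (lc_expg_cvg y0 yv) h1).
Qed.

Let small2 v : 8 * `|v| < r -> 2 * `|v| < r.
Proof. by have := normr_ge0 v; lra. Qed.

Lemma psi_lc_exp v : 8 * `|v| < r -> psi (E v) = lc_lim L v.
Proof.
move=> vr; rewrite lc_exp_small// lc_xiK//.
by apply: le_lt_trans (lc_lim_le (small2 vr)) _; exact: small2.
Qed.

Lemma psi_lc_exp_sub_le v : 8 * `|v| < r -> `|psi (E v) - v| <= C * `|v| ^+ 2.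
Proof. by move=> vr; rewrite psi_lc_exp//; exact/lc_lim_sub_le/small2. Qed.

Lemma psi_lc_exp_le v : 8 * `|v| < r -> `|psi (E v)| <= 2 * `|v|.
Proof. by move=> vr; rewrite psi_lc_exp//; exact/lc_lim_le/small2. Qed.

(** The quadratic error is at most a tenth of [|v|]. In particular no small nonzero vector lies in
    the kernel of [E]. *)
Lemma le_psi_lc_exp v : 8 * `|v| < r -> `|v| <= 2 * `|psi (E v)|.
Proof.
move=> vr; have v0 := normr_ge0 v.
have h := psi_lc_exp_sub_le vr.
have h2 : C * `|v| ^+ 2 <= 10^-1 * `|v|.
  by rewrite expr2 mulrA ler_wpM2r// lc_C_small//; lra.
have : `|v| <= `|psi (E v)| + `|psi (E v) - v|.
  by rewrite -{1}(subKr (psi (E v)) v); exact: ler_normB.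
lra.
Qed.

Lemma psi_lc_exp_lipschitz v w : 8 * `|v| < r -> 8 * `|w| < r ->
  `|psi (E v) - psi (E w)| <= 4 * `|v - w|.
Proof.
move=> vr wr; rewrite !psi_lc_exp//; apply: lc_lim_lipschitz; exact: small2.
Qed.

Lemma lc_exp_natmul m w : E (m%:R *: w) = (E w ^+ m)%g.
Proof.
have [y y0 yw] := lc_exp_approx w.
pose proof (cvg_expg (k := m) (lc_expg_cvg y0 yw)) as h1.
have h2 : ((y k ^+ k.+1) ^+ m)%g @[k --> \oo] --> E (m%:R *: w).
  under eq_fun do rewrite -expgnA.
  apply: lc_expg_cvg => //.
  under eq_fun do rewrite natrM mulrC -scalerA.
  by apply: cvgZ => //; exact: cvg_cst.
exact: (cvg_unique hG h2 h1).
Qed.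

(** The truncations of [s * k.+1] and [t * k.+1] need not add up to that of the sum, but
    [lc_expg_cvg] only sees the exponent up to a bounded error. *)
Lemma lc_expD_ge0 s t w : 0 <= s -> 0 <= t ->
  E ((s + t) *: w) = (E (s *: w) * E (t *: w))%g.
Proof.
move=> s0 t0; have [y y0 yw] := lc_exp_approx w.
pose proof (cvg_mulg (lc_expg_truncn_cvg natS_gt0 s0 cvg_invS yw)
  (lc_expg_truncn_cvg natS_gt0 t0 cvg_invS yw)) as h1.
have h2 : (y k ^+ Num.truncn (s * k.+1%:R) * y k ^+ Num.truncn (t * k.+1%:R))%g
    @[k --> \oo] --> E ((s + t) *: w).
  under eq_fun do rewrite -expgnDr.
  apply: lc_expg_cvg => //; rewrite scalerDl.
  under eq_fun do rewrite natrD scalerDl.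
  by apply: cvgD; exact: (cvg_truncn_scale natS_gt0 _ cvg_invS yw).
exact: (cvg_unique hG h2 h1).
Qed.

Lemma psi_scale_mul I (F : set_system I) {FF : Filter F} (a : I -> R)
    (x y : I -> G) u w : (forall i, 0 < a i) ->
  (a i)^-1 @[i --> F] --> (0 : R) ->
  a i *: psi (x i) @[i --> F] --> u -> a i *: psi (y i) @[i --> F] --> w ->
  a i *: psi (x i * y i)%g @[i --> F] --> u + w.
Proof.
move=> a0 a_oo xu yw.
have x0 := @cvg_scale0 _ _ _ _ FF _ _ _ a0 a_oo xu.
have y0 := @cvg_scale0 _ _ _ _ FF _ _ _ a0 a_oo yw.
have -> : (fun i => a i *: psi (x i * y i)%g) = (fun i =>
    (a i *: psi (x i) + a i *: psi (y i)) +
    a i *: (psi (x i * y i)%g - psi (x i) - psi (y i))).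
  apply/funext => i; rewrite -!scalerDr; congr (_ *: _).
  by rewrite addrAC addrA subrKC subrK.
rewrite -[u + w]addr0; apply: cvgD; first exact: cvgD.
apply: (@cvg_dist_le _ _ _ _ _ _ _
    (fun i => C * (`|a i *: psi (x i)| * `|psi (y i)|))).
  have /cvgr0Pnorm_lt/(_ r r0) := y0; have /cvgr0Pnorm_lt/(_ r r0) := x0.
  apply: filterS2 => i hx hy; rewrite subr0 !normrZ.
  rewrite -mulrA mulrCA ler_wpM2l// mulrA; exact: lc_mul_le.
have -> : 0 = C * (`|u| * `|0 : 'rV[R]_n|) by rewrite normr0 !mulr0.
apply: cvgM; first exact: cvg_cst.
by apply: cvgM; exact: cvg_norm.
Qed.

(** The expansion of the inverse is read off the product estimate for [x * x^-1], whose coordinates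
    are 0. *)
Lemma psi_scale_inv I (F : set_system I) {FF : Filter F} (a : I -> R)
    (x : I -> G) u : (forall i, 0 < a i) ->
  (a i)^-1 @[i --> F] --> (0 : R) ->
  a i *: psi (x i) @[i --> F] --> u ->
  a i *: psi (x i)^-1%g @[i --> F] --> - u.
Proof.
move=> a0 a_oo xu; have x0 := @cvg_scale0 _ _ _ _ FF _ _ _ a0 a_oo xu.
have y0 : psi (x i)^-1%g @[i --> F] --> (0 : 'rV[R]_n).
  by apply: psi_cvg1; rewrite -invg1; apply: cvg_invg; exact: cvg1_psi x0.
have -> : (fun i => a i *: psi (x i)^-1%g) = (fun i =>
    - (a i *: psi (x i)) -
    a i *: (psi (x i * (x i)^-1)%g - psi (x i) - psi (x i)^-1%g)).
  apply/funext => i; rewrite mulgV lc_psi1 sub0r -scalerN -scalerBr.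
  by congr (_ *: _); rewrite opprD !opprK addKr.
rewrite -[- u]subr0; apply: cvgB; first exact: cvgN.
apply: (@cvg_dist_le _ _ _ _ _ _ _
    (fun i => C * (`|a i *: psi (x i)| * `|psi (x i)^-1%g|))).
  have /cvgr0Pnorm_lt/(_ r r0) := y0; have /cvgr0Pnorm_lt/(_ r r0) := x0.
  apply: filterS2 => i hx hy; rewrite subr0 !normrZ.
  rewrite -mulrA mulrCA ler_wpM2l// mulrA; exact: lc_mul_le.
have -> : 0 = C * (`|u| * `|0 : 'rV[R]_n|) by rewrite normr0 !mulr0.
apply: cvgM; first exact: cvg_cst.
by apply: cvgM; exact: cvg_norm.
Qed.

Lemma lc_expN w : E (- w) = (E w)^-1%g.
Proof.
have [y y0 yw] := lc_exp_approx w.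
pose proof (cvg_invg (lc_expg_cvg y0 yw)) as h1.
pose proof (psi_scale_inv natS_gt0 cvg_invS yw) as h2.
pose proof (lc_expg_cvg (cvg_scale0 natS_gt0 cvg_invS h2) h2) as h3.
apply: (cvg_unique hG h3 (y := _));
  have -> : (fun k => (y k)^-1 ^+ k.+1)%g = (fun k => (y k ^+ k.+1)^-1%g).
  by apply/funext => k; rewrite expVgn.
exact: h1.
Qed.

Lemma lc_expB_ge0 s t w : 0 <= s -> 0 <= t ->
  E ((s - t) *: w) = (E (s *: w) * (E (t *: w))^-1)%g.
Proof.
move=> s0 t0; have [st|/ltW st] := leP t s.
  have := @lc_expD_ge0 (s - t) t w; rewrite subr_ge0 subrK => /(_ st t0) ->.
  by rewrite mulgK.
have := @lc_expD_ge0 (t - s) s w; rewrite subr_ge0 subrK => /(_ st s0) ->.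
by rewrite invgM mulVKg -lc_expN -scaleNr opprB.
Qed.

Lemma lc_expD s t w : E ((s + t) *: w) = (E (s *: w) * E (t *: w))%g.
Proof.
have W z : exists a b, [/\ 0 <= a, 0 <= b & z = a - b :> R].
  have [z0|/ltW z0] := leP 0 z; first by exists z, 0; rewrite subr0.
  by exists 0, (- z); rewrite sub0r opprK oppr_ge0.
have [a [b [a0 b0 ->]]] := W s; have [c [d [c0 d0 ->]]] := W t.
rewrite addrACA -opprD !lc_expB_ge0 ?addr_ge0// !lc_expD_ge0//.
have cm p q : 0 <= p -> 0 <= q -> commute (E (p *: w)) (E (q *: w)).
  move=> p0 q0; apply: (etrans (esym (lc_expD_ge0 w p0 q0))).
  by rewrite addrC; exact: lc_expD_ge0.
exact: mulg_div_commute (cm _ _ b0 c0) (cm _ _ b0 d0).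
Qed.

End exponential_properties.

Section one_parameter_subgroups.
Context {R : realType} {G : topologicalGroupType} {n : nat}.
Variable L : local_chart R G n.
Hypothesis hG : hausdorff_space G.
Local Notation psi := (lc_psi L).
Local Notation r := (lc_r L).
Local Notation C := (lc_C L).
Local Notation E := (lc_exp L).
Implicit Types (x y : G) (m k : nat) (u v w : 'rV[R]_n) (s t : R).

Let r0 : 0 < r := lc_r_gt0 L.
Let C0 : 0 <= C := lc_C_ge0 L.
Let natS_gt0 := @natS_gt0 R.
Let cvg_invS := @cvg_invS R.

Lemma lc_exp_commute s t w : commute (E (s *: w)) (E (t *: w)).
Proof.
apply: (etrans (esym (lc_expD L hG s t w))); rewrite addrC.
exact: lc_expD.
Qed.

Lemma psi_lc_exp_cvg0 I (F : set_system I) {FF : Filter F} (v : I -> 'rV[R]_n) :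
  v @ F --> (0 : 'rV[R]_n) -> psi (E (v i)) @[i --> F] --> (0 : 'rV[R]_n).
Proof.
move=> v0; apply: (@cvg_dist_le _ _ _ _ _ _ _ (fun i => 2 * `|v i|)).
  have : 0 < r / 8 by rewrite divr_gt0.
  have /cvgr0Pnorm_lt h := v0; move=> /h.
  apply: filterS => i vi; rewrite subr0; apply: psi_lc_exp_le => //; lra.
have -> : 0 = 2 * `|0 : 'rV[R]_n| by rewrite normr0 mulr0.
by apply: cvgM; [exact: cvg_cst|exact: cvg_norm].
Qed.

Lemma lc_exp_cvg1 I (F : set_system I) {FF : Filter F} (v : I -> 'rV[R]_n) :
  v @ F --> (0 : 'rV[R]_n) -> E (v i) @[i --> F] --> 1%g.
Proof. by move=> v0; apply: cvg1_psi; exact: psi_lc_exp_cvg0. Qed.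

Lemma lc_exp_line_cvg I (F : set_system I) {FF : Filter F} (t : I ->
  R) (l : R) w :
  t @ F --> l -> E (t i *: w) @[i --> F] --> E (l *: w).
Proof.
move=> tl.
have -> : (fun i => E (t i *: w)) = (fun i =>
  E (l *: w) * E ((t i - l) *: w))%g.
  by apply/funext => i; rewrite -(lc_expD L hG l (t i - l) w) [l +
    _]addrC subrK.
rewrite -[E (l *: w)]mulg1; apply: cvg_mulg; first by rewrite mulg1;
  exact: cvg_cst.
apply: lc_exp_cvg1; rewrite -(scale0r w) -(subrr l); apply: cvgZ;
  last exact: cvg_cst.
by apply: cvgB => //; exact: cvg_cst.
Qed.

Lemma psi_scale_exp I (F : set_system I) {FF : Filter F} (a : I -> R) w :
  (forall i, 0 < a i) -> (a i)^-1 @[i --> F] --> (0 : R) ->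
  a i *: psi (E ((a i)^-1 *: w)) @[i --> F] --> w.
Proof.
move=> a0 a_oo.
have v0 : (a i)^-1 *: w @[i --> F] --> (0 : 'rV[R]_n).
  by rewrite -(scale0r w); apply: cvgZ => //; exact: cvg_cst.
apply: (@cvg_dist_le _ _ _ _ _ _ _ (fun i => C * `|w| ^+ 2 * (a i)^-1)).
  have : 0 < r / 8 by rewrite divr_gt0.
  have /cvgr0Pnorm_lt h := v0; move=> /h.
  apply: filterS => i vi.
  have wE : w = a i *: ((a i)^-1 *: w).
    by rewrite scalerA divff ?scale1r// gt_eqF.
  have v8 : 8 * `|(a i)^-1 *: w| < r by lra.
  rewrite [X in _ - X]wE -scalerBr normrZ (gtr0_norm (a0 i)).
  apply: le_trans (ler_wpM2l (ltW (a0 i)) (psi_lc_exp_sub_le hG v8)) _.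
  rewrite normrZ gtr0_norm ?invr_gt0// le_eqVlt; apply/orP; left; apply/eqP.
  by field; rewrite gt_eqF.
rewrite -(mulr0 (C * `|w| ^+ 2)); apply: cvgM => //; exact: cvg_cst.
Qed.

Lemma lc_exp_inj u w : (forall t, 0 <= t -> E (t *: u) = E (t *: w)) -> u = w.
Proof.
move=> uw; pose proof (psi_scale_exp (w := u) natS_gt0 cvg_invS) as h1.
pose proof (psi_scale_exp (w := w) natS_gt0 cvg_invS) as h2.
have h3 : k.+1%:R *: psi (E (k.+1%:R^-1 *: w)) @[k --> \oo] --> u.
  have -> : (fun k : nat => k.+1%:R *: psi (E (k.+1%:R^-1 *: w))) =
      (fun k : nat => k.+1%:R *: psi (E (k.+1%:R^-1 *: u))).
    by apply/funext => k; rewrite uw// invr_ge0.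
  exact: h1.
exact: (cvg_unique (@norm_hausdorff _ _) h3 h2).
Qed.

Lemma lc_exp_eq0 w : (forall t, E (t *: w) = 1%g) -> w = 0.
Proof. by move=> w1; apply: lc_exp_inj => t _; rewrite w1 scaler0 lc_exp0. Qed.

(** A direction in which points of a closed subgroup accumulate at 1 is tangent to it: the powers of
    the [y i] with exponent the truncation of [t * a i] stay in [A] and tend to [E (t *: w)]. *)
Lemma lc_exp_closed_subgroup (A : set G) I (F : set_system I) {FF :
  ProperFilter F}
    (a : I -> R) (y : I -> G) w t : closed_subgroup_set A ->
  (forall i, 0 < a i) -> (a i)^-1 @[i --> F] --> (0 : R) ->
  a i *: psi (y i) @[i --> F] --> w -> (\forall i \near F, A (y i)) ->
  A (E (t *: w)).
Proof.
move=> [cA A1 AM AV] a0 a_oo yw yA.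
have W s : 0 <= s -> A (E (s *: w)).
  move=> s0; pose proof (lc_expg_truncn_cvg a0 s0 a_oo yw) as h.
  apply: (closed_cvg A cA _ _ h); move: yA; apply: filterS => i yi.
  by elim: Num.truncn => [|k IH]; rewrite ?expg0// expgS; exact: AM.
have [t0|/ltW t0] := leP 0 t; first exact: W.
by rewrite -[t]opprK scaleNr lc_expN//; apply: AV; apply: W; rewrite oppr_ge0.
Qed.

Lemma lc_exp_trotter u w :
  ((E (k.+1%:R^-1 *: u) * E (k.+1%:R^-1 *: w)) ^+ k.+1)%g
  @[k --> \oo] --> E (u + w).
Proof.
pose proof (psi_scale_mul natS_gt0 cvg_invS (psi_scale_exp (w :=
  u) natS_gt0 cvg_invS)
  (psi_scale_exp (w := w) natS_gt0 cvg_invS)) as h.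
exact: lc_expg_cvg (cvg_scale0 natS_gt0 cvg_invS h) h.
Qed.

Lemma lc_exp_frac k w : (E (k.+1%:R^-1 *: w) ^+ k.+1)%g = E w.
Proof. by rewrite -(lc_exp_natmul L hG) scalerA divff ?scale1r. Qed.

(** When the factors commute, the Trotter products are constantly equal to [E u * E w]. *)
Lemma lc_expD_commute u w : (forall s t, commute (E (s *: u)) (E (t *: w))) ->
  E (u + w) = (E u * E w)%g.
Proof.
move=> uw; pose proof (@lc_exp_trotter u w) as h1.
have h2 : ((E (k.+1%:R^-1 *: u) * E (k.+1%:R^-1 *: w)) ^+ k.+1)%g
    @[k --> \oo] --> (E u * E w)%g.
  under eq_fun do rewrite (expgMn _ (uw _ _)) !lc_exp_frac; exact: cvg_cst.
exact: (cvg_unique hG h1 h2).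
Qed.

(** A continuous one-parameter subgroup, here the image by [f], has a velocity:
    [k.+1%:R *: psi (y k)] is bounded by [lc_norm_le_of_powers], and any limit of it along the
    ultrafilter generates the subgroup by [lc_expg_truncn_cvg]. *)
Lemma endomorphism_exp (f : G -> G) v : continuous f ->
  {morph f : x y / (x * y)%g} ->
  exists w, forall t, f (E (t *: v)) = E (t *: w).
Proof.
move=> cf fM.
have f1 : f 1%g = 1%g by apply: (@mulgI _ (f 1%g)); rewrite -fM !mulg1.
have fX x k : f (x ^+ k)%g = (f x ^+ k)%g.
  by elim: k => [|k IH]; rewrite ?expg0 ?f1// !expgS fM IH.
have fV x : f (x^-1)%g = (f x)^-1%g.
  by apply: (@mulgI _ (f x)); rewrite -fM !mulgV.
pose y k := f (E (k.+1%:R^-1 *: v)).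
have [q q0 qP] : exists2 q : nat, (0 < q)%N &
    forall t, 0 <= t <= q%:R^-1 -> `|psi (f (E (t *: v)))| < r.
  have h : f (E (t *: v)) @[t --> (0 : R)] --> 1%g.
    rewrite -f1 -(lc_exp0 L hG) -(scale0r v).
    apply: (@cvg_comp _ _ _ (fun t => E (t *: v)) f _ (nbhs (E (0 *: v)))).
      exact: (@lc_exp_line_cvg R (nbhs (0 : R)) _ id 0 v (@cvg_id _ _)).
    exact: cf.
  pose proof (psi_cvg1 L h) as h'; move/cvgr0Pnorm_lt: h' => /(_ _ r0).
  move=> /nbhs_ballP[d /= d0 dP].
  exists (Num.truncn d^-1).+1 => // t /andP[t0 td]; apply: dP.
  rewrite -ball_normE /= sub0r normrN ger0_norm//; apply: le_lt_trans td _.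
  rewrite invf_plt ?posrE//; exact: truncnS_gt.
have yb k : (q <= k.+1)%N -> `|k.+1%:R *: psi (y k)| <= 4 * q%:R * r.
  move=> qk; pose m := (k.+1 %/ q)%N.
  have m0 : (0 < m)%N by rewrite divn_gt0.
  have km : (k.+1 <= 2 * q * m)%N.
    by rewrite {1}(divn_eq k.+1 q) -/m; have := ltn_pmod k.+1 q0; nia.
  have : m%:R * `|psi (y k)| <= 2 * r.
    apply: lc_norm_le_of_powers => j jm.
    rewrite /y -fX -(lc_exp_natmul L hG) scalerA; apply: qP.
    rewrite divr_ge0// ler_pdivrMr// mulrC ler_pdivlMr ?ltr0n// -natrM ler_nat.
    by apply: leq_trans (leq_divM k.+1 q); rewrite leq_mul2r jm orbT.
  have := km; rewrite -(ler_nat R) !natrM => kmR mr.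
  rewrite normrZ ger0_norm//.
  apply: le_trans (ler_wpM2r (normr_ge0 _) kmR) _.
  have -> : 2 * q%:R * m%:R * `|psi (y k)| = 2 * q%:R * (m%:R * `|psi (y k)|).
    by rewrite !mulrA.
  apply: le_trans (ler_wpM2l _ mr) _; first by rewrite mulr_ge0.
  by rewrite le_eqVlt; apply/orP; left; apply/eqP; ring.
have [|w _ yw] := @ultra_oo_bounded R n (fun k =>
  k.+1%:R *: psi (y k)) (4 * q%:R * r).
  by apply: ultra_oo_near; exists q => // k /= qk; apply: yb; exact: leqW.
have invU : (k.+1%:R : R)^-1 @[k --> ultra_oo] --> (0 : R).
  exact: ultra_oo_cvg cvg_invS.
have W t : 0 <= t -> f (E (t *: v)) = E (t *: w).
  move=> t0; pose proof (lc_expg_truncn_cvg natS_gt0 t0 invU yw) as h1.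
  have h2 : f (E (((Num.truncn (t * k.+1%:R))%:R / k.+1%:R) *: v))
      @[k --> ultra_oo] --> f (E (t *: v)).
    apply: (@cvg_comp _ _ _ (fun k :
      nat => E (((Num.truncn (t * k.+1%:R))%:R / k.+1%:R) *: v))
       f _ (nbhs (E (t *: v)))); last exact: cf.
    apply: lc_exp_line_cvg.
    apply: (@cvg_dist_le _ R _ _ _ _ _ (fun k : nat => k.+1%:R^-1)) => //.
    apply: nearW => k /=.
    have /truncn_itv/andP[a1 a2] : 0 <= t * k.+1%:R by rewrite mulr_ge0.
    rewrite -[(Num.truncn _).+1%:R]natr1 in a2.
    rewrite [X in `|X|](_ : _ =
        ((Num.truncn (t * k.+1%:R))%:R - t * k.+1%:R) * k.+1%:R^-1); last first.
      by rewrite mulrBl mulfK.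
    rewrite normrM [X in _ * X <= _]ger0_norm ?invr_ge0// ler_piMl ?invr_ge0//.
    by rewrite ler_norml; apply/andP; split; lra.
  have h3 : f (E (((Num.truncn (t * k.+1%:R))%:R / k.+1%:R) *: v))
      @[k --> ultra_oo] --> E (t *: w).
    by under eq_fun do rewrite -scalerA lc_exp_natmul// fX.
  exact: (cvg_unique hG h2 h3).
exists w => t; have [t0|/ltW t0] := leP 0 t; first exact: W.
rewrite -(opprK t); move: (- t) (etrans (oppr_ge0 t) t0) => s s0.
by rewrite !scaleNr !(lc_expN L hG) fV W.
Qed.

End one_parameter_subgroups.

(** * The bracket *)

Lemma sub_sub2 (V : zmodType) (p q a b : V) :
  p - q = (p - a - b) - (q - b - a).
Proof.
by rewrite [q - b - a]addrAC -[p - a - b]addrA -[q - a - b]addrA -opprD opprB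
  addrA subrK.
Qed.

Section bracket.
Context {R : realType} {G : topologicalGroupType} {n : nat}.
Variable L : local_chart R G n.
Hypothesis hG : hausdorff_space G.
Local Notation psi := (lc_psi L).
Local Notation r := (lc_r L).
Local Notation C := (lc_C L).
Local Notation E := (lc_exp L).
Local Notation B := (bform (lc_beta L)).
Implicit Types (x y : G) (m k : nat) (u v w : 'rV[R]_n) (s t : R).

Let r0 : 0 < r := lc_r_gt0 L.
Let C0 : 0 <= C := lc_C_ge0 L.
Let natS_gt0 := @natS_gt0 R.
Let cvg_invS := @cvg_invS R.

(** [M] is the differential of [f] at 1. Homogeneity holds because a one-parameter subgroup
    determines its velocity, additivity because [f] commutes with the limit in the Trotter
    formula. *)
Lemma endomorphism_matrix (f : G -> G) : continuous f ->
  {morph f : x y / (x * y)%g} ->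
  exists M : 'M[R]_n, forall v t, f (E (t *: v)) = E (t *: (v *m M)).
Proof.
move=> cf fM; have [tau tauP] :
  exists tau, forall v t, f (E (t *: v)) = E (t *: tau v).
  by have [tau tauP] := choice (fun v => endomorphism_exp L hG v cf fM);
    exists tau.
have tauZ c v : tau (c *: v) = c *: tau v.
  by apply: (@lc_exp_inj _ _ _ L hG) => t _; rewrite -tauP scalerA tauP scalerA.
have f1 : f 1%g = 1%g by apply: (@mulgI _ (f 1%g)); rewrite -fM !mulg1.
have fX x k : f (x ^+ k)%g = (f x ^+ k)%g.
  by elim: k => [|k IH]; rewrite ?expg0 ?f1// !expgS fM IH.
have tauD u v : tau (u + v) = tau u + tau v.
  apply: (@lc_exp_inj _ _ _ L hG) => t _; rewrite -tauP !scalerDr.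
  pose proof (@lc_exp_trotter _ _ _ L hG (t *: u) (t *: v)) as h1.
  pose proof (@lc_exp_trotter _ _ _ L hG (t *: tau u) (t *: tau v)) as h2.
  have h3 : f ((E (k.+1%:R^-1 *: (t *: u)) * E (k.+1%:R^-1 *: (t *: v))) ^+
    k.+1)%g
     @[k --> \oo] --> f (E (t *: u + t *: v)).
    exact: (cvg_comp _ _ h1 (cf (E (t *: u + t *: v)))).
  have E3 : (fun k : nat => f ((E (k.+1%:R^-1 *: (t *: u)) *
      E (k.+1%:R^-1 *: (t *: v))) ^+ k.+1)%g) = (fun k : nat =>
      ((E (k.+1%:R^-1 *: (t *: tau u)) * E (k.+1%:R^-1 *: (t *: tau v))) ^+
        k.+1)%g).
    by apply/funext => k; rewrite fX fM !scalerA !tauP.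
  rewrite E3 in h3; exact: (cvg_unique hG h3 h2).
have tau0 : tau 0 = 0 by rewrite -(scale0r 0) tauZ !scale0r.
exists (\matrix_i tau (delta_mx 0 i)) => v t; rewrite tauP; congr (E (t *: _)).
rewrite mulmx_sum_row {1}(row_sum_delta v).
rewrite (big_morph tau tauD tau0); apply: eq_bigr => i _.
by rewrite tauZ rowK.
Qed.

(** The Lie bracket: the second-order term of the product, antisymmetrised. [lc_exp_commutator_cvg]
    shows it as a limit of rescaled group commutators. *)
Definition lc_bracket u v := B u v - B v u.

Lemma lc_bracketC u v : lc_bracket v u = - lc_bracket u v.
Proof. by rewrite /lc_bracket opprB. Qed.

Lemma lc_bracketZl c u v : lc_bracket (c *: u) v = c *: lc_bracket u v.
Proof. by rewrite /lc_bracket bformZl bformZr scalerBr. Qed.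

Lemma lc_bracketDl u u' v :
  lc_bracket (u + u') v = lc_bracket u v + lc_bracket u' v.
Proof. by rewrite /lc_bracket bformDl bformDr opprD addrACA. Qed.

Lemma lc_bracketZr c u v : lc_bracket u (c *: v) = c *: lc_bracket u v.
Proof. by rewrite lc_bracketC lc_bracketZl lc_bracketC scalerN opprK. Qed.

Lemma lc_bracketDr u v v' :
  lc_bracket u (v + v') = lc_bracket u v + lc_bracket u v'.
Proof. by rewrite lc_bracketC lc_bracketDl !(lc_bracketC u) opprD !opprK. Qed.

Lemma lc_bracketxx u : lc_bracket u u = 0.
Proof. by rewrite /lc_bracket subrr. Qed.

Lemma bform_cvg I (F : set_system I) {FF : Filter F} (x y : I -> 'rV[R]_n) u w :
  x @ F --> u -> y @ F --> w -> B (x i) (y i) @[i --> F] --> B u w.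
Proof.
move=> xu yw; have [K K0 KP] := bform_bounded (lc_beta L).
apply: (@cvg_dist_le _ _ _ _ _ _ _
  (fun i => K * (`|x i - u| * `|y i|) + K * (`|u| * `|y i - w|))).
  apply: nearW => i; have -> : B (x i) (y i) - B u w =
      B (x i - u) (y i) + B u (y i - w).
    rewrite bformDl bformDr -[- u]scaleN1r -[- w]scaleN1r bformZl bformZr.
    by rewrite !scaleN1r subrKA.
  by apply: le_trans (ler_normD _ _) _; apply: lerD; exact: KP.
have -> : 0 = K * (`|u - u| * `|w|) + K * (`|u| * `|w - w|).
  by rewrite !subrr !normr0 mul0r !mulr0 addr0.
apply: cvgD; apply: cvgM; try exact: cvg_cst.
- apply: cvgM; last exact: cvg_norm.
  by apply: cvg_norm; apply: cvgB => //; exact: cvg_cst.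
- apply: cvgM; first exact: cvg_cst.
  by apply: cvg_norm; apply: cvgB => //; exact: cvg_cst.
Qed.

Lemma psi_scale2_mul I (F : set_system I) {FF : Filter F} (a : I -> R)
    (x y : I -> G) u w : (forall i, 0 < a i) ->
  (a i)^-1 @[i --> F] --> (0 : R) ->
  a i *: psi (x i) @[i --> F] --> u -> a i *: psi (y i) @[i --> F] --> w ->
  a i ^+ 2 *: (psi (x i * y i)%g - psi (x i) - psi (y i)) @[i --> F] --> B u w.
Proof.
move=> a0 a_oo xu yw.
have x0 := @cvg_scale0 _ _ _ _ FF _ _ _ a0 a_oo xu.
have y0 := @cvg_scale0 _ _ _ _ FF _ _ _ a0 a_oo yw.
have -> : (fun i => a i ^+ 2 *: (psi (x i * y i)%g - psi (x i) - psi (y i))) =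
  (fun i => a i ^+ 2 *: (psi (x i * y i)%g - psi (x i) - psi (y i) -
       B (psi (x i)) (psi (y i))) + B (a i *: psi (x i)) (a i *: psi (y i))).
  by apply/funext => i; rewrite bformZl bformZr scalerA -expr2 -scalerDr subrK.
rewrite -[B u w]add0r; apply: cvgD; last exact: bform_cvg.
apply/cvgr0Pnorm_lt => e e0.
(* [M] eventually bounds the product of the norms of the rescaled coordinates, so an error [e / M]
   in the Taylor expansion becomes less than [e] after scaling by [a i ^+ 2]. *)
pose M := (`|u| + 1) * (`|w| + 1).
have M0 : 0 < M by rewrite mulr_gt0// ltr_wpDl.
have [rho rho0 rhoP] := lc_mul_beta L (divr_gt0 e0 M0).
have hx : \forall i \near F, `|psi (x i)| < rho.
  by have /cvgr0Pnorm_lt/(_ rho rho0) := x0.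
have hy : \forall i \near F, `|psi (y i)| < rho.
  by have /cvgr0Pnorm_lt/(_ rho rho0) := y0.
have hu : \forall i \near F, `|a i *: psi (x i)| < `|u| + 1.
  by apply: near_lt_of_cvg (cvg_norm xu) _; rewrite ltrDl.
have hw : \forall i \near F, `|a i *: psi (y i)| < `|w| + 1.
  by apply: near_lt_of_cvg (cvg_norm yw) _; rewrite ltrDl.
near=> i.
have h1 : `|psi (x i)| < rho by near: i.
have h2 : `|psi (y i)| < rho by near: i.
have h3 : `|a i *: psi (x i)| < `|u| + 1 by near: i.
have h4 : `|a i *: psi (y i)| < `|w| + 1 by near: i.
rewrite normrZ ger0_norm ?exprn_ge0 ?(ltW (a0 i))//.
apply: le_lt_trans (ler_wpM2l _ (rhoP _ _ h1 h2)) _.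
  by rewrite exprn_ge0// ltW.
have -> : a i ^+ 2 * (e / M * `|psi (x i)| * `|psi (y i)|) =
    e / M * (`|a i *: psi (x i)| * `|a i *: psi (y i)|).
  by rewrite !normrZ !(gtr0_norm (a0 i)); ring.
rewrite mulrAC ltr_pdivrMr// ltr_pM2l//; exact: ltr_pM.
Unshelve. all: by end_near. Qed.

(** The product estimate is applied to [c * (y * x) = x * y]. It first gives that [|psi c|] is at
    most twice the difference of coordinates, then that the error is this difference times a small
    factor. *)
Lemma psi_commutator_le x y : let c := (x * y * (y * x)^-1)%g in
  `|psi c| < r -> `|psi (y * x)%g| < r ->
  `|psi c - (psi (x * y)%g - psi (y * x)%g)| <=
     2 * C * `|psi (x * y)%g - psi (y * x)%g| * `|psi (y * x)%g|.
Proof.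
move=> c cr zr; set z := (y * x)%g in zr *.
have cz : (c * z = x * y)%g by rewrite mulgVK.
have h1 := lc_mul_le_l cr zr; have h2 := lc_mul_le cr zr.
rewrite cz in h1 h2; set D := psi (x * y)%g - psi z.
have E1 : psi (x * y)%g - psi c - psi z = D - psi c by rewrite addrAC.
rewrite {}E1 in h1 h2.
have cD : `|psi c| <= 2 * `|D|.
  have : `|psi c| <= `|D| + `|D - psi c|.
    by rewrite -{1}(subKr D (psi c)); exact: ler_normB.
  have := normr_ge0 D; lra.
rewrite distrC; apply: le_trans h2 _.
by rewrite [2 * C]mulrC -[C * 2 * _]mulrA ler_wpM2r// ler_wpM2l.
Qed.

Lemma psi_scale2_commutator I (F : set_system I) {FF : Filter F} (a : I -> R)
    (x y : I -> G) u w : (forall i, 0 < a i) ->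
  (a i)^-1 @[i --> F] --> (0 : R) ->
  a i *: psi (x i) @[i --> F] --> u -> a i *: psi (y i) @[i --> F] --> w ->
  a i ^+ 2 *: psi (x i * y i * (y i * x i)^-1)%g @[i --> F] --> lc_bracket u w.
Proof.
move=> a0 a_oo xu yw.
have x0 := @cvg_scale0 _ _ _ _ FF _ _ _ a0 a_oo xu.
have y0 := @cvg_scale0 _ _ _ _ FF _ _ _ a0 a_oo yw.
pose proof (cvg1_psi x0) as x1; pose proof (cvg1_psi y0) as y1.
have z1 : (y i * x i)%g @[i --> F] --> 1%g.
  by rewrite -[1%g]mulg1; exact: cvg_mulg.
have c1 : (x i * y i * (y i * x i)^-1)%g @[i --> F] --> 1%g.
  rewrite -[1%g]mulg1; apply: cvg_mulg.
    by rewrite -[1%g]mulg1; exact: cvg_mulg.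
  by rewrite -invg1; exact: cvg_invg.
pose proof (psi_cvg1 L z1) as z0; pose proof (psi_cvg1 L c1) as c0.
have Dw : a i ^+ 2 *: (psi (x i * y i)%g - psi (y i * x i)%g) @[i --> F] -->
    lc_bracket u w.
  have -> : (fun i => a i ^+ 2 *: (psi (x i * y i)%g - psi (y i * x i)%g)) =
    (fun i => a i ^+ 2 *: (psi (x i * y i)%g - psi (x i) - psi (y i)) -
              a i ^+ 2 *: (psi (y i * x i)%g - psi (y i) - psi (x i))).
    apply/funext => i; rewrite -scalerBr; congr (_ *: _).
    exact: sub_sub2.
  by apply: cvgB; exact: psi_scale2_mul.
have -> : (fun i => a i ^+ 2 *: psi (x i * y i * (y i * x i)^-1)%g) =
  (fun i => a i ^+ 2 *: (psi (x i * y i)%g - psi (y i * x i)%g) +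
    a i ^+ 2 *: (psi (x i * y i * (y i * x i)^-1)%g -
       (psi (x i * y i)%g - psi (y i * x i)%g))).
  by apply/funext => i; rewrite -scalerDr subrKC.
rewrite -[lc_bracket u w]addr0; apply: cvgD => //.
apply: (@cvg_dist_le _ _ _ _ _ _ _ (fun i => 2 * C *
  (`|a i ^+ 2 *: (psi (x i * y i)%g - psi (y i * x i)%g)| * `|psi (y i * x
    i)%g|))).
  have /cvgr0Pnorm_lt/(_ r r0) := z0; have /cvgr0Pnorm_lt/(_ r r0) := c0.
  apply: filterS2 => i cr zr; rewrite subr0 !normrZ.
  rewrite -[X in _ <= _ * X]mulrA [X in _ <= X]mulrCA ler_wpM2l// mulrA.
  exact: psi_commutator_le.
have -> : 0 = 2 * C * (`|lc_bracket u w| * `|0 : 'rV[R]_n|).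
  by rewrite normr0 !mulr0.
apply: cvgM; first exact: cvg_cst.
by apply: cvgM; exact: cvg_norm.
Qed.

Lemma natS2_gt0 (k : nat) : 0 < (k.+1%:R ^+ 2) :> R.
Proof. exact: exprn_gt0. Qed.

Lemma cvg_invS2 : ((k.+1%:R : R) ^+ 2)^-1 @[k --> \oo] --> (0 : R).
Proof.
under eq_fun do rewrite expr2 invfM.
by rewrite -(mulr0 0); apply: cvgM; exact: cvg_invS.
Qed.

Lemma lc_exp_commutator_cvg u w :
  k.+1%:R ^+ 2 *: psi (E (k.+1%:R^-1 *: u) * E (k.+1%:R^-1 *: w) *
     (E (k.+1%:R^-1 *: w) * E (k.+1%:R^-1 *: u))^-1)%g @[k --> \oo] -->
  lc_bracket u w.
Proof.
apply: (psi_scale2_commutator natS_gt0 cvg_invS).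
  exact: (@psi_scale_exp _ _ _ L hG _ _ _ _ u natS_gt0 cvg_invS).
exact: (@psi_scale_exp _ _ _ L hG _ _ _ _ w natS_gt0 cvg_invS).
Qed.

(** [E (t *: lc_bracket u w)] is a limit of powers of commutators of [E (u / k.+1)] and
    [E (w / k.+1)], and [f] sends these to the commutators built from [u *m M] and [w *m M]. *)
Lemma lc_bracket_endomorphism (f : G -> G) (M : 'M[R]_n) : continuous f ->
  {morph f : x y / (x * y)%g} ->
  (forall v t, f (E (t *: v)) = E (t *: (v *m M))) ->
  forall u w, lc_bracket u w *m M = lc_bracket (u *m M) (w *m M).
Proof.
move=> cf fM fE u w.
have f1 : f 1%g = 1%g by apply: (@mulgI _ (f 1%g)); rewrite -fM !mulg1.
have fX x k : f (x ^+ k)%g = (f x ^+ k)%g.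
  by elim: k => [|k IH]; rewrite ?expg0 ?f1// !expgS fM IH.
have fV x : f (x^-1)%g = (f x)^-1%g.
  by apply: (@mulgI _ (f x)); rewrite -fM !mulgV.
apply: (@lc_exp_inj _ _ _ L hG) => t t0; rewrite -fE.
pose proof (lc_expg_truncn_cvg natS2_gt0 t0 cvg_invS2
  (@lc_exp_commutator_cvg u w)) as h1.
pose proof (lc_expg_truncn_cvg natS2_gt0 t0 cvg_invS2
  (@lc_exp_commutator_cvg (u *m M) (w *m M))) as h2.
pose c k := (E (k.+1%:R^-1 *: u) * E (k.+1%:R^-1 *: w) *
     (E (k.+1%:R^-1 *: w) * E (k.+1%:R^-1 *: u))^-1)%g.
have h3 : f (c k ^+ Num.truncn (t * k.+1%:R ^+ 2))%g @[k --> \oo] -->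
    f (E (t *: lc_bracket u w)).
  exact: (cvg_comp _ _ h1 (cf (E (t *: lc_bracket u w)))).
have E3 : (fun k => f (c k ^+ Num.truncn (t * k.+1%:R ^+ 2))%g) =
  (fun k : nat => (E (k.+1%:R^-1 *: (u *m M)) * E (k.+1%:R^-1 *: (w *m M)) *
     (E (k.+1%:R^-1 *: (w *m M)) * E (k.+1%:R^-1 *: (u *m M)))^-1)%g ^+
     Num.truncn (t * k.+1%:R ^+ 2))%g.
  by apply/funext => k; rewrite fX !fM fV !fM !fE.
rewrite E3 in h3; exact: (cvg_unique hG h3 h2).
Qed.

End bracket.

Lemma sub_sub3 (V : zmodType) (p x y z : V) :
  z - y = (p - x - y) - (p - z - x).
Proof.
by rewrite [p - z - x]addrAC opprB [RHS]addrC subrKA.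
Qed.

(** * Vanishing bracket and commuting one-parameter subgroups *)

Section bracket_commute.
Context {R : realType} {G : topologicalGroupType} {n : nat}.
Variable L : local_chart R G n.
Hypothesis hG : hausdorff_space G.
Local Notation psi := (lc_psi L).
Local Notation r := (lc_r L).
Local Notation E := (lc_exp L).
Local Notation bracket := (lc_bracket L).
Implicit Types (x y : G) (m k : nat) (u v w : 'rV[R]_n) (s t : R).

Let r0 : 0 < r := lc_r_gt0 L.
Let natS_gt0 := @natS_gt0 R.
Let cvg_invS := @cvg_invS R.

Lemma nbhs1_psi (A : set G) : nbhs (1%g : G) A ->
  exists2 d, 0 < d & forall x, `|psi x| < d -> A x.
Proof.
move=> nA; have : nbhs (lc_xi L 0) A by rewrite lc_xi0.
have z0 : `|0 : 'rV[R]_n| < r by rewrite normr0.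
move=> /(lc_xi_cont z0)/nbhs_rV_ball[d d0 dA].
exists (Num.min d r); first by rewrite lt_min d0.
move=> x; rewrite lt_min => /andP[xd xr].
by rewrite -(lc_psiK xr); apply: dA; rewrite subr0.
Qed.

Lemma psi_conj_lt : exists2 d, 0 < d <= r &
  forall x y, `|psi x| < d -> `|psi y| < d -> `|psi (x * y * x^-1)%g| < r.
Proof.
have h1 : z.1 @[z --> ((1%g, 1%g) : G * G)] --> (1%g : G).
  exact: (@cvg_fst G G (nbhs (1%g : G)) (nbhs (1%g : G)) _).
have h2 : z.2 @[z --> ((1%g, 1%g) : G * G)] --> (1%g : G).
  exact: (@cvg_snd G G (nbhs (1%g : G)) (nbhs (1%g : G)) _).
pose proof (cvg_mulg (cvg_mulg h1 h2) (cvg_invg h1)) as h.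
rewrite invg1 !mulg1 in h.
have : nbhs (1%g : G) [set x | `|psi x| < r].
  pose proof (psi_cvg1 L (@cvg_id _ (nbhs (1%g : G)))) as h'.
  by move/cvgr0Pnorm_lt: h' => /(_ r r0).
move=> /h[[P Q] /= [/nbhs1_psi[d d0 dP] /nbhs1_psi[e e0 eQ]] PQ].
exists (Num.min r (Num.min d e)); first by rewrite !lt_min r0 d0 e0 ge_min lexx.
move=> x y; rewrite !lt_min => /andP[_ /andP[xd _]] /andP[_ /andP[_ ye]].
by apply: (PQ (x, y)); split; [exact: dP|exact: eQ].
Qed.

(** The conjugate [z] satisfies [z * x = x * y]. Expanding both sides with an error relative to [z]
    and to [y], rather than to [x], gives [psi z] close to [psi y] even when [x] is much larger. *)
Lemma psi_conj_le x y : `|psi x| < r -> `|psi y| < r ->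
  `|psi (x * y * x^-1)%g| < r -> `|psi (x * y * x^-1)%g| <= 2 * `|psi y|.
Proof.
move=> xr yr zr; set z := (x * y * x^-1)%g in zr *.
have zx : (z * x = x * y)%g by rewrite mulgVK.
have h1 := lc_mul_le_l zr xr; have h2 := lc_mul_le_r xr yr.
rewrite zx in h1; have : `|psi z - psi y| <= 10^-1 * `|psi z| +
  10^-1 * `|psi y|.
  have -> : psi z - psi y = (psi (x * y)%g - psi x - psi y) -
      (psi (x * y)%g - psi z - psi x) by rewrite -sub_sub3.
  apply: le_trans (ler_normB _ _) _; rewrite addrC; exact: lerD.
have : `|psi z| <= `|psi y| + `|psi z - psi y|.
  by rewrite -{1}(subrKC (psi y) (psi z)); exact: ler_normD.
have := normr_ge0 (psi y); lra.
Qed.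

(* x^j y x^-j y^-1 is a product of j conjugates of the commutator c of x and y
  *)
Lemma psi_commutator_expg_le d x y m : let c := (x * y * (y * x)^-1)%g in
  d <= r ->
  (forall g h, `|psi g| < d -> `|psi h| < d -> `|psi (g * h * g^-1)%g| < r) ->
  (forall j, (j <= m)%N -> `|psi (x ^+ j)%g| < d) ->
  `|psi c| < d -> 4 * m%:R * `|psi c| < r ->
  `|psi (x ^+ m * y * (x ^+ m)^-1 * y^-1)%g| <= 4 * m%:R * `|psi c|.
Proof.
move=> c dr conj_lt; elim: m => [|m IH] xd cd cm.
  by rewrite expg0 invg1 mulg1 mul1g mulgV lc_psi1 normr0 mulr0 mul0r.
have cR := lt_le_trans cd dr; have c0 := normr_ge0 (psi c).
rewrite -[m.+1%:R]natr1 in cm *.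
have cm' : 4 * m%:R * `|psi c| < r by nra.
have {}IH := IH (fun j jm => xd j (leqW jm)) cd cm'.
set e := (x ^+ m * c * (x ^+ m)^-1)%g.
set h := (x ^+ m * y * (x ^+ m)^-1 * y^-1)%g in IH *.
have -> : (x ^+ m.+1 * y * (x ^+ m.+1)^-1 * y^-1 = e * h)%g.
  rewrite /e /h /c expgSr !invgM !mulgA; congr (_ * _)%g.
  by rewrite !mulgVK.
have xm := xd m (leqnSn m).
have er := conj_lt _ _ xm cd.
have e2 := psi_conj_le (lt_le_trans xm dr) cR er.
have hr := le_lt_trans IH cm'.
apply: le_trans (norm_le_sub2 (lc_mul_le_l er hr)) _.
by rewrite -/e in e2 *; lra.
Qed.

(** As the bracket vanishes, the commutator [c k] of [E (u / k.+1)] and [E (w / k.+1)] is negligible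
    against [1 / k.+1 ^ 2], so the commutator [h k] of [E u] and [y k] is negligible against
    [1 / k.+1]. Hence [(h k * y k) ^+ k.+1] tends to [E w]; but [h k * y k] is the conjugate of
    [y k] by [E u], so this power is constantly the conjugate of [E w]. *)
Lemma lc_exp_commute_small d u w : 0 < d -> d <= r ->
  (forall g h, `|psi g| < d -> `|psi h| < d -> `|psi (g * h * g^-1)%g| < r) ->
  16 * `|u| < d -> bracket u w = 0 -> commute (E u) (E w).
Proof.
move=> d0 dr conj_lt ud uw.
pose x k := E (k.+1%:R^-1 *: u); pose y k := E (k.+1%:R^-1 *: w).
pose c k := (x k * y k * (y k * x k)^-1)%g.
have c2 : k.+1%:R ^+ 2 *: psi (c k) @[k --> \oo] --> (0 : 'rV[R]_n).
  by rewrite -uw; exact: lc_exp_commutator_cvg.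
pose proof (cvg_scale0 (@natS2_gt0 R) (@cvg_invS2 R) c2) as c0.
pose h k := (E u * y k * (E u)^-1 * (y k)^-1)%g.
have xE k : (x k ^+ k.+1)%g = E u by exact: lc_exp_frac.
have hle : \forall k \near \oo, `|psi (h k)| <= 4 * k.+1%:R * `|psi (c k)|.
  have r4 : 0 < r / 4 by rewrite divr_gt0.
  have /cvgr0Pnorm_lt/(_ _ r4) := c2; have /cvgr0Pnorm_lt/(_ _ d0) := c0.
  apply: filterS2 => k cd cr; rewrite /h -(xE k).
  apply: (@psi_commutator_expg_le d) => //.
    move=> j jk; rewrite /x -(lc_exp_natmul L hG) scalerA.
    have t1 : `|j%:R / k.+1%:R : R| <= 1.
      by rewrite ger0_norm ?divr_ge0// ler_pdivrMr// mul1r ler_nat.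
    have tu : `|(j%:R / k.+1%:R) *: u| <= `|u| by rewrite normrZ ler_piMl.
    have u0 := normr_ge0 u.
    apply: le_lt_trans (psi_lc_exp_le hG _) _; lra.
  move: cr; rewrite normrZ ger0_norm ?exprn_ge0// => cr.
  have k1 : 1 <= k.+1%:R :> R by rewrite ler1n.
  have p0 := normr_ge0 (psi (c k)).
  have : k.+1%:R * `|psi (c k)| <= k.+1%:R ^+ 2 * `|psi (c k)|.
    by rewrite ler_wpM2r// expr2 ler_peMl// (le_trans ler01).
  rewrite -/(c k) -mulrA; lra.
have hh : k.+1%:R *: psi (h k) @[k --> \oo] --> (0 : 'rV[R]_n).
  apply: (@cvg_dist_le _ _ _ _ _ _ _ (fun k =>
    4 * `|k.+1%:R ^+ 2 *: psi (c k)|)).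
    move: hle; apply: filterS => k hk; rewrite subr0 !normrZ.
    rewrite !ger0_norm ?exprn_ge0//.
    apply: le_trans (ler_wpM2l _ hk) _ => //.
    by rewrite le_eqVlt; apply/orP; left; apply/eqP; ring.
  have -> : 0 = 4 * `|0 : 'rV[R]_n| by rewrite normr0 mulr0.
  by apply: cvgM; [exact: cvg_cst|exact: cvg_norm].
pose proof (@psi_scale_exp _ _ _ L hG _ _ _ _ w natS_gt0 cvg_invS) as yy.
pose proof (psi_scale_mul natS_gt0 cvg_invS hh yy) as zz; rewrite add0r in zz.
pose proof (lc_expg_cvg (cvg_scale0 natS_gt0 cvg_invS zz) zz) as h1.
have E1 : (fun k => ((h k * y k) ^+ k.+1)%g) = (fun=> (E u * E w * (E u)^-1)%g).
  apply/funext => k; rewrite mulgVK.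
  rewrite -[(E u * y k * (E u)^-1)%g](_ : (y k ^ ((E u)^-1))%g = _); last first.
    by rewrite conjgE invgK mulgA.
  by rewrite -conjXg (lc_exp_frac L hG) conjgE invgK mulgA.
have h2 : (E u * E w * (E u)^-1)%g @[k --> \oo] --> (E u * E w * (E u)^-1)%g.
  exact: cvg_cst.
rewrite E1 in h1; pose proof (cvg_unique hG h1 h2) as e.
by rewrite /commute [in RHS]e mulgVK.
Qed.

(** Only [u] has to be small in the previous lemma; [E u] is a power of [E (u / k.+1)], and scaling
    [u] keeps the bracket zero. *)
Lemma lc_bracket0_commute u w : bracket u w = 0 -> commute (E u) (E w).
Proof.
move=> uw; have [d /andP[d0 dr] conj_lt] := psi_conj_lt.
pose k := Num.truncn (16 * `|u| / d).
have kd : 16 * `|u| / d < k.+1%:R by exact: truncnS_gt.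
rewrite -(lc_exp_frac L hG k u); apply/commute_sym/commuteX/commute_sym.
apply: (lc_exp_commute_small d0 dr conj_lt); last first.
  by rewrite lc_bracketZl uw scaler0.
rewrite normrZ ger0_norm ?invr_ge0// mulrCA mulrC ltr_pdivrMr//.
by rewrite -ltr_pdivrMl// mulrC.
Qed.

End bracket_commute.

(** * Invariant abelian subspaces *)

(** [X] and [Y] are the real and imaginary parts of a complex eigenvector for the eigenvalue with
    parts [a] and [b]. They may be dependent: a line is allowed. *)
Lemma invariant_plane (R : rcfType) n (M : 'M[R]_n.+1) :
  exists (X Y : 'rV[R]_n.+1) (a b : R),
    [/\ X != 0 \/ Y != 0, X *m M = a *: X - b *: Y & Y *m M = b *: X + a *: Y].
Proof.
pose F := complex.complex R; pose inj := @complex.real_complex_def _ (Phant R).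
have [l ll] : exists l : F, root (char_poly (map_mx inj M)) l.
  by apply/closed_rootP; rewrite size_char_poly.
have : eigenvalue (map_mx inj M) l by rewrite eigenvalue_root_char.
move=> /eigenvalueP[v vM v0].
pose X := map_mx (@complex.Re R) v; pose Y := map_mx (@complex.Im R) v.
exists X, Y, (complex.Re l), (complex.Im l).
have ReM (u : 'rV[F]_n.+1) j : complex.Re ((u *m map_mx inj M) 0 j) =
    (map_mx (@complex.Re R) u *m M) 0 j.
  rewrite !mxE raddf_sum; apply: eq_bigr => i _; rewrite !mxE.
  by case: (u 0 i) => p q /=; rewrite mulr0 subr0.
have ImM (u : 'rV[F]_n.+1) j : complex.Im ((u *m map_mx inj M) 0 j) =
    (map_mx (@complex.Im R) u *m M) 0 j.
  rewrite !mxE raddf_sum; apply: eq_bigr => i _; rewrite !mxE.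
  by case: (u 0 i) => p q /=; rewrite mulr0 add0r.
split.
- have [X0|X0] := eqVneq X 0; last by left.
  right; apply: contra_neq v0 => Y0; apply/rowP => j; rewrite mxE.
  have := congr1 (fun Z : 'rV[R]_n.+1 => Z 0 j) X0.
  have := congr1 (fun Z : 'rV[R]_n.+1 => Z 0 j) Y0.
  by rewrite !mxE; case: (v 0 j) => p q /= -> ->.
- apply/rowP => j; rewrite -ReM vM !mxE.
  by case: l {ll vM} => p q; case: (v 0 j) => p' q'.
- apply/rowP => j; rewrite -ImM vM !mxE.
  by case: l {ll vM} => p q; case: (v 0 j) => p' q' /=; rewrite addrC.
Qed.

Section invariant_abelian.
Context {R : realType} {G : topologicalGroupType} {n : nat}.
Variable L : local_chart R G n.+1.
Local Notation bracket := (lc_bracket L).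

Lemma rowspace_row2 (X Y u : 'rV[R]_n.+1) : (u <= col_mx X Y)%MS ->
  exists s t : R, u = s *: X + t *: Y.
Proof.
move=> /submxP[D ->]; rewrite -(hsubmxK D) mul_row_col.
rewrite [lsubmx D]mx11_scalar [rsubmx D]mx11_scalar !mul_scalar_mx.
by eexists; eexists.
Qed.

(* On an invariant plane spanned by X and Y the endomorphism M multiplies the
   bracket of X and Y by its determinant: the bracket vanishes, or it is itself
   an eigenvector. *)
Lemma invariant_abelian_subspace (M : 'M[R]_n.+1) :
  (forall u w, bracket u w *m M = bracket (u *m M) (w *m M)) ->
  exists P : 'M[R]_n.+1, [/\ P != 0, (P *m M <= P)%MS &
    forall u w : 'rV_n.+1, (u <= P)%MS -> (w <= P)%MS -> bracket u w = 0].
Proof.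
move=> bM; have [X [Y [a [b [XY0 XM YM]]]]] := invariant_plane M.
have b2 (s t s' t' : R) : bracket (s *: X + t *: Y) (s' *: X + t' *: Y) =
    (s * t' - t * s') *: bracket X Y.
  rewrite !lc_bracketDl !lc_bracketDr !lc_bracketZl !lc_bracketZr !lc_bracketxx.
  rewrite !scaler0 add0r addr0 !scalerA (lc_bracketC L X Y) scalerN.
  by rewrite -scalerBl.
have [Z0|Z0] := eqVneq (bracket X Y) 0.
  exists <<col_mx X Y>>%MS; split.
  - rewrite -mxrank_eq0 genmxE mxrank_eq0; case: XY0 => h;
      apply: contra h => /eqP e.
      by have := congr1 usubmx e; rewrite col_mxKu => ->; rewrite linear0.
    by have := congr1 dsubmx e; rewrite col_mxKd => ->; rewrite linear0.
  - rewrite (eqmxMr _ (genmxE _)) genmxE mul_col_mx XM YM col_mx_sub.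
    have Xs : (X <= col_mx X Y)%MS by rewrite -addsmxE addsmxSl.
    have Ys : (Y <= col_mx X Y)%MS by rewrite -addsmxE addsmxSr.
    by rewrite addmx_sub ?scalemx_sub ?eqmx_opp ?scalemx_sub//= addmx_sub
      ?scalemx_sub.
  - move=> u w; rewrite !genmxE =>
      /rowspace_row2[s [t ->]] /rowspace_row2[s' [t' ->]].
    by rewrite b2 Z0 scaler0.
exists <<bracket X Y>>%MS; split.
- by rewrite -mxrank_eq0 genmxE mxrank_eq0.
- rewrite (eqmxMr _ (genmxE _)) genmxE bM XM YM -scaleNr b2.
  exact: scalemx_sub.
- move=> u w; rewrite !genmxE => /sub_rVP[s ->] /sub_rVP[t ->].
  by rewrite lc_bracketZl lc_bracketZr lc_bracketxx !scaler0.
Qed.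

End invariant_abelian.

(** * Closed subgroups *)

Section closure_subgroup.
Context {G : topologicalGroupType}.
Variable S : set G.
Hypothesis S1 : S 1%g.
Hypothesis SM : forall x y, S x -> S y -> S (x * y)%g.
Hypothesis SV : forall x, S x -> S (x^-1)%g.

Lemma closure_filter (T : topologicalType) (A : set T) x : closure A x ->
  exists F : set_system T, [/\ ProperFilter F, id @ F --> x & F A].
Proof.
rewrite closureEcvg => -[F PF [Fx FA]]; exists F; split=> //.
by apply: FA.
Qed.

Lemma closure_closed_subgroup : closed_subgroup_set (closure S).
Proof.
split; first exact: closed_closure.
- exact: subset_closure.
- move=> x y /closure_filter[F [PF Fx FS]] /closure_filter[H [PH Hy HS]].
  pose proof (@cvg_fst G G F H _) as f1; pose proof (@cvg_snd G G F H _) as f2.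
  have g1 : fst @ filter_prod F H --> x by exact: cvg_trans f1 Fx.
  have g2 : snd @ filter_prod F H --> y by exact: cvg_trans f2 Hy.
  apply: (closed_cvg _ (@closed_closure _ S) _ _ (cvg_mulg g1 g2)).
  have FHS : filter_prod F H (S `*` S) by exists (S, S).
  by move: FHS; apply: filterS => -[a b] [/= Sa Sb]; exact/subset_closure/SM.
- move=> x /closure_filter[F [PF Fx FS]].
  apply: (closed_cvg _ (@closed_closure _ S) _ _ (cvg_invg Fx)).
  by move: FS; apply: filterS => a Sa; exact/subset_closure/SV.
Qed.

Lemma closure_commute : hausdorff_space G ->
  (forall x y, S x -> S y -> commute x y) ->
  forall x y, closure S x -> closure S y -> commute x y.
Proof.
move=> hG cS.
have W x (A : set G) y : (forall z, A z -> commute x z) -> closure A y ->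
  commute x y.
  move=> Ax /closure_filter[F [PF Fy FA]].
  have h1 : (x * z)%g @[z --> F] --> (x * y)%g by apply: cvg_mulg => //;
    exact: cvg_cst.
  have h2 : (z * x)%g @[z --> F] --> (y * x)%g by apply: cvg_mulg => //;
    exact: cvg_cst.
  apply: (cvg_unique hG h1); apply: cvg_trans h2.
  by apply: near_eq_cvg; move: FA; apply: filterS => z /Ax.
move=> x y Sx Sy; apply: (W x S y _ Sy) => z Sz; apply/commute_sym.
by apply: (W z S x _ Sx) => t St; exact: cS.
Qed.

End closure_subgroup.

Section subspaces.
Context {R : realType} {n : nat}.

Lemma mulmx_cvg m I (F : set_system I) {FF : Filter F} (v : I ->
  'rV[R]_n) (w : 'rV[R]_n)
    (A : 'M[R]_(n, m)) : v @ F --> w -> v i *m A @[i --> F] --> w *m A.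
Proof.
move=> vw; pose K := \sum_i \sum_j `|A i j|.
apply: (@cvg_dist_le _ _ _ _ _ _ _ (fun i => K * `|v i - w|)).
  apply: nearW => i; rewrite -mulmxBl; apply: rV_norm_le => [|j].
    by rewrite mulr_ge0// sumr_ge0// => k _; exact: sumr_ge0.
  rewrite mxE; apply: le_trans (ler_norm_sum _ _ _) _; rewrite mulr_suml.
  apply: ler_sum => k _; rewrite normrM mulrC; apply: ler_pM => //.
    by rewrite (bigD1 j)//= lerDl sumr_ge0.
  exact: le_rV_norm.
have -> : 0 = K * `|w - w| by rewrite subrr normr0 mulr0.
apply: cvgM; first exact: cvg_cst.
by apply: cvg_norm; apply: cvgB => //; exact: cvg_cst.
Qed.

Lemma submx_closed m (P : 'M[R]_(m, n)) : closed [set v :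
  'rV[R]_n | (v <= P)%MS].
Proof.
move=> v /closure_filter[F [PF Fv FP]]; rewrite /= submxE; apply/eqP.
pose proof (mulmx_cvg (A := cokermx P) Fv) as h1.
have h2 : z *m cokermx P @[z --> F] --> (0 : 'rV[R]_n).
  apply: (@cvg_trans _ (cst (0 : 'rV[R]_n) @ F)); last exact: cvg_cst.
  by apply: near_eq_cvg; move: FP; apply: filterS => z;
    rewrite /= submxE => /eqP ->.
exact: (cvg_unique (@norm_hausdorff _ _) h1 h2).
Qed.

Lemma max_rank (a : 'M[R]_n -> Prop) : (exists P, a P) ->
  exists2 P, a P & forall Q, a Q -> (\rank Q <= \rank P)%N.
Proof.
move=> [P0 aP0].
pose p k := asbool (exists2 P, a P & \rank P = k).
have p0 : exists k, p k by exists (\rank P0); apply/asboolP; exists P0.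
have pn k : p k -> (k <= n)%N by move=> /asboolP[P _ <-]; exact: rank_leq_row.
have [k /asboolP[P aP Pk] kmax] := ex_maxnP p0 pn.
by exists P => // Q aQ; rewrite Pk; apply: kmax; apply/asboolP; exists Q.
Qed.

(** Among the matrices whose row space satisfies [a], one of maximal rank contains every vector of
    [a]: otherwise adding that vector would raise the rank. *)
Lemma subspace_matrix (a : 'rV[R]_n -> Prop) : a 0 ->
  (forall u v, a u -> a v -> a (u + v)) -> (forall c v, a v -> a (c *: v)) ->
  exists Q : 'M[R]_n, forall v, (v <= Q)%MS <-> a v.
Proof.
move=> a0 aD aZ.
have [|Q aQ Qmax] := @max_rank (fun Q => forall v : 'rV_n, (v <= Q)%MS -> a v).
  by exists 0 => v /submx0null ->.
exists Q => v; split; first exact: aQ.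
move=> av; have : (\rank (Q + v)%MS <= \rank Q)%N.
  apply: Qmax => w /sub_addsmxP[[x y] /= ->]; apply: aD.
    exact/aQ/submxMl.
  by rewrite [y]mx11_scalar mul_scalar_mx; exact: aZ.
have [_ e] := mxrank_leqif_sup (addsmxSl Q v); rewrite leq_eqVlt ltnNge.
rewrite mxrankS ?addsmxSl// orbF eq_sym e => /(submx_trans (addsmxSr Q v)).
by [].
Qed.

End subspaces.

(** * A closed subgroup near the identity, after Cartan *)

Section closed_subgroup_chart.
Context {R : realType} {G : topologicalGroupType} {n : nat}.
Variable L : local_chart R G n.
Hypothesis hG : hausdorff_space G.
Local Notation psi := (lc_psi L).
Local Notation r := (lc_r L).
Local Notation C := (lc_C L).
Local Notation E := (lc_exp L).
Implicit Types (x y : G) (u v w p : 'rV[R]_n).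

Variables (N : set G) (P : 'M[R]_n).
Hypothesis N_closed : closed_subgroup_set N.
Hypothesis P_tangent : forall u, (u <= P)%MS <-> forall t : R, N (E (t *: u)).
Hypothesis P_commute : forall u w, (u <= P)%MS -> (w <= P)%MS ->
  commute (E u) (E w).

Let r0 : 0 < r := lc_r_gt0 L.
Let C0 : 0 <= C := lc_C_ge0 L.

Lemma lc_expD_sub u w : (u <= P)%MS -> (w <= P)%MS -> E (u + w) = (E u * E w)%g.
Proof.
move=> uP wP; apply: (lc_expD_commute hG) => s t.
by apply: P_commute; exact: scalemx_sub.
Qed.

Lemma lc_exp_sub_closed u : (u <= P)%MS -> N (E u).
Proof. by move=> /P_tangent/(_ 1); rewrite scale1r. Qed.

(** Makes the distance from [x] to [E p] continuous in [p], so that a closest [p] exists on a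
    compact set. *)
Lemma psi_exp_mul_lipschitz x p p' : 16 * `|p| < r -> 16 * `|p'| < r ->
  `|psi x| < r ->
  `|psi (E p * x)%g - psi (E p' * x)%g| <= 8 * `|p - p'|.
Proof.
move=> pr pr' xr; have p0 := normr_ge0 p; have p0' := normr_ge0 p'.
have h1 : 8 * `|p| < r by lra.
have h2 : 8 * `|p'| < r by lra.
have e1 : `|psi (E p)| < r.
  by apply: le_lt_trans (psi_lc_exp_le hG h1) _; lra.
have e2 : `|psi (E p')| < r.
  by apply: le_lt_trans (psi_lc_exp_le hG h2) _; lra.
have := lc_mulL e1 e2 xr; have := psi_lc_exp_lipschitz hG h1 h2.
set D := psi (E p) - psi (E p'); set F := _ - psi (E p' * x)%g => hD hF.
have : `|F| <= `|D| + `|F - D| by rewrite -{1}(subrKC D F); exact: ler_normD.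
have : C * `|D| * `|psi x| <= 10^-1 * `|D|.
  by rewrite mulrAC ler_wpM2r// lc_C_small.
have := normr_ge0 (p - p'); lra.
Qed.

(* The elements of N near 1 are divided by the closest E p, p in P, and the
   directions of the quotients accumulate at a direction u tangent to N. So u
   lies in P, and moving p a little along u would have been better. *)
Lemma closed_subgroup_near1_small rho : 0 < rho -> 16 * rho < r ->
  exists2 eps, 0 < eps &
  forall x, N x -> `|psi x| < eps ->
  exists p, [/\ (p <= P)%MS, `|p| < rho & x = E p].
Proof.
move=> rho0 rhor.
have [//|noeps] := pselect (exists2 eps, 0 < eps & forall x, N x ->
  `|psi x| < eps -> exists p, [/\ (p <= P)%MS, `|p| < rho & x = E p]).
exfalso.
pose bad (k : nat) x := [/\ N x, `|psi x| < Num.min r (k.+1%:R^-1) &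
  forall p, (p <= P)%MS -> `|p| < rho -> x <> E p].
have [x xbad] : exists x : nat -> G, forall k, bad k (x k).
  suff H k : exists x, bad k x.
    by have [x xP] := choice H; exists x => k; exact: xP.
  apply: contrapT => nx; apply: noeps; exists (Num.min r (k.+1%:R^-1)).
    by rewrite lt_min r0 invr_gt0 ltr0n.
  move=> x Nx xk; apply: contrapT => np; apply: nx; exists x; split=> //.
  by move=> p pP pr xp; apply: np; exists p.
have xr k : `|psi (x k)| < r.
  by have [_ + _] := xbad k; rewrite lt_min => /andP[].
(* The competitor [q k + s k *: v] used at the end must remain in [K]: both terms will have norm
   below [rho / 4]. *)
pose K := [set p : 'rV[R]_n | (p <= P)%MS] `&` [set p | `|p| <= rho / 2].
have Kle p : K p -> 16 * `|p| < r by move=> [_ /= pr]; lra.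
have cK : compact K.
  rewrite /K setIC; apply: compact_closedI; first exact: rV_closed_ball_compact.
  exact: submx_closed.
have K0 : K 0 by split; rewrite /= ?sub0mx// normr0 divr_ge0// ltW.
pose dist k p := `|psi (E (- p) * x k)%g|.
have dist_lip k p p' : K p -> K p' -> `|dist k p - dist k p'| <= 8 * `|p - p'|.
  move=> Kp Kp'; apply: le_trans (ler_dist_dist _ _) _.
  apply: le_trans (psi_exp_mul_lipschitz _ _ (xr k)) _; rewrite ?normrN;
    try exact: Kle.
  by rewrite -opprD normrN.
have [q qK qmin] : exists2 q : nat -> 'rV[R]_n, (forall k, K (q k)) &
    forall k p, K p -> dist k (q k) <= dist k p.
  suff H k : exists p, K p /\ forall p', K p' -> dist k p <= dist k p'.
    by have [q qP] := choice H; exists q => k; have [] := qP k.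
  have [|p pK pmin] := @compact_EVT_min _ R (dist k) K (ex_intro _ 0 K0) cK.
    apply/subspace_continuousP => p Kp; apply/cvgrPdist_lt => e e0.
    have e8 : 0 < e / 8 by rewrite divr_gt0.
    rewrite near_withinE; apply: filterS (nbhsx_ballx p _ e8) => p' + Kp'.
    rewrite -ball_normE /= => pp';
      apply: le_lt_trans (dist_lip k p p' Kp Kp') _.
    lra.
  exists p; split; first exact: set_mem.
  by move=> p' /mem_set; exact: pmin.
pose y k := (E (- q k) * x k)%g; pose s k := `|psi (y k)|.
have sx k : s k <= `|psi (x k)|.
  by have := qmin k _ K0; rewrite /dist oppr0 lc_exp0// mul1g.
have sr k : s k < r by exact: le_lt_trans (sx k) (xr k).
have qP k : (q k <= P)%MS by have [] := qK k.
have xE k : x k = (E (q k) * y k)%g by rewrite /y lc_expN// mulVKg.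
have s0 k : 0 < s k.
  rewrite lt_def normr_ge0 andbT normr_eq0; apply/eqP => y0.
  have [_ _ /(_ (q k) (qP k))] := xbad k; apply.
    by have [_ /= qr] := qK k; lra.
  by rewrite xE -[y k](lc_psiK (sr k)) y0 lc_xi0 mulg1.
have x0 : psi (x k) @[k --> ultra_oo] --> (0 : 'rV[R]_n).
  apply: (@cvg_dist_le _ _ _ _ _ _ _ (fun k : nat => k.+1%:R^-1)).
    apply: nearW => k; rewrite subr0 ltW//.
    by have [_ + _] := xbad k; rewrite lt_min => /andP[].
  exact: ultra_oo_cvg (@cvg_invS R).
have y0 : psi (y k) @[k --> ultra_oo] --> (0 : 'rV[R]_n).
  apply: (@cvg_dist_le _ _ _ _ _ _ _ (fun k => `|psi (x k)|)).
    by apply: nearW => k; rewrite subr0; exact: sx.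
  by pose proof (cvg_norm x0) as h; rewrite normr0 in h.
(* [E (q k)] is [x k] divided by [y k], hence tends to 1, and [E] is bounded below near 0. *)
have q0 : q @ ultra_oo --> (0 : 'rV[R]_n).
  have Eq1 : E (q k) @[k --> ultra_oo] --> 1%g.
    pose proof (cvg_mulg (cvg1_psi x0) (cvg_invg (cvg1_psi y0))) as h.
    rewrite invg1 mulg1 in h.
    have -> : (fun k => E (q k)) = (fun k => (x k * (y k)^-1)%g).
      by apply/funext => k; rewrite xE mulgK.
    exact: h.
  pose proof (cvg_norm (psi_cvg1 L Eq1)) as h; rewrite normr0 in h.
  apply: (@cvg_dist_le _ _ _ _ _ _ _ (fun k => 2 * `|psi (E (q k))|)).
    apply: nearW => k; rewrite subr0; apply: (le_psi_lc_exp hG).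
    have := Kle _ (qK k); have := normr_ge0 (q k); lra.
  by rewrite -(mulr0 2); apply: cvgM => //; exact: cvg_cst.
pose u k := (s k)^-1 *: psi (y k).
have u1 k : `|u k| = 1.
  by rewrite normrZ gtr0_norm ?invr_gt0// mulVf// gt_eqF.
have [v v1 uv] : exists2 v, `|v| <= 1 & u @ ultra_oo --> v.
  by apply: ultra_oo_bounded; apply: nearW => k; rewrite u1.
have Ny k : N (y k).
  have [_ _ NM NV] := N_closed; apply: NM; last by have [] := xbad k.
  by apply: lc_exp_sub_closed; rewrite eqmx_opp.
have s_cvg0 : s @ ultra_oo --> (0 : R).
  by pose proof (cvg_norm y0) as h; rewrite normr0 in h.
have vP : (v <= P)%MS.
  apply/P_tangent => t.
  apply: (@lc_exp_closed_subgroup _ _ _ L hG _ _ ultra_oo _ (fun k =>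
    (s k)^-1) y v t N_closed).
  - by move=> k; rewrite invr_gt0.
  - by under eq_fun do rewrite invrK.
  - exact: uv.
  - by apply: nearW.
(* The thresholds give errors of [s k / 4] for the direction, [s k / 12] for [E] against its linear
   part and [s k / 6] for the product: [s k / 2] in all, which contradicts the minimality of
   [s k]. *)
have e4 : 0 < 4^-1 :> R by rewrite invr_gt0.
have hu : \forall k \near ultra_oo, `|v - u k| < 4^-1.
  by have /cvgrPdist_lt/(_ _ e4) := uv.
have rho4 : 0 < rho / 4 by rewrite divr_gt0.
have hq : \forall k \near ultra_oo, `|q k| < rho / 4.
  by have /cvgr0Pnorm_lt/(_ _ rho4) := q0.
have hs : \forall k \near ultra_oo, `|s k| < rho / 4.
  by have /cvgr0Pnorm_lt/(_ _ rho4) := s_cvg0.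
have hC : \forall k \near ultra_oo, C * s k < 12^-1.
  apply: (@near_lt_of_cvg _ _ ultra_oo _ _ (C * 0)).
    by apply: cvgM => //; exact: cvg_cst.
  by rewrite mulr0 invr_gt0.
have [k [hk1 [hk2 [hk3 hk4]]]] :=
  filter_ex (filterI hu (filterI hq (filterI hs hC))).
have sk0 := s0 k; rewrite gtr0_norm// in hk3.
have sv : `|s k *: v| <= s k by rewrite normrZ gtr0_norm// ler_piMr// ltW.
have Kq : K (q k + s k *: v).
  split; first by rewrite /= addmx_sub// scalemx_sub.
  rewrite /=; apply: le_trans (ler_normD _ _) _; lra.
have qk : s k <= `|psi (E (- (q k + s k *: v)) * x k)%g| := qmin k _ Kq.
move: qk; rewrite leNgt => /negP; apply.
have -> : (E (- (q k + s k *: v)) * x k = E (- (s k *: v)) * y k)%g.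
  rewrite opprD addrC lc_expD_sub ?eqmx_opp ?scalemx_sub// /y mulgA.
  by rewrite [(E _ * E _)%g]P_commute ?eqmx_opp ?scalemx_sub.
set g := E (- (s k *: v)).
have nv : `|- (s k *: v)| <= s k by rewrite normrN.
have v8 : 8 * `|- (s k *: v)| < r by lra.
have g1 := psi_lc_exp_sub_le hG v8; rewrite -/g opprK in g1.
have g2 := psi_lc_exp_le hG v8; rewrite -/g in g2.
have gr : `|psi g| < r by lra.
have h1 := lc_mul_le gr (sr k).
have yv : `|psi (y k) - s k *: v| <= s k / 4.
  have -> : psi (y k) - s k *: v = - (s k *: (v - u k)).
    by rewrite /u scalerBr scalerA divff ?gt_eqF// scale1r opprB.
  by rewrite normrN normrZ gtr0_norm// ler_pM2l// ltW.
have g1' : `|psi g + s k *: v| <= s k / 12.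
  apply: le_trans g1 _; apply: (@le_trans _ _ (C * s k ^+ 2)).
    by rewrite ler_wpM2l// lerXn2r// ?nnegrE// ltW.
  by rewrite expr2 mulrA mulrC ler_pM2l// ltW.
have h2 : C * `|psi g| * `|psi (y k)| <= s k / 6.
  rewrite -/(s k); apply: (@le_trans _ _ (C * (2 * s k) * s k)).
    rewrite ler_wpM2r ?(ltW sk0)// ler_wpM2l//; lra.
  have : C * s k * s k <= 12^-1 * s k by rewrite ler_wpM2r// ltW.
  lra.
have -> : psi (g * y k)%g = (psi (g * y k)%g - psi g - psi (y k)) +
    ((psi g + s k *: v) + (psi (y k) - s k *: v)).
  by rewrite [(psi g + _) + _]addrACA subrr addr0 -[_ - _ - psi (y k)]addrA
    -opprD subrK.
apply: le_lt_trans (ler_normD _ _) _.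
have := ler_normD (psi g + s k *: v) (psi (y k) - s k *: v); lra.
Qed.

Lemma closed_subgroup_near1 rho : 0 < rho -> exists2 eps, 0 < eps &
  forall x, N x -> `|psi x| < eps ->
  exists p, [/\ (p <= P)%MS, `|p| < rho & x = E p].
Proof.
move=> rho0; have m0 : 0 < Num.min rho (r / 32).
  by rewrite lt_min rho0 divr_gt0.
have mr : 16 * Num.min rho (r / 32) < r.
  apply: le_lt_trans (_ : 16 * (r / 32) < r); last by have := r0; lra.
  by rewrite ler_pM2l// ge_min lexx orbT.
have [eps e0 H] := closed_subgroup_near1_small m0 mr.
exists eps => // x Nx xe; have [p [pP pr xp]] := H x Nx xe.
by exists p; split=> //; apply: lt_le_trans pr _; rewrite ge_min lexx.
Qed.

End closed_subgroup_chart.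

(** * Limits in the space of closed abelian subgroups *)

Section chabauty_limits.
Context {G : topologicalGroupType}.
Hypothesis hG : hausdorff_space G.
Implicit Types (A : closed_subgroup G) (u : nat -> SubA G).

Definition members (B : SubA G) : set G := csub_set (val B).

(** Along an ultrafilter the lower and upper limits of a sequence of sets coincide; this common
    value is the limit in the Chabauty topology. *)
Definition limit_set u : set G := [set x | forall V, nbhs x V ->
  \forall k \near ultra_oo, exists2 y, V y & members (u k) y].

Lemma members_group (B : SubA G) : closed_subgroup_set (members B).
Proof. exact: csub_closed_subgroup. Qed.

Lemma limit_set_closed_subgroup u : closed_subgroup_set (limit_set u).
Proof.
split.
- move=> x xl V; rewrite nbhsE => -[ W0 [openO Ox] OV].
  have [y [yl Oy]] := xl W0 (open_nbhs_nbhs (conj openO Ox)).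
  have := yl W0 (open_nbhs_nbhs (conj openO Oy)); apply: filterS => k [z Oz uz].
  by exists z => //; exact: OV.
- move=> V V1; apply: nearW => k; exists 1%g; first exact: nbhs_singleton.
  by have [] := members_group (u k).
- move=> x y xl yl V Vxy.
  have [[P Q] /= [Px Qy] PQ] := @mulg_continuous G (x, y) V Vxy.
  have := xl P Px; have := yl Q Qy; apply: filterS2 => k [b Qb ub] [a Pa ua].
  exists (a * b)%g; first exact: (PQ (a, b)).
  by have [_ _ uM _] := members_group (u k); exact: uM.
- move=> x xl V /(@invg_continuous G x)/xl; apply: filterS => k [a Va ua].
  exists a^-1%g => //.
  by have [_ _ _ uV] := members_group (u k); exact: uV.
Qed.

Lemma limit_set_commute u x y : limit_set u x -> limit_set u y -> commute x y.
Proof.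
move=> xl yl; apply: contrapT => nxy.
have := hG; rewrite open_hausdorff => /(_ (x * y)%g (y * x)%g)[];
  first exact/eqP.
move=> [V W] /= [/set_mem Vxy /set_mem Wyx] [oV oW /eqP VW].
have [[P Q] /= [Px Qy] PQ] :=
  @mulg_continuous G (x, y) V (open_nbhs_nbhs (conj oV Vxy)).
have [[P' Q'] /= [Qy' Px'] PQ'] :=
  @mulg_continuous G (y, x) W (open_nbhs_nbhs (conj oW Wyx)).
have := filter_ex (filterI (xl _ (filterI Px Px')) (yl _ (filterI Qy Qy'))).
move=> [k [[a [Pa Pa'] ua] [b [Qb Qb'] ub]]].
have ab : commute a b by have /set_mem := valP (u k); exact.
have h1 : V (a * b)%g by exact: (PQ (a, b)).
have h2 : W (a * b)%g by rewrite ab; exact: (PQ' (b, a)).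
by have : (V `&` W) (a * b)%g by []; rewrite VW.
Qed.

Definition limit_subA u : SubA G :=
  SigSub (mem_set (limit_set_commute (u := u)) :
    ClosedSubgroup (limit_set_closed_subgroup u) \in @abelian_csubs G).

Lemma limit_subA_cvg u : u @ ultra_oo --> limit_subA u.
Proof.
move=> W /= [_ [[ W0 openO <-] Ol sW]].
have [s [sl sO]] := chabauty_openP openO Ol.
have : \forall k \near ultra_oo, forall S, S \in s -> S (val (u k)).
  have h : ultra_oo (\bigcap_(S in [set` s]) [set k | S (val (u k))]).
    apply: filter_bigI => S Ss; have [bS Sl] := sl S Ss.
    case: bS Sl => [[K cK ->]|[U oU ->]] /=.
      (* If [u k] met [K] for most [k], points chosen in the intersections would converge by
         compactness to a point of [K] in the limit set. *)
      move=> lK; have [//|nK] := in_ultra_setVsetC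
        [set k | csub_set (val (u k)) `&` K = set0] ultra_oo_ultra.
      exfalso; have ch k : exists x, ~ (csub_set (val (u k)) `&` K = set0) ->
          csub_set (val (u k)) x /\ K x.
        have [e|/eqP/set0P[x [ux Kx]]] :=
          pselect (csub_set (val (u k)) `&` K = set0); first by exists 1%g.
        by exists x.
      have [x xP] := choice ch.
      have [|l Kl xl] := @ultra_oo_compact G K x cK.
        by move: nK; apply: filterS => k /xP[].
      suff : (limit_set u `&` K) l by rewrite lK.
      split=> // V /xl; apply: filterS2 nK => k /xP[ux Kx] Vx.
      by exists (x k).
    move=> [x [xl Ux]].
    have := xl U (open_nbhs_nbhs (conj oU Ux)).
    by apply: filterS => k [y Uy uy]; exists y.
  by move: h; apply: filterS => k h S Ss; exact: h.
by apply: filterS => k h; apply: sW; exact: sO.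
Qed.

End chabauty_limits.

Section iterates.
Context {G : topologicalGroupType}.

Lemma members_subA_action (T : top_aut G) (k : int) (B : SubA G) :
  members (homeo_iter (subA_action T) k B) = homeo_iter T k @` members B.
Proof.
case: k => k /=.
  elim: k => [|k IH] /=; first by rewrite image_id.
  by rewrite -[RHS](image_comp _ T) -IH.
elim: k => [|k IH] /=; first by [].
by rewrite -[RHS](image_comp _ (homeo_inv T)) -IH.
Qed.

Lemma homeo_iter_fixed (X : topologicalType) (f : homeo X) k x :
  f x = x -> homeo_iter f k x = x.
Proof.
move=> fx; have gx : homeo_inv f x = x by rewrite -[X in homeo_inv f X]fx
  homeo_funK.
by case: k => k /=; [|rewrite -[in LHS]gx gx]; elim: k => //= k ->.
Qed.

End iterates.

Section expansive_criteria.
Context {R : realType} {G : topologicalGroupType}.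
Hypothesis hG : hausdorff_space G.
Variable T : top_aut G.

Lemma subA_eq (B D : SubA G) : members B = members D -> B = D.
Proof. by move=> e; apply: val_inj; exact: csub_inj. Qed.

Lemma metric_cvg (X : topologicalType) (d : X -> X -> R) (u : nat -> X) l e :
  metric_for d -> u @ ultra_oo --> l -> 0 < e ->
  \forall k \near ultra_oo, d l (u k) < e.
Proof.
move=> [_ _ _ _ dn] ul e0; apply: (ul [set y | d l y < e]).
by apply/dn; exists e.
Qed.

(** The arbitrary times [e] encode uniformity: expansiveness provides for each pair a separating
    time, and at these times both sequences converge to the same subgroup. *)
Lemma not_expansive_of_pairs (B D : nat -> SubA G) : (forall k, B k <> D k) ->
  (forall e : nat -> int,
    limit_set (fun k => homeo_iter (subA_action T) (e k) (B k)) =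
    limit_set (fun k => homeo_iter (subA_action T) (e k) (D k))) ->
  ~ expansive R (subA_action T).
Proof.
move=> BD lBD [d dP [delta delta0 dexp]].
have [e eP] := choice (fun k => dexp _ _ (BD k)).
pose b' k := homeo_iter (subA_action T) (e k) (B k).
pose d' k := homeo_iter (subA_action T) (e k) (D k).
have l_eq : limit_subA hG b' = limit_subA hG d' by apply: subA_eq; exact: lBD.
have d2 : 0 < delta / 2 by rewrite divr_gt0.
pose proof (metric_cvg dP (@limit_subA_cvg G hG b') d2) as h1.
pose proof (metric_cvg dP (@limit_subA_cvg G hG d') d2) as h2.
have [k [h1k h2k]] := filter_ex (filterI h1 h2).
have [_ _ ds dt _] := dP; rewrite -l_eq in h2k.
have := eP k; rewrite -/(b' k) -/(d' k) ltNge => /negP; apply.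
apply: le_trans (dt _ (limit_subA hG b') _) _.
rewrite ds (splitr delta) ltW//; exact: ltrD.
Qed.

(** Infinitely many points of a compact space come within [delta] of one another, and fixed points
    never move apart. *)
Lemma not_expansive_of_fixed (B : nat -> SubA G) :
  (forall j k, (j < k)%N -> B j <> B k) ->
  (forall k, subA_action T (B k) = B k) ->
  ~ expansive R (subA_action T).
Proof.
move=> Binj Bfix [d dP [delta delta0 dexp]].
have d2 : 0 < delta / 2 by rewrite divr_gt0.
pose proof (metric_cvg dP (@limit_subA_cvg G hG B) d2) as h1.
have [j h1j] := filter_ex h1.
have hj : \forall k \near ultra_oo, (j < k)%N.
  by apply: ultra_oo_near; exists j.+1.
have [k [jk h1k]] := filter_ex (filterI hj h1).
have [e] := dexp _ _ (Binj j k jk).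
rewrite !homeo_iter_fixed// ltNge => /negP; apply.
have [_ _ ds dt _] := dP.
apply: le_trans (dt _ (limit_subA hG B) _) _.
rewrite ds (splitr delta) ltW//; exact: ltrD.
Qed.

End expansive_criteria.

(** * An invariant closed connected abelian subgroup *)

Section invariant_abelian_group.
Context {R : realType} {G : topologicalGroupType} {n : nat}.
Variable L : local_chart R G n.+1.
Hypothesis hG : hausdorff_space G.
Variable T : top_aut G.
Local Notation psi := (lc_psi L).
Local Notation E := (lc_exp L).
Implicit Types (x y : G) (u v w p : 'rV[R]_n.+1).

Definition tangent_group (P : 'M[R]_n.+1) : set G :=
  [set x | exists2 p : 'rV_n.+1, (p <= P)%MS & x = E p].

(** [tangent_near1] says that the elements of [E P] close to 1 in [G] come from small vectors of
    [P]. A dense line in a torus fails both this and [tangent_closed]. *)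
Record tangent_spec (M P : 'M[R]_n.+1) : Prop := TangentSpec {
  tangent_neq0 : P != 0 ;
  tangent_stable : (P *m M <= P)%MS ;
  tangent_commute : forall u w, (u <= P)%MS -> (w <= P)%MS ->
    commute (E u) (E w) ;
  tangent_closed : closed_subgroup_set (tangent_group P) ;
  tangent_near1 : forall rho, 0 < rho -> exists2 eps, 0 < eps &
    forall x, tangent_group P x -> `|psi x| < eps ->
    exists p, [/\ (p <= P)%MS, `|p| < rho & x = E p]
}.

Lemma exp_sub_expD (P : 'M[R]_n.+1) u w :
  (forall u w, (u <= P)%MS -> (w <= P)%MS -> commute (E u) (E w)) ->
  (u <= P)%MS -> (w <= P)%MS -> E (u + w) = (E u * E w)%g.
Proof.
move=> cP uP wP; apply: (lc_expD_commute hG) => s t.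
by apply: cP; exact: scalemx_sub.
Qed.

Lemma tangent_group_subgroup (P : 'M[R]_n.+1) :
  (forall u w, (u <= P)%MS -> (w <= P)%MS -> commute (E u) (E w)) ->
  [/\ tangent_group P 1%g,
    forall x y, tangent_group P x -> tangent_group P y ->
      tangent_group P (x * y)%g &
    forall x, tangent_group P x -> tangent_group P (x^-1)%g].
Proof.
move=> cP; split.
- by exists 0; rewrite ?sub0mx// lc_exp0.
- move=> _ _ [p pP ->] [q qP ->]; exists (p + q); first exact: addmx_sub.
  by rewrite (exp_sub_expD cP).
- by move=> _ [p pP ->]; exists (- p); rewrite ?eqmx_opp// lc_expN.
Qed.

Lemma exists_tangent (M : 'M[R]_n.+1) :
  (forall v t, T (E (t *: v)) = E (t *: (v *m M))) ->
    exists P, tangent_spec M P.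
Proof.
move=> TE.
have bM := lc_bracket_endomorphism hG (@homeo_cont _ T) (@aut_morph _ T) TE.
have [P0 [P00 P0M P0b]] := invariant_abelian_subspace bM.
pose good (P : 'M[R]_n.+1) := (P *m M <= P)%MS /\
  forall u w, (u <= P)%MS -> (w <= P)%MS -> commute (E u) (E w).
have good0 : good P0.
  by split=> // u w uP wP; apply: (lc_bracket0_commute hG); exact: P0b.
have [P [PM cP] Pmax] := max_rank (ex_intro _ _ good0).
have [S1 SM SV] := tangent_group_subgroup cP.
pose N := closure (tangent_group P).
have N_closed : closed_subgroup_set N by exact: closure_closed_subgroup.
have cN x y : N x -> N y -> commute x y.
  apply: closure_commute => //= _ _ [p pP ->] [q qP ->]; exact: cP.
have TN x : N x -> N (T x).
  move=> /closure_filter[F [PF Fx FS]].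
  have h : T @ F --> T x by exact: cvg_comp Fx (@homeo_cont _ T x).
  apply: (closed_cvg _ (@closed_closure _ (tangent_group P)) _ _ h).
  move: FS; apply: filterS => _ [p pP ->]; apply: subset_closure.
  exists (p *m M); last by have := TE p 1; rewrite !scale1r.
  by apply: submx_trans PM; exact: submxMr.
have [N1 NM] : N 1%g /\ forall x y, N x -> N y ->
  N (x * y)%g by have [_ ? ? _] := N_closed.
(* The vectors tangent to the closure [N] form a subspace because [N] is commutative. It is again a
   candidate and contains [P], so maximality of the rank gives [Q = P]. *)
have [Q Qtan] : exists Q :
  'M[R]_n.+1, forall v, (v <= Q)%MS <-> forall t, N (E (t *: v)).
  apply: subspace_matrix.
  - by move=> t; rewrite scaler0 lc_exp0.
  - move=> u v uN vN t; rewrite scalerDr (lc_expD_commute hG).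
      exact: NM.
    by move=> s s'; rewrite !scalerA; exact: cN.
  - by move=> c v vN t; rewrite scalerA.
have goodQ : good Q.
  split.
    apply/row_subP => i; rewrite row_mul; apply/Qtan => t.
    by rewrite -TE; apply: TN; move: t; apply/Qtan; exact: row_sub.
  move=> u w /Qtan/(_ 1) + /Qtan/(_ 1); rewrite !scale1r; exact: cN.
have PQ : (P <= Q)%MS.
  apply/row_subP => i; apply/Qtan => t; apply: subset_closure.
  by exists (t *: row i P) => //; apply: scalemx_sub; exact: row_sub.
have QP : (Q <= P)%MS.
  have [rPQ e] := mxrank_leqif_sup PQ.
  by rewrite -e eqn_leq rPQ Pmax.
have Ptan v : (v <= P)%MS <-> forall t, N (E (t *: v)).
  rewrite -Qtan; split=> h; [exact: submx_trans PQ|exact: submx_trans QP].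
have near1 := closed_subgroup_near1 hG N_closed Ptan cP.
(* A point of [N] divided by a nearby point of [E P] is an element of [N] close to 1, hence in
   [E P]. *)
have NS : N = tangent_group P.
  apply/seteqP; split; last exact: subset_closure.
  move=> x Nx; have [eps e0 H] := near1 1 ltr01.
  have h : (x * z^-1)%g @[z --> x] --> 1%g.
    rewrite -(mulgV x); apply: cvg_mulg; first exact: cvg_cst.
    by apply: cvg_invg; exact: cvg_id.
  pose proof (psi_cvg1 L h) as h'; move/cvgr0Pnorm_lt: h' => /(_ eps e0) V.
  have [y [[q qP ->] /= qe]] := Nx _ V.
  have [|p [pP _ xp]] := H (x * (E q)^-1)%g _ qe.
    have [_ _ _ NV] := N_closed; apply: NM => //; apply: NV.
    by apply: subset_closure; exists q.
  by rewrite -(mulgVK (E q) x) xp; apply: SM; [exists p|exists q].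
exists P; split=> //; last 2 first.
- by rewrite -NS.
- by move=> rho rho0; have [eps e0 H] := near1 rho rho0; exists eps;
    rewrite -?NS.
- apply: contra P00 => /eqP P0'; rewrite -mxrank_eq0.
  by have := Pmax _ good0; rewrite P0' mxrank0 leqn0.
Qed.

End invariant_abelian_group.

(** * The action of [T] on the invariant group, and the case of a kernel *)

Section tangent_dynamics.
Context {R : realType} {G : topologicalGroupType} {n : nat}.
Variable L : local_chart R G n.+1.
Hypothesis hG : hausdorff_space G.
Variable T : top_aut G.
Local Notation r := (lc_r L).
Local Notation E := (lc_exp L).
Implicit Types (x y : G) (u v w p : 'rV[R]_n.+1).

Variables M P : 'M[R]_n.+1.
Hypothesis TE : forall v t, T (E (t *: v)) = E (t *: (v *m M)).
Hypothesis HP : tangent_spec L M P.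

Let cP := tangent_commute HP.
Let N := tangent_group L P.

Let T1 : T 1%g = 1%g.
Proof. by apply: (@mulgI _ (T 1%g)); rewrite -aut_morph !mulg1. Qed.

Lemma differential_unitmx : M \in unitmx.
Proof.
rewrite -row_free_unit -kermx_eq0; apply/eqP/row_matrixP => i; rewrite row0.
apply: (@lc_exp_eq0 _ _ _ L hG) => t; apply: (can_inj (homeo_funK T)).
rewrite TE T1 -row_mul mulmx_ker row0 scaler0; exact: lc_exp0.
Qed.

Lemma exp_sub_image v : (v <= P)%MS -> exists2 w : 'rV_n.+1, (w <= P)%MS &
  forall t, T (E (t *: v)) = E (t *: w).
Proof.
move=> vP; exists (v *m M) => //.
by apply: submx_trans (tangent_stable HP); exact: submxMr.
Qed.

(** [M] is invertible, so [P *m M] has the rank of [P] and the inclusion into [P] is an equality: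
    negative iterates also preserve [P]. *)
Lemma exp_sub_preimage v : (v <= P)%MS -> exists2 w : 'rV_n.+1, (w <= P)%MS &
  forall t, homeo_inv T (E (t *: v)) = E (t *: w).
Proof.
move=> vP; have PM : (P <= P *m M)%MS.
  have [_ e] := mxrank_leqif_sup (tangent_stable HP).
  by rewrite -e mxrankMfree// row_free_unit differential_unitmx.
have /submxP[D vE] := submx_trans vP PM.
exists (D *m P); first exact: submxMl.
by move=> t; rewrite vE mulmxA -TE homeo_funK.
Qed.

Lemma exp_sub_iter (k : int) v : (v <= P)%MS ->
  exists2 w : 'rV_n.+1, (w <= P)%MS &
  forall t, homeo_iter T k (E (t *: v)) = E (t *: w).
Proof.
case: k => k /=; elim: k => [|k IH] vP /=.
- by exists v.
- have [w wP Hw] := IH vP; have [w' wP' Hw'] := exp_sub_image wP.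
  by exists w' => // t; rewrite Hw Hw'.
- exact: exp_sub_preimage.
- have [w wP Hw] := IH vP; have [w' wP' Hw'] := exp_sub_preimage wP.
  by exists w' => // t; rewrite -Hw' -Hw.
Qed.

Lemma tangent_group_abelian x y : N x -> N y -> commute x y.
Proof. by move=> [p pP ->] [q qP ->]; exact: cP. Qed.

Section kernel.
Variable lam : 'rV[R]_n.+1.
Hypothesis lamP : (lam <= P)%MS.
Hypothesis lam_neq0 : lam != 0.
Hypothesis lam_ker : E lam = 1%g.

Definition torsion_set k : set G := [set x | N x /\ (x ^+ (2 ^ k) = 1)%g].

Lemma torsion_set_closed_subgroup k : closed_subgroup_set (torsion_set k).
Proof.
have [Ncl N1 NM NV] := tangent_closed HP; split.
- move=> x /closure_filter[F [PF Fx FS]]; split.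
    by apply: (closed_cvg _ Ncl _ _ Fx); move: FS; apply: filterS => z [].
  pose proof (cvg_expg (k := 2 ^ k) Fx) as h1.
  have h2 : (z ^+ (2 ^ k))%g @[z --> F] --> 1%g.
    apply: (@cvg_trans _ (cst (1%g : G) @ F)); last exact: cvg_cst.
    by apply: near_eq_cvg; move: FS; apply: filterS => z [_ ->].
  exact: (cvg_unique hG h1 h2).
- by split=> //; rewrite expg1n.
- move=> x y [Nx x1] [Ny y1]; split; first exact: NM.
  by rewrite expgMn ?x1 ?y1 ?mulg1//; exact: tangent_group_abelian.
- by move=> x [Nx x1]; split; [exact: NV|rewrite expVgn x1 invg1].
Qed.

Lemma torsion_set_commute k x y : torsion_set k x -> torsion_set k y ->
  commute x y.
Proof. by move=> [Nx _] [Ny _]; exact: tangent_group_abelian. Qed.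

Definition torsion_subA k : SubA G :=
  SigSub (mem_set (@torsion_set_commute k) :
    ClosedSubgroup (torsion_set_closed_subgroup k) \in @abelian_csubs G).

Lemma torsion_subA_fixed k : subA_action T (torsion_subA k) = torsion_subA k.
Proof.
have TX x m : T (x ^+ m)%g = (T x ^+ m)%g.
  by elim: m => [|m IH]; rewrite ?expg0 ?T1// !expgS aut_morph IH.
apply: subA_eq; apply/seteqP; split=> x /=.
  move=> [y [[p pP yp] y1] <-]; split; last by rewrite -TX y1 T1.
  have [w wP Hw] := exp_sub_image pP; exists w => //.
  by have := Hw 1; rewrite !scale1r yp.
move=> [[p pP xp] x1]; exists (homeo_inv T x); last exact: homeo_invK.
split.
  have [w wP Hw] := exp_sub_preimage pP; exists w => //.
  by have := Hw 1; rewrite !scale1r xp.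
by apply: (can_inj (homeo_funK T)); rewrite TX homeo_invK x1 T1.
Qed.

(** If the torsion stopped growing at [j], then [E (lam / 2 ^ (j + i))], killed by [2 ^ (j + i)],
    would be killed by [2 ^ j]. So [E (lam / 2 ^ i)] would be 1 for every [i], although [E] has no
    small nonzero kernel vector. *)
Lemma torsion_subA_neq j k : (j < k)%N -> torsion_subA j <> torsion_subA k.
Proof.
move=> jk jkE; have {jkE} jkE : torsion_set k `<=` torsion_set j.
  by rewrite -[torsion_set k]/(members (torsion_subA k)) -jkE.
have tors i x : N x -> (x ^+ (2 ^ (j + i)) = 1)%g -> (x ^+ (2 ^ j) = 1)%g.
  elim: i x => [|i IH] x Nx; first by rewrite addn0.
  rewrite addnS expnS mulnC => x1; apply: IH => //.
  have [_ N1 NM _] := tangent_closed HP.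
  have NX m : N (x ^+ m)%g.
    by elim: m => [|m IHm]; rewrite ?expg0// expgS; exact: NM.
  (* [x ^+ (2 ^ i)] is killed by [2 ^ j.+1], which divides [2 ^ k]; the assumed inclusion lowers the
     exponent by one. *)
  have : torsion_set k (x ^+ (2 ^ i))%g.
    have e : (2 ^ i * 2 ^ k = (2 ^ (j + i) * 2) * 2 ^ (k - j.+1))%N.
      by rewrite -expnSr -!expnD; congr (2 ^ _)%N; lia.
    by split=> //; rewrite -expgnA e expgnA x1 expg1n.
  by move=> /jkE[_]; rewrite -expgnA -expnD addnC.
have half i : E ((2 ^ i)%N%:R^-1 *: lam) = 1%g.
  pose x := E ((2 ^ (j + i))%N%:R^-1 *: lam).
  have xX m : (x ^+ m)%g = E ((m%:R / (2 ^ (j + i))%N%:R) *: lam).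
    by rewrite /x -(lc_exp_natmul L hG) scalerA.
  have p2 m : (2 ^ m)%N%:R != 0 :> R by rewrite pnatr_eq0 expn_eq0.
  have := tors i x; rewrite !xX divff// scale1r.
  have -> : (2 ^ j)%N%:R / (2 ^ (j + i))%N%:R = (2 ^ i)%N%:R^-1 :> R.
    by rewrite expnD natrM invfM mulrA divff ?mul1r.
  apply=> //; exists ((2 ^ (j + i))%N%:R^-1 *: lam) => //.
  exact: scalemx_sub.
pose i := (Num.truncn (8 * `|lam| / r)).+1.
have i8 : 8 * `|lam| < r * (2 ^ i)%N%:R.
  have : 8 * `|lam| / r < i%:R by exact: truncnS_gt.
  rewrite ltr_pdivrMr ?lc_r_gt0// => /lt_le_trans; apply.
  by rewrite mulrC ler_pM2l ?lc_r_gt0// ler_nat ltnW// ltn_expl.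
have i0 : 0 < (2 ^ i)%N%:R :> R by rewrite ltr0n expn_gt0.
have v8 : 8 * `|(2 ^ i)%N%:R^-1 *: lam| < r.
  by rewrite normrZ ger0_norm ?invr_ge0// mulrCA mulrC ltr_pdivrMr.
have := le_psi_lc_exp hG v8; rewrite half lc_psi1 normr0 mulr0 normr_le0.
by rewrite scaler_eq0 invr_eq0 (gt_eqF i0) (negbTE lam_neq0).
Qed.

Lemma not_expansive_kernel : ~ expansive R (subA_action T).
Proof.
exact: (not_expansive_of_fixed hG (B := torsion_subA) torsion_subA_neq
  torsion_subA_fixed).
Qed.

End kernel.

End tangent_dynamics.

(** * The case where [E] is injective on [P] *)

Section tangent_injective.
Context {R : realType} {G : topologicalGroupType} {n : nat}.
Variable L : local_chart R G n.+1.
Hypothesis hG : hausdorff_space G.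
Variable T : top_aut G.
Local Notation psi := (lc_psi L).
Local Notation E := (lc_exp L).
Implicit Types (x y : G) (u v w p : 'rV[R]_n.+1).

Variables M P : 'M[R]_n.+1.
Hypothesis TE : forall v t, T (E (t *: v)) = E (t *: (v *m M)).
Hypothesis HP : tangent_spec L M P.
Hypothesis E_ker : forall p, (p <= P)%MS -> E p = 1%g -> p = 0.

Let cP := tangent_commute HP.

Lemma exp_sub_inj p q : (p <= P)%MS -> (q <= P)%MS -> E p = E q -> p = q.
Proof.
move=> pP qP pq; apply/eqP; rewrite -subr_eq0; apply/eqP.
apply: E_ker; first by rewrite addmx_sub ?eqmx_opp.
by rewrite (exp_sub_expD hG cP) ?eqmx_opp// (lc_expN L hG) pq mulgV.
Qed.

Lemma nbhs_div_small x eps : 0 < eps ->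
  exists2 A, nbhs x A & forall a b, A a -> A b -> `|psi (a^-1 * b)%g| < eps.
Proof.
move=> e0.
have f1 : z.1 @[z --> ((x, x) : G * G)] --> x.
  exact: (@cvg_fst G G (nbhs x) (nbhs x) _).
have f2 : z.2 @[z --> ((x, x) : G * G)] --> x.
  exact: (@cvg_snd G G (nbhs x) (nbhs x) _).
pose proof (cvg_mulg (cvg_invg f1) f2) as h; rewrite mulVg in h.
pose proof (psi_cvg1 L h) as h'; move/cvgr0Pnorm_lt: h' => /(_ eps e0).
move=> [[A B] /= [Ax Bx] AB]; exists (A `&` B); first exact: filterI.
by move=> a b [Aa _] [_ Bb]; exact: (AB (a, b)).
Qed.

(** If [E p] and [E q] are both near [x], then [E (q - p)] is near 1, hence equal to [E s] with [s]
    small, and injectivity gives [q - p = s]. The point [x] is any point of [G]. *)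
Lemma exp_sub_close x rho : 0 < rho -> exists2 A, nbhs x A &
  forall p q, (p <= P)%MS -> (q <= P)%MS -> A (E p) -> A (E q) ->
    `|q - p| < rho.
Proof.
move=> rho0; have [eps e0 H] := tangent_near1 HP rho0.
have [A Ax AH] := nbhs_div_small x e0; exists A => // p q pP qP Ap Aq.
have E1 : ((E p)^-1 * E q)%g = E (q - p).
  by rewrite addrC (exp_sub_expD hG cP) ?eqmx_opp// (lc_expN L hG).
have qpP : (q - p <= P)%MS by rewrite addmx_sub ?eqmx_opp.
have Nqp : tangent_group L P ((E p)^-1 * E q)%g by exists (q - p).
have [s [sP sr Es]] := H _ Nqp (AH _ _ Ap Aq).
by rewrite (exp_sub_inj qpP sP (etrans (esym E1) Es)).
Qed.

Definition exp_Z w : set G := [set x | exists m : int, x = E (m%:~R *: w)].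

Lemma exp_Z_commute w x y : exp_Z w x -> exp_Z w y -> commute x y.
Proof. by move=> [k ->] [m ->]; exact: lc_exp_commute. Qed.

(** Distinct multiples of [w] are at distance at least [|w|], so [exp_sub_close] leaves at most one
    multiple near a point of the closure, and that point must be its image. *)
Lemma exp_Z_closed_subgroup w : (w <= P)%MS -> w != 0 ->
  closed_subgroup_set (exp_Z w).
Proof.
move=> wP w0; split.
- have nw0 : 0 < `|w| by rewrite normr_gt0.
  move=> x xcl; have [A Ax AH] := exp_sub_close x nw0.
  have [_ [[m ->] Am]] := xcl _ Ax.
  suff -> : x = E (m%:~R *: w) by exists m.
  apply: contrapT => xm.
  have := hG; rewrite open_hausdorff => /(_ _ _ (introN eqP xm)).
  move=> [[U V] /= [/set_mem Ux /set_mem Vm] [oU oV /eqP UV]].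
  have [_ [[m' ->] [Am' Um']]] :=
    xcl _ (filterI Ax (open_nbhs_nbhs (conj oU Ux))).
  suff mm' : m' = m.
    rewrite mm' in Um'.
    by have : (U `&` V) (E (m%:~R *: w)) by []; rewrite UV.
  have := AH _ _ (scalemx_sub _ wP) (scalemx_sub _ wP) Am Am'.
  rewrite -scalerBl normrZ -[X in _ < X]mul1r ltr_pM2r// -intrB -intr_norm.
  by rewrite ltrz1; lia.
- by exists 0; rewrite scale0r lc_exp0.
- move=> _ _ [k ->] [m ->]; exists (k + m).
  by rewrite intrD (lc_expD L hG).
- by move=> _ [k ->]; exists (- k); rewrite intrN scaleNr (lc_expN L hG).
Qed.

Definition exp_Z_subA w (wP : (w <= P)%MS) (w0 : w != 0) : SubA G :=
  SigSub (mem_set (@exp_Z_commute w) :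
    ClosedSubgroup (exp_Z_closed_subgroup wP w0) \in @abelian_csubs G).

Lemma exp_Z_image (f : G ->
  G) c v w : (forall t, f (E (t *: v)) = E (t *: w)) ->
  f @` exp_Z (c *: v) = exp_Z (c *: w).
Proof.
move=> fE; apply/seteqP; split=> x.
  by move=> [_ [m ->] <-]; exists m; rewrite !scalerA fE.
move=> [m ->]; exists (E (m%:~R *: (c *: v))); first by exists m.
by rewrite !scalerA fE.
Qed.

(** No control on the vectors [a k] is available, as they come from arbitrary iterates. But the
    multiples of them that [E] sends near [x] all lie within 1 of one reference vector [p0], so
    their norms are at most [K], and changing [a k] into [c k *: a k] moves them by at most [K]
    times the distance of [c k] to 1. *)
Lemma exp_Z_limit_sub (a : nat -> 'rV[R]_n.+1) (c : nat -> R) x :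
  (forall k, (a k <= P)%MS) -> c @ ultra_oo --> (1 : R) ->
  (forall V, nbhs x V -> \forall k \near ultra_oo, exists2 y,
    V y & exp_Z (a k) y) ->
  forall V, nbhs x V -> \forall k \near ultra_oo,
    exists2 y, V y & exp_Z (c k *: a k) y.
Proof.
move=> aP c1 xl V Vx.
have [[A B] /= [Ax B1] AB] : nbhs (x, 1%g : G) [set z | V (z.1 * z.2)%g].
  by apply: (@mulg_continuous G (x, 1%g)); rewrite /= mulg1.
have [A' Ax' A'H] := exp_sub_close x ltr01.
pose proof (xl _ (filterI Ax Ax')) as xl'.
have [k0 [y0 [_ A'0] [m0 y0E]]] := filter_ex xl'; rewrite y0E in A'0.
set p0 := m0%:~R *: a k0 in A'0.
have p0P : (p0 <= P)%MS by exact: scalemx_sub.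
pose K := `|p0| + 1.
have {}A'H p : (p <= P)%MS -> A' (E p) -> `|p| <= K.
  move=> pP /(A'H p0 p p0P pP A'0) h; rewrite -(subrKC p0 p).
  by apply: le_trans (ler_normD _ _) _; rewrite lerD2l ltW.
have h : (fun p => E p) @ nbhs (0 : 'rV[R]_n.+1) --> 1%g.
  exact: (@lc_exp_cvg1 _ _ _ L hG _ (nbhs (0 :
    'rV[R]_n.+1)) _ id (@cvg_id _ _)).
have [d d0 dB] : exists2 d, 0 < d & forall p, `|p| < d -> B (E p).
  have [d d0 dB] := nbhs_rV_ball (h _ B1).
  by exists d => // p pd; apply: dB; rewrite subr0.
have K0 : 0 < K by rewrite ltr_wpDl.
have dK : 0 < d / K by rewrite divr_gt0.
have /cvgrPdist_lt/(_ _ dK) c1' := c1.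
apply: filterS2 xl' c1' => k [y [Ay A'y] [m yE]] ck; rewrite yE in Ay A'y.
exists (E (m%:~R *: (c k *: a k))); last by exists m.
have -> : m%:~R *: (c k *: a k) = m%:~R *: a k + (c k - 1) *: (m%:~R *: a k).
  by rewrite scalerBl scale1r subrKC !scalerA mulrC.
have maP : (m%:~R *: a k <= P)%MS by exact: scalemx_sub.
rewrite (exp_sub_expD hG cP) ?scalemx_sub//; apply: (AB (_, _)); split=> //=.
apply: dB; rewrite normrZ distrC.
apply: le_lt_trans (ler_wpM2l (normr_ge0 _) (A'H _ maP A'y)) _.
by rewrite -ltr_pdivlMr.
Qed.

Lemma not_expansive_injective : ~ expansive R (subA_action T).
Proof.
have [v vP v0] : exists2 v : 'rV[R]_n.+1, (v <= P)%MS & v != 0.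
  have /row_subPn[i Pi] : ~~ (P <= (0 : 'M[R]_n.+1))%MS.
    by rewrite submx0; exact: tangent_neq0 HP.
  by exists (row i P); [exact: row_sub|rewrite -submx0].
(* Strictly between 1 and 2, so [c k] is not an integer and, by injectivity, the subgroups generated
   by [v] and [c k *: v] differ. *)
pose c k : R := 1 + k.+2%:R^-1.
have c_gt0 k : 0 < c k by rewrite ltr_wpDr ?invr_ge0.
have cP' k : (c k *: v <= P)%MS by exact: scalemx_sub.
have c0 k : c k *: v != 0 by rewrite scaler_eq0 negb_or (gt_eqF (c_gt0 k)).
have c1 : c @ ultra_oo --> (1 : R).
  rewrite -[X in _ --> X]addr0; apply: cvgD; first exact: cvg_cst.
  apply: ultra_oo_cvg.
  have := @cvg_invS R; rewrite -(cvg_shiftS (fun k : nat => k.+1%:R^-1 : R)).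
  exact.
have cV1 : (fun k => (c k)^-1) @ ultra_oo --> (1 : R).
  by rewrite -[X in _ --> X]invr1; apply: cvgV.
apply: (@not_expansive_of_pairs R G hG T (fun=> exp_Z_subA vP v0)
  (fun k => exp_Z_subA (cP' k) (c0 k))).
  move=> k /(congr1 (fun B => members B)) => vc.
  have : exp_Z v (E (c k *: v)).
    rewrite -[exp_Z v]/(members (exp_Z_subA vP v0)) vc.
    by exists 1; rewrite scale1r.
  move=> [m /(exp_sub_inj (cP' k) (scalemx_sub _ vP))/eqP].
  rewrite -subr_eq0 -scalerBl scaler_eq0 (negbTE v0) orbF subr_eq0 => /eqP cm.
  have h1 : 1 < c k by rewrite ltrDl invr_gt0.
  have h2 : c k < 2%:R.
    by rewrite -[2%:R]/(1 + 1) ltrD2l invf_lt1// ltr1n.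
  move: h1 h2; rewrite cm -[1]/(1%:~R) -[2%:R]/(2%:~R) !ltr_int; lia.
move=> e.
have [a aP] : exists a : nat -> 'rV[R]_n.+1, forall k, (a k <= P)%MS /\
    forall t, homeo_iter T (e k) (E (t *: v)) = E (t *: a k).
  have H k := exp_sub_iter hG TE HP (e k) vP.
  have H' k : exists w : 'rV[R]_n.+1, (w <= P)%MS /\
     forall t, homeo_iter T (e k) (E (t *: v)) = E (t *: w).
    by have [w wP Hw] := H k; exists w.
  by have [a aP] := choice H'; exists a.
have a1 k : (a k <= P)%MS by have [] := aP k.
have aE k t : homeo_iter T (e k) (E (t *: v)) = E (t *: a k) by have [] := aP k.
have m1 k : members (homeo_iter (subA_action T) (e k) (exp_Z_subA vP v0)) =
  exp_Z (a k).
  rewrite members_subA_action -[members _]/(exp_Z v) -[v]scale1r -[a k]scale1r.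
  exact: exp_Z_image.
have m2 k : members (homeo_iter (subA_action T) (e k)
    (exp_Z_subA (cP' k) (c0 k))) = exp_Z (c k *: a k).
  by rewrite members_subA_action; exact: exp_Z_image.
apply/seteqP; split=> x xl V Vx.
- have : \forall k \near ultra_oo, exists2 y, V y & exp_Z (c k *: a k) y.
    apply: (exp_Z_limit_sub a1 c1) Vx => V' /xl; apply: filterS => k [y Vy].
    by rewrite m1; exists y.
  by apply: filterS => k [y Vy ay]; exists y; rewrite ?m2.
(* The converse inclusion is the same lemma for the vectors [c k *: a k] and the factors
   [(c k)^-1]. *)
- have : \forall k \near ultra_oo, exists2 y, V y &
      exp_Z ((c k)^-1 *: (c k *: a k)) y.
    apply: (exp_Z_limit_sub (a := fun k => c k *: a k) _ cV1) Vx.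
      by move=> k; exact: scalemx_sub.
    move=> V' /xl; apply: filterS => k [y Vy].
    by rewrite m2; exists y.
  apply: filterS => k [y Vy]; rewrite scalerA mulVf ?gt_eqF// scale1r => ay.
  by exists y; rewrite ?m1.
Qed.

End tangent_injective.

(** * Conclusion *)

Lemma local_chart_not_expansive (R : realType) (G : topologicalGroupType) n
    (L : local_chart R G n.+1) (T : top_aut G) :
  hausdorff_space G -> ~ expansive R (subA_action T).
Proof.
move=> hG.
have [M TE] := endomorphism_matrix L hG (@homeo_cont _ T) (@aut_morph _ T).
have [P HP] := exists_tangent hG TE.
have [[lam [lamP lam0 lamE]]|nolam] := pselect (exists lam : 'rV[R]_n.+1,
  [/\ (lam <= P)%MS, lam != 0 & lc_exp L lam = 1%g]).
  exact: (not_expansive_kernel hG TE HP lamP lam0 lamE).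
apply: (not_expansive_injective hG TE HP) => p pP pE.
by apply: contrapT => /eqP p0; apply: nolam; exists p.
Qed.

(** In dimension 0 the chart takes a single value, so its domain is the single point 1. The identity
    is then open and closed. *)
Lemma chart0_connected (R : realType) (G : topologicalGroupType)
    (A : chart R G 0) : hausdorff_space G -> connected [set: G] ->
  chart_dom A 1%g -> forall x : G, x = 1%g.
Proof.
move=> hG cG A1 x.
have dom1 : chart_dom A = [set 1%g].
  apply/seteqP; split=> [y yA|_ ->//].
  rewrite /= -(chart_mapK (mem_set yA)) -[RHS](chart_mapK (mem_set A1)).
  by congr (chart_inv A _); apply/rowP => -[].
have o1 : open [set (1%g : G)] by rewrite -dom1; exact: chart_dom_open.
have c1 : closed [set (1%g : G)].
  exact: accessible_closed_set1 (hausdorff_accessible hG) _.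
have : [set (1%g : G)] = [set: G].
  by apply: cG; [exists 1%g|exists [set 1%g]; rewrite ?setTI|
    exists [set 1%g]; rewrite ?setTI].
by move=> e; have : [set: G] x by []; rewrite -e.
Qed.

Theorem theorem3p1 (R : realType) (G : topologicalGroupType)
    (L : lie_structure R G) (G_connected : connected [set: G])
    (G_nontrivial : exists x : G, x <> 1%g) (T : top_aut G) :
  ~ expansive R (subA_action T).
Proof.
case: L => d hG _ atlas cover _ mul_smooth _.
have [A atlasA A1] := cover 1%g.
case: d atlas cover mul_smooth A atlasA A1 =>
  [|n] atlas cover mul_smooth A atlasA A1.
  by case: G_nontrivial => x []; exact: chart0_connected A1 x.
have [L] := local_chart_of_chart A1 (mul_smooth A A A atlasA atlasA atlasA).
exact: (local_chart_not_expansive L (T := T) hG).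
Qed.
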